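(* Let $\mathbf{F}$ be a finite field with $q$ elements and let $G$ be the infinite symplectic group over $\mathbf{F}$. Let $k$ be a field of characteristic $0$, let $t\in k$ be non-zero, and let $\mu_t$ be the $k$-valued measure on $G$ with $\mu_t(\mathbf{V})=t$. Then $\mu_t$ is equivalent to some ultraproduct measure, and in particular, satisfies condition (Nil).
   Context: **Group.** $\mathbf{V}$ is the $\mathbf{F}$-vector space with basis $\{e_i,f_i\}_{i\ge1}$ and alternating form $\langle e_i,e_j\rangle=\langle f_i,f_j\rangle=0$, $\langle e_i,f_j\rangle=\delta_{i,j}$. $G$ is the group of form-preserving linear automorphisms of $\mathbf{V}$, topologized by taking the pointwise stabilizers of finite subsets of $\mathbf{V}$ as a neighborhood basis of $1$. A $G$-set is a set with an action of $G$ having open stabilizers; it is finitary if it has finitely many orbits; the same terms are used for open subgroups $U\subset G$. $G(n)$ is the subgroup fixing $e_i,f_i$ for $i\le n$. **Measures.** A measure $\mu$ on $G$ valued in a commutative ring $k$ assigns to each map $f\colon Y\to X$ of transitive $G$-sets an element $\mu(f)\in k$ such that: (a) $\mu(f)=1$ if $f$ is an isomorphism; (b) $\mu(f\circ g)=\mu(f)\mu(g)$ for composable maps of transitive $G$-sets; (c) if $X'\to X$ is a map of transitive $G$-sets, $Y\times_XX'=\bigsqcup_iY'_i$ is the orbit decomposition and $f'_i\colon Y'_i\to X'$ is the projection, then $\mu(f)=\sum_i\mu(f'_i)$. There is a universal measure, valued in a commutative ring $\Theta(G)$ (generated by symbols $[f]$ subject to these relations), so $k$-valued measures correspond to ring homomorphisms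 $\Theta(G)\to k$. If $U\subset G$ is open and $Y$ is a transitive $U$-set put $\mu(Y)=\mu(G\times_UY\to G/U)$, extended additively to finitary $U$-sets (independent of shrinking $U$). For $k$ a field of characteristic $0$ and $t\in k$, there is a unique $k$-valued measure $\mu_t$ on $G$ with $\mu_t(\mathbf{V})=t$. **Equivalence.** Two measures on $G$ valued in (possibly different) fields of characteristic $0$ are equivalent if the corresponding homomorphisms from $\Theta(G)$ have the same kernel, i.e., define the same point of $\mathrm{Spec}\,\Theta(G)$. **Ultraproduct measures.** Let $\kappa_n$ ($n\in\mathbb{N}$) be fields, let $\mathcal{F}$ be a non-principal ultrafilter on $\mathbb{N}$, and suppose that the ultraproduct $\kappa$ of the $\kappa_n$ has characteristic $0$. For a map $f\colon Y\to X$ of transitive $G$-sets, for all but finitely many $n$ the set $X^{G(n)}$ is non-empty and all fibers of $Y^{G(n)}\to X^{G(n)}$ have the same finite cardinality $\nu_n(f)$. The associated ultraproduct measure is the $\kappa$-valued measure $f\mapsto(\nu_n(f))_n$. **(Nil).** For a measure $\mu$ valued in a field $k$ and a finitary $G$-set $X$, a Schwartz function on $X$ is a function $\phi\colon X\to k$ invariant under some open subgroup $U$ and supported on finitely many $U$-orbits, with $\int_X\phi(x)\,dx=\sum_{c\ne0}c\,\mu(\phi^{-1}(c))$. A $G$-invariant $X\times X$ matrix is a $G$-invariant function $A\colon X\times X\to k$; the product is $(BA)(z,x)=\int_XB(z,y)A(y,x)\,dy$ and the trace is $\int_XA(x,x)\,dx$. $\mu$ satisfies (Nil) if, for every finitary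 $G$-set $X$, every nilpotent $G$-invariant $X\times X$ matrix has trace $0$. *)

(* Defs.v *)
From HB Require Import structures.
From mathcomp Require Import all_boot all_algebra.
From mathcomp Require Import all_classical.

Set Implicit Arguments.
Unset Strict Implicit.
Unset Printing Implicit Defensive.

Import GRing.Theory.
Local Open Scope classical_set_scope.
Local Open Scope ring_scope.
Local Open Scope quotient_scope.

(* The space with basis e_i = ('X^i, 0), f_i = (0, 'X^i), for i >= 0. *)
Notation symp_space F := ({poly F} * {poly F})%type.

Definition basis_e (F : finFieldType) (i : nat) : symp_space F := ('X^i, 0).
Definition basis_f (F : finFieldType) (i : nat) : symp_space F := (0, 'X^i).

(* Coefficients beyond the size of a polynomial vanish, so this is the sum over
   all i of u.1_i v.2_i - u.2_i v.1_i. *)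
Definition symp_form (F : finFieldType) (u v : symp_space F) : F :=
  \sum_(i < maxn (size u.1) (size u.2)) (u.1`_i * v.2`_i - u.2`_i * v.1`_i).

Lemma symp_form_e (F : finFieldType) i (v : symp_space F) :
  symp_form (basis_e F i) v = v.2`_i.
Proof.
rewrite /symp_form /= size_polyXn size_poly0 maxn0 big_ord_recr /=.
rewrite coefXn eqxx coef0 mul1r mul0r subr0 big1 ?add0r// => j _.
by rewrite coefXn ltn_eqF// coef0 !mul0r subr0.
Qed.

Lemma symp_form_f (F : finFieldType) i (v : symp_space F) :
  symp_form (basis_f F i) v = - v.1`_i.
Proof.
rewrite /symp_form /= size_polyXn size_poly0 max0n big_ord_recr /=.
rewrite coefXn eqxx coef0 mul1r mul0r sub0r big1 ?add0r// => j _.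
by rewrite coefXn ltn_eqF// coef0 !mul0r subr0.
Qed.

Record symp_group (F : finFieldType) := SympGroup {
  sp_fun :> symp_space F -> symp_space F;
  sp_inv : symp_space F -> symp_space F;
  sp_funK : cancel sp_fun sp_inv;
  sp_invK : cancel sp_inv sp_fun;
  sp_linear : linear sp_fun;
  sp_form : forall u v, symp_form (sp_fun u) (sp_fun v) = symp_form u v
}.

Section SympGroup.
Variable F : finFieldType.
Notation V := (symp_space F).
Implicit Types g h : symp_group F.

Lemma symp_groupP g h : (forall v, g v = h v) -> g = h.
Proof.
case: g h => [f i fi fK fl ff] [f' i' fi' fK' fl' ff'] /= e.
have ef : f = f' by apply/funext.
subst f'; have ei : i = i'.
  by apply/funext => v; rewrite -[in LHS](fK' v) fi.
by subst i'; congr SympGroup; apply: Prop_irrelevance.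
Qed.

Definition sp_one : symp_group F.
Proof. by exists idfun idfun. Defined.

Definition sp_mul g h : symp_group F.
Proof.
exists (g \o h) (sp_inv h \o sp_inv g).
- by move=> v /=; rewrite !sp_funK.
- by move=> v /=; rewrite !sp_invK.
- by move=> a u v /=; rewrite !sp_linear.
- by move=> u v /=; rewrite !sp_form.
Defined.

Definition sp_opp g : symp_group F.
Proof.
exists (sp_inv g) g.
- exact: sp_invK.
- exact: sp_funK.
- move=> a u v; apply: (can_inj (sp_funK g)).
  by rewrite sp_linear !sp_invK.
- by move=> u v; rewrite -[LHS](sp_form g) !sp_invK.
Defined.

HB.instance Definition _ := gen_eqMixin (symp_group F).
HB.instance Definition _ := gen_choiceMixin (symp_group F).

Fact sp_mulA : associative sp_mul.
Proof. by move=> *; apply: symp_groupP. Qed.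
Fact sp_mul1 : left_id sp_one sp_mul.
Proof. by move=> *; apply: symp_groupP. Qed.
Fact sp_mulr1 : right_id sp_one sp_mul.
Proof. by move=> *; apply: symp_groupP. Qed.
Fact sp_mulV : left_inverse sp_one sp_opp sp_mul.
Proof. by move=> g; apply: symp_groupP => v /=; rewrite sp_funK. Qed.
Fact sp_mulrV : right_inverse sp_one sp_opp sp_mul.
Proof. by move=> g; apply: symp_groupP => v /=; rewrite sp_invK. Qed.

HB.instance Definition _ := isGroup.Build (symp_group F)
  sp_mulA sp_mul1 sp_mulr1 sp_mulV sp_mulrV.

Arguments sp_one : simpl never.
Arguments sp_mul : simpl never.
Arguments sp_opp : simpl never.

Lemma sp_mulE g h v : (g * h)%g v = g (h v). Proof. by []. Qed.
Lemma sp_1E v : (1%g : symp_group F) v = v. Proof. by []. Qed.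

End SympGroup.

Section GSets.
Variable F : finFieldType.
Notation V := (symp_space F).
Notation G := (symp_group F).
Local Open Scope group_scope.

(* The topology whose neighbourhoods of 1 are generated by the pointwise
   stabilizers of the finite subsets of V. *)
Definition sp_open (A : set G) : Prop :=
  forall g, A g -> exists s : seq V,
    forall h : G, (forall v, v \in s -> h v = v) -> A (g * h).

Record open_subgroup := OpenSubgroup {
  osg_set :> G -> Prop;
  osg_1 : osg_set 1;
  osg_M : forall g h, osg_set g -> osg_set h -> osg_set (g * h);
  osg_V : forall g, osg_set g -> osg_set g^-1;
  osg_open : sp_open osg_set
}.

Definition full_subgroup : open_subgroup.
Proof.
exists setT => //.
by move=> g _; exists [::].
Defined.

(* A U-set, with open stabilizers.  The values of the action off U are
   irrelevant; they only spare us the type of elements of U. *)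
Record gset (U : open_subgroup) := GSet {
  gs_car :> Type;
  gs_act : G -> gs_car -> gs_car;
  gs_act1 : forall x, gs_act 1 x = x;
  gs_actM : forall g h x, U g -> U h ->
    gs_act (g * h) x = gs_act g (gs_act h x);
  gs_open : forall x, sp_open [set g | U g /\ gs_act g x = x]
}.

Definition gs_orbit U (X : gset U) (x : X) : set X :=
  [set y | exists2 g, U g & y = gs_act g x].

Definition gs_stable U (X : gset U) (S : set X) : Prop :=
  forall g x, U g -> S x -> S (gs_act g x).

Definition gs_transitive U (X : gset U) : Prop :=
  exists x : X, gs_orbit x = setT.

Record trset U := TrSet {
  tr_gset :> gset U;
  tr_transitive : gs_transitive tr_gset
}.

Record gmap U (Y X : gset U) := GMap {
  gm_fun :> Y -> X;
  gm_equivariant : forall g y, U g -> gm_fun (gs_act g y) = gs_act g (gm_fun y)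
}.

(* (r i)_i picks one point in each of the n orbits of the stable subset S. *)
Definition orbit_decomposition U (X : gset U) (S : set X) n (r : 'I_n -> X) :=
  (forall i, S (r i)) /\ (forall x, S x -> exists! i, gs_orbit (r i) x).

Definition finitary U (X : gset U) : Prop :=
  exists n (r : 'I_n -> X), orbit_decomposition setT r.

Section Constructions.
Variable U : open_subgroup.

Lemma sp_open_conj (A : set G) (g : G) :
  sp_open A -> sp_open [set h | A (g^-1 * h * g)].
Proof.
move=> oA h /= /oA[s sP]; exists [seq g v | v <- s] => k ks /=.
have -> : g^-1 * (h * k) * g = (g^-1 * h * g) * (g^-1 * k * g).
  by rewrite !mulgA mulgK.
apply: sP => v vs; rewrite !sp_mulE ks ?map_f //.
by rewrite -sp_mulE mulVg.
Qed.

Lemma sp_openI (A B : set G) : sp_open A -> sp_open B -> sp_open (A `&` B).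
Proof.
move=> oA oB g [/oA[s sP] /oB[t tP]]; exists (s ++ t) => h st; split.
  by apply: sP => v vs; apply: st; rewrite mem_cat vs.
by apply: tP => v vt; apply: st; rewrite mem_cat vt orbT.
Qed.

Lemma gs_actVK (X : gset U) (g : G) (x : X) : U g -> gs_act g^-1 (gs_act g x) = x.
Proof.
by move=> Ug; rewrite -gs_actM ?mulVg ?gs_act1//; apply: osg_V.
Qed.

Lemma gs_actKV (X : gset U) (g : G) (x : X) : U g -> gs_act g (gs_act g^-1 x) = x.
Proof.
by move=> Ug; rewrite -gs_actM ?mulgV ?gs_act1//; apply: osg_V.
Qed.

Definition stabilizer (X : gset U) (x : X) : open_subgroup.
Proof.
exists [set g | U g /\ gs_act g x = x].
- by split; [exact: osg_1|exact: gs_act1].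
- by move=> g h [Ug gx] [Uh hx]; split; [exact: osg_M|rewrite gs_actM// hx].
- by move=> g [Ug gx]; split; [exact: osg_V|rewrite -[in LHS]gx gs_actVK].
- exact: gs_open.
Defined.

Definition prod_gset (X Y : gset U) : gset U.
Proof.
exists (X * Y)%type (fun g p => (gs_act g p.1, gs_act g p.2)).
- by case=> x y /=; rewrite !gs_act1.
- by move=> g h [x y] Ug Uh /=; rewrite !gs_actM.
- move=> [x y] /=.
  rewrite (_ : mkset _ = [set g | U g /\ gs_act g x = x] `&`
                         [set g | U g /\ gs_act g y = y]).
    by apply: sp_openI; exact: gs_open.
  apply/seteqP; split=> g /=; first by move=> [? [-> ->]].
  by move=> [[? ->] [_ ->]].
Defined.

Lemma insubd_act (X : gset U) (S : set X) (y : S) g :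
  gs_stable S -> U g -> val (insubd y (gs_act g (val y))) = gs_act g (val y).
Proof.
move=> St Ug; rewrite val_insubd ifT//; apply: mem_set.
by apply: St => //; exact: set_valP.
Qed.

(* A stable subset as a U-set; the default value of insubd only matters off U. *)
Definition sub_gset (X : gset U) (S : set X) (St : gs_stable S) : gset U.
Proof.
exists (set_type S) (fun g y => insubd y (gs_act g (val y))).
- move=> x; apply: val_inj; rewrite insubd_act ?gs_act1//; exact: osg_1.
- move=> g h x Ug Uh; apply: val_inj; rewrite !insubd_act//; last exact: osg_M.
  by rewrite gs_actM.
- move=> x; rewrite (_ : mkset _ = [set g | U g /\ gs_act g (val x) = val x]).
    exact: gs_open.
  apply/seteqP; split=> g /= [Ug gx]; split => //.
    by rewrite -[in RHS]gx insubd_act.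
  by apply: val_inj; rewrite insubd_act.
Defined.

Lemma sub_gsetE (X : gset U) (S : set X) (St : gs_stable S) g
    (y : sub_gset St) : U g -> val (gs_act g y) = gs_act g (val y).
Proof. exact: insubd_act. Qed.

Lemma orbit_stable (X : gset U) (x : X) : gs_stable (gs_orbit x).
Proof.
move=> g _ Ug [h Uh ->]; exists (g * h); first exact: osg_M.
by rewrite gs_actM.
Qed.

Lemma orbit_refl (X : gset U) (x : X) : gs_orbit x x.
Proof. by exists 1; [exact: osg_1|rewrite gs_act1]. Qed.

Definition orbit_trset (X : gset U) (x : X) : trset U.
Proof.
exists (sub_gset (@orbit_stable X x)).
exists (SigSub (mem_set (orbit_refl x))).
apply/seteqP; split => // y _.
have [g Ug yE] := set_valP y.
by exists g => //; apply: val_inj; rewrite sub_gsetE.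
Defined.

Definition gcomp (Z Y X : gset U) (f : gmap Y X) (g : gmap Z Y) : gmap Z X.
Proof.
exists (f \o g) => h z Uh /=.
by rewrite !gm_equivariant.
Defined.

End Constructions.

Definition vector_gset : gset full_subgroup.
Proof.
exists V (fun g v => g v) => //.
move=> v g [_ gv]; exists [:: v] => h hv; split=> //.
by rewrite sp_mulE hv ?mem_head.
Defined.

Section Induction.
Variable U : open_subgroup.

Definition lcoset_set (g : G) : set G := [set k | exists2 u, U u & k = g * u].

Lemma lcoset_set_act h g : [set k | lcoset_set g (h^-1 * k)] = lcoset_set (h * g).
Proof.
apply/seteqP; split=> k /= [u Uu kE]; exists u => //.
  by rewrite -mulgA -kE mulVKg.
by rewrite kE -!mulgA mulKg.
Qed.

Lemma lcoset_set_eq g g' : lcoset_set g = lcoset_set g' <-> U (g^-1 * g').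
Proof.
split=> [e|Ug].
  have : lcoset_set g g'.
    by rewrite e; exists 1; [exact: osg_1|rewrite mulg1].
  by case=> u Uu ->; rewrite mulKg.
apply/seteqP; split=> k [u Uu ->].
  exists ((g^-1 * g')^-1 * u); first by apply: osg_M => //; apply: osg_V.
  by rewrite invgM invgK !mulgA mulgV mul1g.
exists (g^-1 * g' * u); first exact: osg_M.
by rewrite !mulgA mulgV mul1g.
Qed.

Lemma coset_act_subproof (h : G) (A : set_type (range lcoset_set)) :
  [set k | val A (h^-1 * k)] \in range lcoset_set.
Proof.
apply: mem_set; case: (set_valP A) => g _ <-.
by exists (h * g) => //; rewrite lcoset_set_act.
Qed.

Definition coset_gset : gset full_subgroup.
Proof.
exists (set_type (range lcoset_set)) (fun h A => SigSub (coset_act_subproof h A)).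
- by move=> A; apply: val_inj; apply/funext => k /=; rewrite invg1 mul1g.
- move=> g h A _ _; apply: val_inj; apply/funext => k /=.
  by rewrite invgM mulgA.
- move=> A; have [g _ gA] := set_valP A.
  rewrite (_ : mkset _ = [set h | U (g^-1 * h * g)]).
    by apply: sp_open_conj; exact: osg_open.
  apply/seteqP; split=> h /= => [[_ /(congr1 val)/=]|Uh].
    rewrite -gA lcoset_set_act => /esym /lcoset_set_eq.
    by rewrite mulgA.
  split => //; apply: val_inj => /=; rewrite -gA lcoset_set_act.
  by apply/esym/lcoset_set_eq; rewrite mulgA.
Defined.

Lemma coset_transitive : gs_transitive coset_gset.
Proof.
exists (SigSub (mem_set (imageT lcoset_set 1))).
apply/seteqP; split=> // A _; have [g _ gA] := set_valP A.
by exists g => //; apply: val_inj; rewrite /= -gA lcoset_set_act mulg1.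
Qed.

Definition coset_trset := TrSet coset_transitive.

Variable Y : trset U.

(* The class of p in G x_U Y, where (g u, y) ~ (g, u y) for u in U. *)
Definition induced_class (p : G * Y) : set (G * Y) :=
  [set q | exists2 u, U u & q = (p.1 * u, gs_act u^-1 p.2)].

Lemma induced_class_act h p :
  [set q | induced_class p (h^-1 * q.1, q.2)] = induced_class (h * p.1, p.2).
Proof.
apply/seteqP; split=> -[k y] /= [u Uu /pair_equal_spec[kE ->]];
  exists u => //; congr pair.
  by rewrite -mulgA -kE mulVKg.
by rewrite kE -!mulgA mulKg.
Qed.

Lemma induced_class_eq g y g' y' : induced_class (g, y) = induced_class (g', y') <->
  U (g^-1 * g') /\ gs_act (g^-1 * g') y' = y.
Proof.
split=> [e|[Ug yE]].
  have : induced_class (g, y) (g', y').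
    rewrite e; exists 1; first exact: osg_1.
    by rewrite /= mulg1 invg1 gs_act1.
  by case=> u Uu /pair_equal_spec[-> ->]; rewrite mulKg gs_actKV.
have UVg := osg_V Ug.
apply/seteqP; split=> -[k z] [u Uu /pair_equal_spec[-> ->]] /=.
  exists ((g^-1 * g')^-1 * u); first exact: osg_M.
  congr pair; first by rewrite /= invgM invgK !mulgA mulgV mul1g.
  by rewrite /= invgM invgK gs_actM ?yE//; exact: osg_V.
exists (g^-1 * g' * u); first exact: osg_M.
congr pair; first by rewrite /= !mulgA mulgV mul1g.
by rewrite /= invgM gs_actM//; [rewrite -yE gs_actVK|exact: osg_V].
Qed.

Lemma induced_act_subproof (h : G) (A : set_type (range induced_class)) :
  [set q | val A (h^-1 * q.1, q.2)] \in range induced_class.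
Proof.
apply: mem_set; case: (set_valP A) => p _ <-.
by exists (h * p.1, p.2) => //; rewrite induced_class_act.
Qed.

Definition induced_gset : gset full_subgroup.
Proof.
exists (set_type (range induced_class))
       (fun h A => SigSub (induced_act_subproof h A)).
- move=> A; apply: val_inj; apply/funext => -[k y] /=.
  by rewrite invg1 mul1g.
- move=> g h A _ _; apply: val_inj; apply/funext => -[k y] /=.
  by rewrite invgM mulgA.
- move=> A; have [[g y] _ gA] := set_valP A.
  rewrite (_ : mkset _ = [set h | [set u | U u /\ gs_act u y = y] (g^-1 * h * g)]).
    by apply: sp_open_conj; exact: gs_open.
  apply/seteqP; split=> h /= => [[_ /(congr1 val)/=]|Uh].
    rewrite -gA induced_class_act => /esym /induced_class_eq.
    by rewrite mulgA.
  split => //; apply: val_inj => /=; rewrite -gA induced_class_act.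
  by apply/esym/induced_class_eq; rewrite mulgA.
Defined.

Lemma induced_transitive : gs_transitive induced_gset.
Proof.
have [y0 y0T] := tr_transitive Y.
exists (SigSub (mem_set (imageT induced_class (1, y0)))).
apply/seteqP; split=> // A _; have [[g y] _ gA] := set_valP A.
have [u Uu yE] : gs_orbit y0 y by rewrite y0T.
exists (g * u) => //; apply: val_inj; rewrite /= -gA induced_class_act /= mulg1.
by apply/induced_class_eq; rewrite mulKg yE.
Qed.

Definition induced_trset := TrSet induced_transitive.

Lemma induced_map_subproof (A : induced_gset) :
  fst @` val A \in range lcoset_set.
Proof.
apply: mem_set; have [[g y] _ <-] := set_valP A; exists g => //.
apply/seteqP; split=> [k [u Uu ->]|_ [_ [u Uu ->] <-]]; last by exists u.
by exists (g * u, gs_act u^-1 y) => //; exists u.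
Qed.

(* G x_U Y -> G/U, [g, y] |-> g U *)
Definition induced_map : gmap induced_trset coset_trset.
Proof.
exists (fun A => SigSub (induced_map_subproof A)).
move=> h A _; apply: val_inj; apply/seteqP; split=> k /=.
  by move=> [[g y] /= ? <-]; exists (h^-1 * g, y).
by move=> [[g y] /= Ay ghk]; exists (h * g, y); rewrite /= ?mulKg// ghk mulVKg.
Defined.

End Induction.

Definition res_gset (U : open_subgroup) (X : gset full_subgroup) : gset U.
Proof.
exists X (@gs_act _ X).
- exact: gs_act1.
- by move=> g h x _ _; exact: gs_actM.
- move=> x; rewrite (_ : mkset _ = U `&` [set g | full_subgroup g /\ gs_act g x = x]).
    by apply: sp_openI; [exact: osg_open|exact: gs_open].
  by apply/seteqP; split=> g /=; [move=> []|move=> [? []]].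
Defined.

Definition fiber_product (Y X X' : gset full_subgroup) (f : gmap Y X) (h : gmap X' X) :
    set (prod_gset Y X') :=
  [set p | f p.1 = h p.2].

Definition orbit_snd (Y X' : gset full_subgroup) (p : prod_gset Y X') :
  gmap (orbit_trset p) X'.
Proof.
exists (fun q => (val q).2).
move=> g q Ug.
exact: (congr1 snd (@sub_gsetE _ _ _ (@orbit_stable _ _ p) g q Ug)).
Defined.

End GSets.

Notation Gset F := (gset (full_subgroup F)).
Notation trGset F := (trset (full_subgroup F)).

(* The fiber product in ms_base always has finitely many orbits, because open
   subgroups of G have finitely many orbits on transitive G-sets. *)
Record measure (F : finFieldType) (k : comPzRingType) := Measure {
  ms_fun :> forall Y X : trGset F, gmap Y X -> k;
  ms_iso : forall (Y X : trGset F) (f : gmap Y X), bijective f -> ms_fun f = 1;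
  ms_comp : forall (Z Y X : trGset F) (f : gmap Y X) (g : gmap Z Y),
    ms_fun (gcomp f g) = ms_fun f * ms_fun g;
  ms_base : forall (Y X X' : trGset F) (f : gmap Y X) (h : gmap X' X)
      n (r : 'I_n -> prod_gset Y X'),
    orbit_decomposition (fiber_product f h) r ->
    ms_fun f = \sum_(i < n) ms_fun (orbit_snd (r i))
}.

Section Theta.
Variable F : finFieldType.

(* Ring expressions in the symbols [f]; Theta is their quotient by theta_rel,
   the smallest congruence that contains the axioms of commutative rings and
   of measures. *)
Inductive theta_expr : Type :=
| TSym (Y X : trGset F) (f : gmap Y X)
| TZero | TOne
| TOpp (a : theta_expr)
| TAdd (a b : theta_expr)
| TMul (a b : theta_expr).

Inductive theta_rel : theta_expr -> theta_expr -> Prop :=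
| theta_refl a : theta_rel a a
| theta_sym a b : theta_rel a b -> theta_rel b a
| theta_trans a b c : theta_rel a b -> theta_rel b c -> theta_rel a c
| theta_congN a a' : theta_rel a a' -> theta_rel (TOpp a) (TOpp a')
| theta_congD a a' b b' : theta_rel a a' -> theta_rel b b' ->
    theta_rel (TAdd a b) (TAdd a' b')
| theta_congM a a' b b' : theta_rel a a' -> theta_rel b b' ->
    theta_rel (TMul a b) (TMul a' b')
| theta_addA a b c : theta_rel (TAdd a (TAdd b c)) (TAdd (TAdd a b) c)
| theta_addC a b : theta_rel (TAdd a b) (TAdd b a)
| theta_add0 a : theta_rel (TAdd TZero a) a
| theta_addN a : theta_rel (TAdd (TOpp a) a) TZero
| theta_mulA a b c : theta_rel (TMul a (TMul b c)) (TMul (TMul a b) c)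
| theta_mulC a b : theta_rel (TMul a b) (TMul b a)
| theta_mul1 a : theta_rel (TMul TOne a) a
| theta_mulD a b c :
    theta_rel (TMul (TAdd a b) c) (TAdd (TMul a c) (TMul b c))
| theta_iso (Y X : trGset F) (f : gmap Y X) : bijective f ->
    theta_rel (TSym f) TOne
| theta_comp (Z Y X : trGset F) (f : gmap Y X) (g : gmap Z Y) :
    theta_rel (TSym (gcomp f g)) (TMul (TSym f) (TSym g))
| theta_base (Y X X' : trGset F) (f : gmap Y X) (h : gmap X' X)
    n (r : 'I_n -> prod_gset Y X') :
    orbit_decomposition (fiber_product f h) r ->
    theta_rel (TSym f) (\big[TAdd/TZero]_(i < n) TSym (orbit_snd (r i))).

(* An equivalence class.  For universe reasons (theta_expr quantifies over all
   transitive G-sets) Theta cannot be built with classical_sets, nor be given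
   a canonical ring structure; its ring laws are the facts theta_addrA, ...,
   theta_mulrDl below. *)
Record Theta : Type := MkTheta {
  theta_mem : theta_expr -> Prop;
  theta_memP : exists a, theta_mem = theta_rel a
}.

Definition theta_class (a : theta_expr) : Theta :=
  MkTheta (ex_intro _ a erefl).

Definition theta_repr (x : Theta) : theta_expr := projT1 (cid (theta_memP x)).

Lemma theta_reprK x : theta_class (theta_repr x) = x.
Proof.
rewrite /theta_class /theta_repr; case: cid => a /= xa.
by case: x xa => P Pa /= xa; subst P; congr MkTheta; apply: Prop_irrelevance.
Qed.

Lemma theta_classP a b : theta_class a = theta_class b <-> theta_rel a b.
Proof.
split=> [e|ab].
  have -> : theta_rel a = theta_rel b by exact: (congr1 theta_mem e).
  exact: theta_refl.
rewrite /theta_class; suff e : theta_rel a = theta_rel b.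
  move: (ex_intro _ a _) (ex_intro _ b _); rewrite e => p q.
  by congr MkTheta; apply: Prop_irrelevance.
apply/funext => c; apply/propext; split; apply: theta_trans => //.
exact: theta_sym.
Qed.

Lemma theta_repr_class a : theta_rel (theta_repr (theta_class a)) a.
Proof. by apply/theta_classP; exact: theta_reprK. Qed.

Definition theta_zero := theta_class TZero.
Definition theta_one := theta_class TOne.
Definition theta_opp x := theta_class (TOpp (theta_repr x)).
Definition theta_add x y := theta_class (TAdd (theta_repr x) (theta_repr y)).
Definition theta_mul x y := theta_class (TMul (theta_repr x) (theta_repr y)).

Lemma theta_oppE a : theta_opp (theta_class a) = theta_class (TOpp a).
Proof. by apply/theta_classP/theta_congN/theta_repr_class. Qed.

Lemma theta_addE a b :
  theta_add (theta_class a) (theta_class b) = theta_class (TAdd a b).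
Proof. by apply/theta_classP/theta_congD; exact: theta_repr_class. Qed.

Lemma theta_mulE a b :
  theta_mul (theta_class a) (theta_class b) = theta_class (TMul a b).
Proof. by apply/theta_classP/theta_congM; exact: theta_repr_class. Qed.

Let thetaE := (theta_oppE, theta_addE, theta_mulE).

Fact theta_addrA : associative theta_add.
Proof.
move=> x y z; rewrite -(theta_reprK x) -(theta_reprK y) -(theta_reprK z) !thetaE.
exact/theta_classP/theta_addA.
Qed.
Fact theta_addrC : commutative theta_add.
Proof. by move=> x y; exact/theta_classP/theta_addC. Qed.
Fact theta_add0r : left_id theta_zero theta_add.
Proof.
by move=> x; rewrite -(theta_reprK x) !thetaE; exact/theta_classP/theta_add0.
Qed.
Fact theta_addNr : left_inverse theta_zero theta_opp theta_add.
Proof.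
by move=> x; rewrite -(theta_reprK x) !thetaE; exact/theta_classP/theta_addN.
Qed.
Fact theta_mulrA : associative theta_mul.
Proof.
move=> x y z; rewrite -(theta_reprK x) -(theta_reprK y) -(theta_reprK z) !thetaE.
exact/theta_classP/theta_mulA.
Qed.
Fact theta_mulrC : commutative theta_mul.
Proof. by move=> x y; exact/theta_classP/theta_mulC. Qed.
Fact theta_mul1r : left_id theta_one theta_mul.
Proof.
by move=> x; rewrite -(theta_reprK x) !thetaE; exact/theta_classP/theta_mul1.
Qed.
Fact theta_mulrDl : left_distributive theta_mul theta_add.
Proof.
move=> x y z; rewrite -(theta_reprK x) -(theta_reprK y) -(theta_reprK z) !thetaE.
exact/theta_classP/theta_mulD.
Qed.

(* The homomorphism Theta -> k corresponding to a measure. *)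
Section Hom.
Variables (k : comPzRingType) (mu : measure F k).

Fixpoint theta_eval (a : theta_expr) : k :=
  match a with
  | TSym _ _ f => mu _ _ f
  | TZero => 0
  | TOne => 1
  | TOpp a => - theta_eval a
  | TAdd a b => theta_eval a + theta_eval b
  | TMul a b => theta_eval a * theta_eval b
  end.

Definition theta_hom (x : Theta) : k := theta_eval (theta_repr x).

Lemma theta_eval_rel a b : theta_rel a b -> theta_eval a = theta_eval b.
Proof.
elim=> //=.
- by move=> ? ? ? _ -> _ ->.
- by move=> ? ? _ ->.
- by move=> ? ? ? ? _ -> _ ->.
- by move=> ? ? ? ? _ -> _ ->.
- by move=> *; exact: addrA.
- by move=> *; exact: addrC.
- by move=> *; exact: add0r.
- by move=> *; exact: addNr.
- by move=> *; exact: mulrA.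
- by move=> *; exact: mulrC.
- by move=> *; exact: mul1r.
- by move=> *; exact: mulrDl.
- by move=> *; exact: ms_iso.
- by move=> *; exact: ms_comp.
- move=> Y X X' f h n r /ms_base ->.
  by rewrite (big_morph theta_eval (id1 := 0) (op1 := +%R)).
Qed.

Lemma theta_homE a : theta_hom (theta_class a) = theta_eval a.
Proof. exact/theta_eval_rel/theta_repr_class. Qed.

Lemma theta_hom_sym (Y X : trGset F) (f : gmap Y X) :
  theta_hom (theta_class (TSym f)) = mu _ _ f.
Proof. by rewrite theta_homE. Qed.

Lemma theta_hom1 : theta_hom theta_one = 1.
Proof. by rewrite theta_homE. Qed.

Lemma theta_homD : {morph theta_hom : x y / theta_add x y >-> x + y}.
Proof. by move=> x y; rewrite theta_homE. Qed.

Lemma theta_homM : {morph theta_hom : x y / theta_mul x y >-> x * y}.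
Proof. by move=> x y; rewrite theta_homE. Qed.

End Hom.

End Theta.

Definition equivalent_measures (F : finFieldType) (k k' : fieldType)
    (mu : measure F k) (nu : measure F k') : Prop :=
  forall x : Theta F, theta_hom mu x = 0 <-> theta_hom nu x = 0.

Section Ultraproduct.
Variables (kappa : nat -> fieldType) (D : set_system nat) (UD : UltraFilter D).
Implicit Types a b c : forall n, kappa n.

Definition ultra_rel a b : bool := `[< D [set n | a n = b n] >].

Lemma ultra_rel_equiv : equiv_class_of ultra_rel.
Proof.
split=> [a|a b|b a c].
- by apply/asboolP/filterE.
- by apply/asboolP/asboolP; apply: filterS => n /esym.
- by move=> /asboolP ab /asboolP bc; apply/asboolP;
    apply: filterS2 ab bc => n /= -> ->.
Qed.

Canonical ultra_equiv := EquivRelPack ultra_rel_equiv.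

Definition ultraproduct : Type := {eq_quot ultra_equiv}.

HB.instance Definition _ := Choice.on ultraproduct.

Definition ultra_class a : ultraproduct := \pi_({eq_quot ultra_equiv}) a.
Definition ultra_repr (x : ultraproduct) : forall n, kappa n :=
  repr (x : {eq_quot ultra_equiv}).

Lemma ultra_reprK x : ultra_class (ultra_repr x) = x.
Proof. exact: reprK. Qed.

Lemma ultra_classP a b : ultra_class a = ultra_class b <-> D [set n | a n = b n].
Proof.
by split=> [/eqmodP/asboolP|?]; last by apply/eqmodP/asboolP.
Qed.

Lemma ultra_repr_class a : D [set n | ultra_repr (ultra_class a) n = a n].
Proof. exact/ultra_classP/ultra_reprK. Qed.

Definition ultra_zero := ultra_class (fun=> 0).
Definition ultra_one := ultra_class (fun=> 1).
Definition ultra_opp x := ultra_class (fun n => - ultra_repr x n).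
Definition ultra_add x y :=
  ultra_class (fun n => ultra_repr x n + ultra_repr y n).
Definition ultra_mul x y :=
  ultra_class (fun n => ultra_repr x n * ultra_repr y n).
Definition ultra_inv x := ultra_class (fun n => (ultra_repr x n)^-1).

Lemma ultra_oppE a : ultra_opp (ultra_class a) = ultra_class (fun n => - a n).
Proof.
by apply/ultra_classP; apply: filterS (ultra_repr_class a) => n /= ->.
Qed.

Lemma ultra_invE a : ultra_inv (ultra_class a) = ultra_class (fun n => (a n)^-1).
Proof.
by apply/ultra_classP; apply: filterS (ultra_repr_class a) => n /= ->.
Qed.

Lemma ultra_addE a b :
  ultra_add (ultra_class a) (ultra_class b) = ultra_class (fun n => a n + b n).
Proof.
apply/ultra_classP.
by apply: filterS2 (ultra_repr_class a) (ultra_repr_class b) => n /= -> ->.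
Qed.

Lemma ultra_mulE a b :
  ultra_mul (ultra_class a) (ultra_class b) = ultra_class (fun n => a n * b n).
Proof.
apply/ultra_classP.
by apply: filterS2 (ultra_repr_class a) (ultra_repr_class b) => n /= -> ->.
Qed.

Let ultraE := (ultra_oppE, ultra_invE, ultra_addE, ultra_mulE).

Local Ltac ultra_law law :=
  repeat (let x := fresh in move=> x; rewrite -(ultra_reprK x));
  rewrite !ultraE; apply/ultra_classP; apply: filterE => n /=; exact: law.

Fact ultra_addrA : associative ultra_add. Proof. ultra_law addrA. Qed.
Fact ultra_addrC : commutative ultra_add. Proof. ultra_law addrC. Qed.
Fact ultra_add0r : left_id ultra_zero ultra_add. Proof. ultra_law add0r. Qed.
Fact ultra_addNr : left_inverse ultra_zero ultra_opp ultra_add.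
Proof. ultra_law addNr. Qed.
Fact ultra_mulrA : associative ultra_mul. Proof. ultra_law mulrA. Qed.
Fact ultra_mulrC : commutative ultra_mul. Proof. ultra_law mulrC. Qed.
Fact ultra_mul1r : left_id ultra_one ultra_mul. Proof. ultra_law mul1r. Qed.
Fact ultra_mulrDl : left_distributive ultra_mul ultra_add.
Proof. ultra_law mulrDl. Qed.
Fact ultra_oner_neq0 : ultra_one != ultra_zero.
Proof.
apply/eqP => /ultra_classP D10; apply: (@filter_not_empty _ D _).
by apply: filterS D10 => n /= /eqP; rewrite oner_eq0.
Qed.

HB.instance Definition _ := GRing.isZmodule.Build ultraproduct
  ultra_addrA ultra_addrC ultra_add0r ultra_addNr.
HB.instance Definition _ := GRing.Zmodule_isComNzRing.Build ultraproduct
  ultra_mulrA ultra_mulrC ultra_mul1r ultra_mulrDl ultra_oner_neq0.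

Fact ultra_mulVr (x : ultraproduct) : x != 0 -> ultra_inv x * x = 1.
Proof.
rewrite -(ultra_reprK x); set a := ultra_repr x => a0.
rewrite [LHS](_ : _ = ultra_mul (ultra_inv (ultra_class a)) (ultra_class a))//.
rewrite !ultraE; apply/ultra_classP.
have [Da|Dna] := in_ultra_setVsetC [set n | a n = 0] UD.
  by case/eqP: a0; apply/ultra_classP.
by apply: filterS Dna => n /= /eqP /mulVf.
Qed.

Fact ultra_invr0 : ultra_inv 0 = 0.
Proof.
by rewrite ultra_invE; apply/ultra_classP/filterE => n; rewrite /= invr0.
Qed.

HB.instance Definition _ := GRing.ComNzRing_isField.Build ultraproduct
  ultra_mulVr ultra_invr0.

End Ultraproduct.

Section UltraproductMeasure.
Variable F : finFieldType.

(* G(n); the basis vectors are numbered from 0 here. *)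
Definition symp_fix (n : nat) : set (symp_group F) :=
  [set g | forall i, (i < n)%N ->
    g (basis_e F i) = basis_e F i /\ g (basis_f F i) = basis_f F i].

Definition fixed_points (n : nat) (X : Gset F) : set X :=
  [set x | forall g, symp_fix n g -> gs_act g x = x].
Arguments fixed_points : clear implicits.

Definition fiber_card (Y X : Gset F) (f : gmap Y X) (n m : nat) : Prop :=
  fixed_points n X !=set0 /\
  forall x, fixed_points n X x ->
    ([set y | fixed_points n Y y /\ f y = x] #= `I_m)%card.

Definition is_ultraproduct_measure (kappa : nat -> fieldType)
    (D : set_system nat) (UD : UltraFilter D)
    (nu : measure F (ultraproduct kappa UD)) : Prop :=
  forall (Y X : trGset F) (f : gmap Y X), exists2 m : nat -> nat,
    \forall n \near \oo, fiber_card f n (m n) &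
    nu Y X f = ultra_class UD (fun n => (m n)%:R).

End UltraproductMeasure.

Section Nil.
Variables (F : finFieldType) (k : fieldType) (mu : measure F k).

Definition tr_vol (U : open_subgroup F) (Y : trset U) : k :=
  mu _ _ (induced_map Y).

(* mu(S) for a stable subset S of the U-set X: the sum of the measures of the
   U-orbits in S, which does not depend on the points picked in them. *)
Definition vol (U : open_subgroup F) (X : gset U) (S : set X) : k :=
  xget 0 [set v | exists n (r : 'I_n -> X), orbit_decomposition S r /\
    v = \sum_(i < n) tr_vol (orbit_trset (r i))].

(* The integral of a Schwartz function phi on X that is invariant under U; the
   choice of U does not affect the value. *)
Definition integral (U : open_subgroup F) (X : Gset F) (phi : X -> k) : k :=
  \sum_(c \in [set c : k | c != 0])
    c * vol (phi @^-1` [set c] : set (res_gset U X)).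

Definition invariant_mx (X : Gset F) (A : X -> X -> k) : Prop :=
  forall g y x, A (gs_act g y) (gs_act g x) = A y x.

(* The integrand is invariant under the stabilizer of (z, x). *)
Definition mulmx_gset (X : Gset F) (B A : X -> X -> k) : X -> X -> k :=
  fun z x => integral (stabilizer ((z, x) : prod_gset X X))
               (fun y => B z y * A y x).

Definition trace_gset (X : Gset F) (A : X -> X -> k) : k :=
  integral (full_subgroup F) (fun x => A x x).

(* iter n (mulmx_gset A) A is the power A^(n+1). *)
Definition nilpotent_gset (X : Gset F) (A : X -> X -> k) : Prop :=
  exists n, forall z x, iter n (mulmx_gset A) A z x = 0.

Definition nil_condition : Prop :=
  forall X : Gset F, finitary X ->
  forall A : X -> X -> k, invariant_mx A -> nilpotent_gset A ->
  trace_gset A = 0.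

End Nil.

(* Main.v *)
Require Import Defs.
From mathcomp Require Import all_boot all_order all_algebra.
From mathcomp Require Import closed_field algC cyclic zify ring.
From mathcomp Require Import all_classical.

Set Implicit Arguments.
Unset Strict Implicit.
Unset Printing Implicit Defensive.

Import GRing.Theory.
Local Open Scope classical_set_scope.
Local Open Scope ring_scope.

(** Write [q] for the number of elements of [F], [V] for the symplectic space and
    [t] for the volume of [V]. The number of points of [V] fixed by [G(n)] is
    [q ^ (2 * n)], and the proof compares [t] with these numbers.

    An open subgroup [U] of [G] has a core, the least finite-dimensional subspace
    whose pointwise stabilizer lies in [U] ([core_exists]); this rests on the fact
    that the stabilizers of two subspaces generate the stabilizer of their
    intersection ([fixator_cap]), which is proved with transvections. The
    stabilizer of the core has finite index in [U], and the core makes everything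
    about transitive [G]-sets computable.

    First, a measure with values in characteristic [0] is determined by [t]
    ([universal_idx]). The vectors with given products against a subspace of [V]
    form a fibre of a map to a finite set, translations identify the fibres, and
    so each has volume [t] divided by their number; removing the finitely many
    vectors of the subspace leaves an orbit. Every value of the measure is a
    product of such volumes, up to indices of finite-index subgroups, hence a
    polynomial in [t] with rational coefficients that does not depend on the
    measure.

    Next, the points of a transitive [G]-set fixed by [G(n)] are permuted
    transitively by the normalizer of [G(n)] for large [n]
    ([fixed_transitive]), so that the fibre counts define ultraproduct measures
    ([ultra_measure]). Universality over ultrapowers of the rationals shows that
    these counts are the values at [q ^ (2 * n)] of the universal polynomials,
    for large [n] ([universal_count]).

    Finally, finitely generated subrings of [k] containing [t] have homomorphisms
    to fields that map [t] to [q ^ (2 * n)], with [n] as large as desired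
    ([specialization_exists]). If [t] is transcendental this is possible in
    characteristic [0]; if it is algebraic, reduce modulo primes dividing the
    values of its minimal polynomial at even powers of [q], of which there are
    infinitely many because [t] is not zero ([prime_divisor_exists]). The
    extension to the other generators is Chevalley's theorem
    ([specialize_extend]).

    Both claims follow. Choosing for each [n] a field in which [q ^ (2 * n)]
    satisfies the relations of [t] and avoids more and more of the others, one
    gets an ultraproduct in which the class of the [q ^ (2 * n)] satisfies exactly
    the relations of [t]; by universality the ultraproduct measure has the same
    kernel as the given one. For (Nil), a specialization turns products and
    traces of invariant matrices into those of finite matrices indexed by the
    points fixed by [G(n)] ([mulmx_transfer], [trace_transfer]), and a nilpotent
    matrix over a field has trace zero. *)

(** * Linear algebra of the symplectic space *)

Section Symplectic.
Variable F : finFieldType.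
Notation V := (symp_space F).
Notation G := (symp_group F).
Implicit Types (u v w x y z : V) (s : seq V) (g h : G) (a b c : F).
Local Notation "<< u , v >>" := (symp_form u v) (format "<< u ,  v >>").

Lemma symp_form_widen n u v : (size u.1 <= n)%N -> (size u.2 <= n)%N ->
  <<u, v>> = \sum_(i < n) (u.1`_i * v.2`_i - u.2`_i * v.1`_i).
Proof.
move=> u1 u2; set f := fun i => u.1`_i * v.2`_i - u.2`_i * v.1`_i.
have le : (maxn (size u.1) (size u.2) <= n)%N by rewrite geq_max u1.
rewrite /symp_form (big_ord_widen n f le) big_mkcond; apply: eq_bigr => i _.
case: ifP => // /negbT; rewrite -leqNgt geq_max => /andP[h1 h2].
by rewrite /f (nth_default _ h1) (nth_default _ h2) !mul0r subr0.
Qed.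

Lemma symp_formC u v : <<u, v>> = - <<v, u>>.
Proof.
pose n := maxn (maxn (size u.1) (size u.2)) (maxn (size v.1) (size v.2)).
rewrite !(@symp_form_widen n) ?leq_max ?leqnn ?orbT // -sumrN.
by apply: eq_bigr => i _; rewrite opprB mulrC [v.1`_i * _]mulrC.
Qed.

Lemma symp_formvv v : <<v, v>> = 0.
Proof. by rewrite /symp_form big1 // => i _; rewrite mulrC subrr. Qed.

Lemma symp_formDr u v w : <<u, v + w>> = <<u, v>> + <<u, w>>.
Proof.
rewrite /symp_form -big_split; apply: eq_bigr => i _ /=.
by rewrite !coefD !mulrDr opprD addrACA.
Qed.

Lemma symp_formZr a u v : <<u, a *: v>> = a * <<u, v>>.
Proof.
rewrite /symp_form mulr_sumr; apply: eq_bigr => i _ /=.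
by rewrite !coefZ mulrBr !mulrA ![_ * a]mulrC.
Qed.

Lemma symp_formDl u v w : <<u + v, w>> = <<u, w>> + <<v, w>>.
Proof. by rewrite symp_formC symp_formDr opprD -!symp_formC. Qed.

Lemma symp_formZl a u v : <<a *: u, v>> = a * <<u, v>>.
Proof. by rewrite symp_formC symp_formZr -mulrN -symp_formC. Qed.

Lemma symp_formNr u v : <<u, - v>> = - <<u, v>>.
Proof. by rewrite -scaleN1r symp_formZr mulN1r. Qed.

Lemma symp_formNl u v : <<- u, v>> = - <<u, v>>.
Proof. by rewrite -scaleN1r symp_formZl mulN1r. Qed.

Lemma symp_form0r u : <<u, 0>> = 0.
Proof. by rewrite -(scale0r 0) symp_formZr mul0r. Qed.

Lemma symp_form0l u : <<0, u>> = 0.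
Proof. by rewrite symp_formC symp_form0r oppr0. Qed.

Definition symp_formE := (symp_formDr, symp_formDl, symp_formZr, symp_formZl,
  symp_formNr, symp_formNl, symp_form0r, symp_form0l, symp_formvv).

(** Since [F] is finite, a finite-dimensional subspace is a finite set; it is
    kept as the list of its vectors. *)
Fixpoint span s : seq V :=
  if s is w :: s' then [seq a *: w + x | a <- enum F, x <- span s'] else [:: 0].

Lemma span_consP w s v :
  reflect (exists a, v - a *: w \in span s) (v \in span (w :: s)).
Proof.
apply: (iffP allpairsP) => [[[a x] /= [_ xs ->]]|[a vs]].
  by exists a; rewrite addrC addKr.
by exists (a, v - a *: w); split; rewrite ?mem_enum //= addrC subrK.
Qed.

Lemma span0 s : 0 \in span s.
Proof.
elim: s => [|w s IH]; first by rewrite inE.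
by apply/span_consP; exists 0; rewrite scale0r subr0.
Qed.

Lemma spanDZ s a v w : v \in span s -> w \in span s -> a *: v + w \in span s.
Proof.
elim: s v w => [|x s IH] v w.
  by rewrite !inE => /eqP-> /eqP->; rewrite scaler0 addr0.
move=> /span_consP[b vb] /span_consP[c wc]; apply/span_consP.
exists (a * b + c); have := IH _ _ vb wc.
by rewrite scalerBr scalerDl scalerA opprD addrACA.
Qed.

Lemma spanD s v w : v \in span s -> w \in span s -> v + w \in span s.
Proof. by move=> vs ws; rewrite -[v]scale1r spanDZ. Qed.

Lemma spanZ s a v : v \in span s -> a *: v \in span s.
Proof. by move=> vs; rewrite -[_ *: _]addr0 spanDZ ?span0. Qed.

Lemma spanN s v : v \in span s -> - v \in span s.
Proof. by rewrite -scaleN1r; apply: spanZ. Qed.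

Lemma spanB s v w : v \in span s -> w \in span s -> v - w \in span s.
Proof. by move=> vs ws; rewrite spanD ?spanN. Qed.

Lemma span_cons w s : {subset span s <= span (w :: s)}.
Proof. by move=> v vs; apply/span_consP; exists 0; rewrite scale0r subr0. Qed.

Lemma mem_span s : {subset s <= span s}.
Proof.
elim: s => [//|w s IH] v; rewrite inE => /orP[/eqP->|/IH]; last exact: span_cons.
by apply/span_consP; exists 1; rewrite scale1r subrr span0.
Qed.

Lemma span_sub s s' : {subset s <= span s'} -> {subset span s <= span s'}.
Proof.
elim: s => [_ v|w s IH sub v /span_consP[a va]].
  by rewrite inE => /eqP->; exact: span0.
rewrite -(subrK (a *: w) v); apply: spanD; last by rewrite spanZ ?sub ?mem_head.
by apply: IH va => x xs; rewrite sub // inE xs orbT.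
Qed.

Lemma sub_span s s' : {subset s <= s'} -> {subset span s <= span s'}.
Proof. by move=> ss; apply: span_sub => x /ss; exact: mem_span. Qed.

Lemma span_catP s s' v : v \in span (s ++ s') ->
  exists2 x, x \in span s & v - x \in span s'.
Proof.
elim: s v => [|w s IH] v; first by exists 0; rewrite ?inE ?subr0.
move=> /span_consP[a /IH[x xs vx]]; exists (x + a *: w).
  by apply: spanD; [exact: span_cons|apply/spanZ/mem_span/mem_head].
by rewrite [x + _]addrC opprD addrA.
Qed.

Definition perp z s := forall x, x \in s -> <<z, x>> = 0.

Lemma perp_span z s : perp z s -> perp z (span s).
Proof.
move=> zs; elim: s zs => [_ x|w s IH zs x /span_consP[a]].
  by rewrite inE => /eqP->; rewrite symp_form0r.
move=> /IH; rewrite !symp_formE (zs w) ?mem_head // mulr0 subr0.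
by apply=> y ys; apply: zs; rewrite inE ys orbT.
Qed.

Lemma perpD z z' s : perp z s -> perp z' s -> perp (z + z') s.
Proof. by move=> h h' x xs; rewrite symp_formE h ?h' ?addr0. Qed.

Lemma perpZ a z s : perp z s -> perp (a *: z) s.
Proof. by move=> h x xs; rewrite symp_formE h ?mulr0. Qed.

Lemma perpN z s : perp z s -> perp (- z) s.
Proof. by move=> h x xs; rewrite symp_formE h ?oppr0. Qed.

Lemma perpB z z' s : perp z s -> perp z' s -> perp (z - z') s.
Proof. by move=> h h'; exact/perpD/perpN. Qed.

Lemma perp_sub z s s' : {subset s <= s'} -> perp z s' -> perp z s.
Proof. by move=> ss h x /ss/h. Qed.

Lemma perp_cons z w s : <<z, w>> = 0 -> perp z s -> perp z (w :: s).
Proof. by move=> zw zs x; rewrite inE => /orP[/eqP->|/zs]. Qed.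

(** The subspace spanned by the first [n] hyperbolic pairs. *)
Definition coord_space n : pred V :=
  [pred v : V | (size v.1 <= n)%N && (size v.2 <= n)%N].

Lemma coord_spaceDZ n a v w :
  v \in coord_space n -> w \in coord_space n -> a *: v + w \in coord_space n.
Proof.
rewrite !inE => /andP[v1 v2] /andP[w1 w2].
by apply/andP; split; rewrite (leq_trans (size_polyD _ _)) // geq_max ?w1 ?w2 andbT
  (leq_trans (size_scale_leq _ _)).
Qed.

Lemma coord_spaceD n v w :
  v \in coord_space n -> w \in coord_space n -> v + w \in coord_space n.
Proof. by move=> vs ws; rewrite -[v]scale1r coord_spaceDZ. Qed.

Lemma coord_space0 n : 0 \in coord_space n.
Proof. by rewrite inE /= size_poly0. Qed.

Lemma coord_spaceZ n a v : v \in coord_space n -> a *: v \in coord_space n.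
Proof. by move=> vs; rewrite -[_ *: _]addr0 coord_spaceDZ ?coord_space0. Qed.

Lemma coord_spaceN n v : v \in coord_space n -> - v \in coord_space n.
Proof. by rewrite -scaleN1r; apply: coord_spaceZ. Qed.

Lemma coord_spaceW m n : (m <= n)%N -> {subset coord_space m <= coord_space n}.
Proof.
move=> mn v; rewrite !inE => /andP[v1 v2].
by rewrite (leq_trans v1 mn) (leq_trans v2 mn).
Qed.

Lemma basis_e_coord n i : (i < n)%N -> basis_e F i \in coord_space n.
Proof. by rewrite inE /= size_polyXn size_poly0 => ->. Qed.

Lemma basis_f_coord n i : (i < n)%N -> basis_f F i \in coord_space n.
Proof. by rewrite inE /= size_polyXn size_poly0 => ->. Qed.

Lemma coord_space_bound s : exists n, {subset s <= coord_space n}.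
Proof.
elim: s => [|w s [n sn]]; first by exists 0.
exists (maxn n (maxn (size w.1) (size w.2))) => v.
rewrite inE => /orP[/eqP->|/sn]; last by apply: coord_spaceW; rewrite leq_maxl.
by rewrite inE !leq_max !leqnn !orbT.
Qed.

Lemma span_coord s n : {subset s <= coord_space n} -> {subset span s <= coord_space n}.
Proof.
elim: s => [_ v|w s IH sub v /span_consP[a va]].
  by rewrite inE => /eqP->; exact: coord_space0.
rewrite -(subrK (a *: w) v); apply: coord_spaceD; last first.
  by rewrite coord_spaceZ ?sub ?mem_head.
by apply: IH va => x xs; rewrite sub // inE xs orbT.
Qed.

Lemma coord_nondeg n v : v \in coord_space n -> v != 0 ->
  exists2 z, z \in coord_space n & <<z, v>> != 0.
Proof.
rewrite inE => /andP[v1 v2] v0.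
case: (eqVneq v.1 0) => [e1|n1]; last first.
  have h : v.1`_((size v.1).-1) != 0 by rewrite -lead_coefE lead_coef_eq0.
  exists (basis_f F (size v.1).-1); last by rewrite symp_form_f oppr_eq0.
  by apply: basis_f_coord; rewrite prednK // lt0n size_poly_eq0.
have n2 : v.2 != 0.
  by apply: contraNneq v0 => e2; rewrite [v]surjective_pairing e1 e2.
have h : v.2`_((size v.2).-1) != 0 by rewrite -lead_coefE lead_coef_eq0.
exists (basis_e F (size v.2).-1); last by rewrite symp_form_e.
by apply: basis_e_coord; rewrite prednK // lt0n size_poly_eq0.
Qed.

(** Biduality: eliminating one vector [w] of [s] replaces [v] by [v - a *: w],
    with [a] the value at [v] of a functional dual to [w]. *)
Lemma coord_dual n s v : {subset s <= coord_space n} -> v \in coord_space n ->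
  v \notin span s -> exists z, [/\ z \in coord_space n, perp z s & <<z, v>> = 1].
Proof.
elim: s v => [|w s IH] v sub vn.
  rewrite inE => /(coord_nondeg vn)[z zn zv].
  exists ((<<z, v>>)^-1 *: z); split=> //; first exact: coord_spaceZ.
  by rewrite symp_formE mulVf.
have wn : w \in coord_space n by rewrite sub ?mem_head.
have {}sub : {subset s <= coord_space n}.
  by move=> x xs; rewrite sub // inE xs orbT.
move=> vws; have [ws|ws] := boolP (w \in span s).
  have vs : v \notin span s by apply: contra vws; exact: span_cons.
  have [z [zn zs zv]] := IH v sub vn vs.
  by exists z; split=> //; apply: perp_cons => //; exact: perp_span zs _ ws.
have [z2 [z2n z2s z2w]] := IH w sub wn ws.
pose v' := v - <<z2, v>> *: w.
have v's : v' \notin span s.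
  by apply: contra vws => h; apply/span_consP; exists (<<z2, v>>).
have v'n : v' \in coord_space n by rewrite coord_spaceD ?coord_spaceN ?coord_spaceZ.
have [z3 [z3n z3s z3v]] := IH v' sub v'n v's.
exists (z3 - <<z3, w>> *: z2); split.
- by rewrite coord_spaceD ?coord_spaceN ?coord_spaceZ.
- apply: perp_cons; first by rewrite !symp_formE z2w mulr1 subrr.
  by apply: perpB => //; apply: perpZ.
- by move: z3v; rewrite /v' !symp_formE ![_ * <<z3, w>>]mulrC.
Qed.

Lemma dual_vector s v : v \notin span s -> exists2 z, perp z s & <<z, v>> = 1.
Proof.
have [n sn] := coord_space_bound (v :: s) => vs.
have [||z [_ zs zv]] := coord_dual _ _ vs (n := n).
- by move=> x xs; rewrite sn // inE xs orbT.
- by rewrite sn ?mem_head.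
- by exists z.
Qed.

(** A basis vector of index beyond all coordinates in sight will do. *)
Lemma perp_avoid s B : exists2 y, perp y s & y \notin span B.
Proof.
have [n sn] := coord_space_bound (s ++ B).
exists (basis_e F n) => [x xs|].
  have : x \in coord_space n by rewrite sn // mem_cat xs.
  by rewrite inE symp_form_e => /andP[_ ?]; rewrite nth_default.
have sB : {subset B <= coord_space n} by move=> x xB; rewrite sn // mem_cat xB orbT.
apply/negP => /(span_coord sB); rewrite inE /=.
by rewrite size_polyXn ltnn.
Qed.

(** Adding to a solution a vector of the orthogonal complement moves it off
    any prescribed finite-dimensional subspace. *)
Lemma dual_vector_avoid s v B : v \notin span s ->
  exists z, [/\ perp z s, <<z, v>> = 1 & z \notin span B].
Proof.
move=> /dual_vector[z zs zv]; have [zB|zB] := boolP (z \in span B); last by exists z.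
have [y ys yB] := perp_avoid (v :: s) B.
exists (z + y); split.
- by apply: perpD => //; apply: perp_sub ys => x xs; rewrite inE xs orbT.
- by rewrite symp_formE zv ys ?mem_head ?addr0.
- by apply: contra yB => zyB; rewrite -(addKr z y) addrC spanB.
Qed.

(** The orthogonal of an intersection is the sum of the orthogonals. A vector [w]
    added to [s'] either lies off the span of [s ++ s'], and then a vector dual
    to it corrects [u], or is [x + y] with [x] in the span of [s] and [y] in that
    of [s']; then [x] lies in both spans, and [u] is already as required. *)
Lemma perp_capP s s' v :
  (forall x, x \in span s -> x \in span s' -> <<v, x>> = 0) ->
  exists2 u, perp u s & perp (v - u) s'.
Proof.
elim: s' => [|w s' IH] vss; first by exists 0 => // x _; rewrite symp_form0l.
have [|u us vus] := IH; first by move=> x xs /span_cons-/(_ w); exact: vss.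
have [/span_catP[x xs wx]|ws] := boolP (w \in span (s ++ s')).
  exists u => //; apply: perp_cons => //.
  rewrite -(subrK x w) symp_formDr (perp_span vus wx) add0r symp_formDl.
  rewrite vss // ?symp_formNl ?(perp_span us xs) ?subr0 //.
  by apply/span_consP; exists 1; rewrite scale1r -opprB spanN.
have [z zs zw] := dual_vector ws.
set c := <<v - u, w>>; exists (u + c *: z).
  by apply/perpD/perpZ => //; apply: perp_sub zs => x xs; rewrite mem_cat xs.
rewrite opprD addrA; apply: perp_cons.
  by rewrite symp_formDl symp_formNl symp_formZl zw mulr1 subrr.
by apply/perpB/perpZ => //; apply: perp_sub zs => x xs; rewrite mem_cat xs orbT.
Qed.

Lemma sp_DZ g a v w : g (a *: v + w) = a *: g v + g w.
Proof. exact: sp_linear. Qed.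
Lemma sp_D g v w : g (v + w) = g v + g w.
Proof. by rewrite -[v]scale1r sp_DZ !scale1r. Qed.
Lemma sp_0 g : g 0 = 0.
Proof. by apply: (addrI (g 0)); rewrite -sp_D !addr0. Qed.
Lemma sp_Z g a v : g (a *: v) = a *: g v.
Proof. by rewrite -[_ *: v]addr0 sp_DZ sp_0 addr0. Qed.
Lemma sp_N g v : g (- v) = - g v.
Proof. by rewrite -scaleN1r sp_Z scaleN1r. Qed.
Lemma sp_B g v w : g (v - w) = g v - g w.
Proof. by rewrite sp_D sp_N. Qed.

Lemma sp_VK g v : g^-1%g (g v) = v. Proof. by rewrite -sp_mulE mulVg. Qed.
Lemma sp_KV g v : g (g^-1%g v) = v. Proof. by rewrite -sp_mulE mulgV. Qed.

Lemma sp_formV g u v : <<g^-1%g u, v>> = <<u, g v>>.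
Proof. by rewrite -(sp_form g) sp_KV. Qed.

Lemma span_map g s v : (g v \in span (map g s)) = (v \in span s).
Proof.
elim: s v => [|w s IH] v /=.
  rewrite !inE; apply/eqP/eqP => [e|->]; last exact: sp_0.
  by rewrite -(sp_VK g v) e sp_0.
by apply/span_consP/span_consP => -[a h]; exists a; move: h; rewrite -sp_Z -sp_B IH.
Qed.

Definition fixes g s := forall v, v \in s -> g v = v.

Lemma fixes_span g s : fixes g s -> fixes g (span s).
Proof.
move=> gs; elim: s gs => [_ v|w s IH gs v /span_consP[a va]].
  by rewrite inE => /eqP->; exact: sp_0.
have gs' : fixes g s by move=> x xs; apply: gs; rewrite inE xs orbT.
by apply: (addIr (- (a *: w))); rewrite -(IH gs' _ va) sp_B sp_Z (gs w) ?mem_head.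
Qed.

Lemma fixes1 s : fixes 1%g s.
Proof. by []. Qed.
Lemma fixesM g h s : fixes g s -> fixes h s -> fixes (g * h)%g s.
Proof. by move=> gs hs v vs; rewrite sp_mulE hs ?gs. Qed.
Lemma fixesV g s : fixes g s -> fixes g^-1%g s.
Proof. by move=> gs v vs; rewrite -{1}(gs v vs) sp_VK. Qed.
Lemma fixes_cons g w s : fixes g (w :: s) <-> g w = w /\ fixes g s.
Proof.
split=> [h|[gw h] v]; last by rewrite inE => /orP[/eqP->|/h].
by split=> [|v vs]; apply: h; rewrite inE ?vs ?eqxx ?orbT.
Qed.

Definition transvection w a : G.
Proof.
exists (fun v => v + (a * <<v, w>>) *: w) (fun v => v - (a * <<v, w>>) *: w).
- move=> v /=; rewrite !symp_formE mulr0 addr0; exact: addrK.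
- move=> v /=; rewrite !symp_formE mulr0 oppr0 addr0; exact: subrK.
- move=> b u v /=; rewrite symp_formDl symp_formZl mulrDr scalerDl scalerDr scalerA.
  by rewrite addrACA mulrCA.
- move=> u v /=; rewrite !symp_formE !(mulr0, addr0) [<<w, v>>]symp_formC.
  by rewrite mulrN mulrAC subrK.
Defined.

Lemma transvectionE w a v : transvection w a v = v + (a * <<v, w>>) *: w.
Proof. by []. Qed.

Lemma transvection_perp w a s : perp w s -> fixes (transvection w a) s.
Proof.
by move=> ws v vs; rewrite transvectionE symp_formC ws // oppr0 mulr0 scale0r addr0.
Qed.

Lemma transvection_conj g w a :
  (g * transvection w a * g^-1)%g = transvection (g w) a.
Proof.
apply: symp_groupP => v; rewrite !sp_mulE !transvectionE sp_D sp_KV sp_Z.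
by rewrite sp_formV.
Qed.

Lemma transvection_move w v : <<v, w>> != 0 ->
  transvection w (<<v, w>>)^-1 v = v + w.
Proof. by move=> vw; rewrite transvectionE mulVf ?scale1r. Qed.

End Symplectic.

Notation "<< u , v >>" := (symp_form u v) (format "<< u ,  v >>") : ring_scope.

(** * Transvections and Witt's theorem *)

Section Witt.
Variable F : finFieldType.
Notation V := (symp_space F).
Notation G := (symp_group F).
Implicit Types (u v w x y z : V) (s d : seq V) (g h : G) (a b c : F).

Lemma fixes_map g h s : fixes g (map h s) <-> fixes (h^-1 * g * h)%g s.
Proof.
split=> [f v vs|f _ /mapP[v vs ->]].
  by rewrite !sp_mulE f ?map_f // sp_VK.
by rewrite -[in RHS](f v vs) !sp_mulE sp_KV.
Qed.

Lemma move_step v w : <<v, w>> != 0 -> transvection (w - v) (<<v, w>>)^-1 v = w.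
Proof.
move=> vw; have e : <<v, w>> = <<v, w - v>> by rewrite symp_formDr symp_formNr symp_formvv subr0.
by rewrite e transvection_move -?e // addrC subrK.
Qed.

(** Two vectors with the same products against [s], both off its span, are
    joined by the chain [x, x + z0, y + z1, y], consecutive members of which are
    not orthogonal; hence a transvection carries each to the next. The
    directions of these transvections can be kept off the span of [B]. *)
Lemma transvections_transitive (H : G -> Prop) s B x y :
  (forall g h, H g -> H h -> H (g * h)%g) ->
  (forall w c, perp w s -> w \notin span B -> H (transvection w c)) ->
  x \notin span s -> y \notin span s -> perp (y - x) s ->
  exists g, [/\ H g, fixes g s & g x = y].
Proof.
move=> HM Ht xs ys yxs.
have [z0 [z0s z0x z0B]] := dual_vector_avoid (B ++ y :: x :: s) xs.
have z0ys : x + z0 \notin span (y :: s).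
  apply: contra z0B => /span_consP[c h].
  rewrite -[z0](addKr x) addrC -(subrK (c *: y) (x + z0)).
  apply: spanB; last by rewrite mem_span // mem_cat !inE eqxx !orbT.
  apply: spanD; last by rewrite spanZ // mem_span // mem_cat inE eqxx orbT.
  by apply: sub_span h => v vs; rewrite mem_cat !inE vs !orbT.
have [z' z'ys z'1] := dual_vector z0ys.
have z's : perp z' s by apply: perp_sub z'ys => v vs; rewrite inE vs orbT.
have z'y : <<z', y>> = 0 by rewrite z'ys ?mem_head.
have [z2 z2s z2y] := dual_vector ys.
(* the coefficient of z' makes the product of x + z0 and y + z1 equal to 1 *)
pose e := z2 + (<<x + z0, y>> - 1 - <<z2, x + z0>>) *: z'.
have [y0 y0s y0B] := perp_avoid ((x + z0) :: y :: s) (e :: (x + z0) :: y :: B).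
have es : perp e s by apply/perpD/perpZ.
pose z1 := e + y0.
have y0s' : perp y0 s by apply: perp_sub y0s => v vs; rewrite !inE vs !orbT.
have z1s : perp z1 s by apply: perpD.
have z1y : <<z1, y>> = 1.
  by rewrite !symp_formDl symp_formZl z'y z2y (y0s y) ?inE ?eqxx ?orbT // mulr0 !addr0.
have z1x : <<z1, x + z0>> = <<x + z0, y>> - 1.
  rewrite [LHS]symp_formDl [X in X + _]symp_formDl symp_formZl z'1 mulr1.
  by rewrite (y0s (x + z0)) ?mem_head // addr0 addrC subrK.
have off v : v \in span (e :: (x + z0) :: y :: B) -> v + y0 \notin span B.
  move=> ve; apply: contra y0B => h; rewrite -(addKr v y0) addrC.
  apply: spanB => //; apply: sub_span h => u uB; by rewrite !inE uB !orbT.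
have eB : e \in span (e :: (x + z0) :: y :: B) by rewrite mem_span ?mem_head.
have xB : x + z0 \in span (e :: (x + z0) :: y :: B).
  by rewrite mem_span // !inE eqxx orbT.
have yB : y \in span (e :: (x + z0) :: y :: B).
  by rewrite mem_span // !inE eqxx !orbT.
have n0 : <<x, x + z0>> != 0.
  by rewrite symp_formDr symp_formvv add0r symp_formC z0x oppr_eq0 oner_eq0.
have n1 : <<x + z0, y + z1>> != 0.
  rewrite symp_formDr [X in _ + X]symp_formC z1x opprB addrC subrK.
  exact: oner_neq0.
have n2 : <<y + z1, y>> != 0 by rewrite symp_formDl symp_formvv add0r z1y oner_neq0.
have p0 : perp (x + z0 - x) s by rewrite [x + _]addrC addrK.
have p2 : perp (y - (y + z1)) s by rewrite opprD addNKr; exact: perpN.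
have p1 : perp (y + z1 - (x + z0)) s.
  rewrite opprD addrACA; exact/perpD/perpB.
exists (transvection (y - (y + z1)) (<<y + z1, y>>)^-1%R *
        (transvection (y + z1 - (x + z0)) (<<x + z0, y + z1>>)^-1%R *
         transvection (x + z0 - x) (<<x, x + z0>>)^-1%R))%g; split.
- apply: (HM); [|apply: (HM)]; apply: Ht => //.
  + rewrite opprD addNKr; apply/negP => /spanN; rewrite opprK.
    exact/negP/off.
  + have -> : y + z1 - (x + z0) = (y + e - (x + z0)) + y0.
      by rewrite /z1 [y + (e + _)]addrA [LHS]addrAC.
    by apply: off; apply: spanB => //; exact: spanD.
  + rewrite [x + _]addrC addrK; apply: contra z0B; apply: sub_span => v vB.
    by rewrite mem_cat vB.
- by apply: fixesM; [|apply: fixesM]; exact: transvection_perp.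
- by rewrite !sp_mulE !move_step.
Qed.

Definition normalizes n g :=
  {homo g : v / v \in coord_space n} /\ {homo g^-1%g : v / v \in coord_space n}.

Lemma normalizesM n g h : normalizes n g -> normalizes n h -> normalizes n (g * h)%g.
Proof.
move=> [g1 g2] [h1 h2]; split=> v vn; first by rewrite sp_mulE; auto.
by rewrite invgM sp_mulE; auto.
Qed.

Lemma normalizesV n g : normalizes n g -> normalizes n g^-1%g.
Proof. by move=> [g1 g2]; split=> //; rewrite invgK. Qed.

Lemma normalizes1 n : normalizes n 1%g.
Proof. by split=> // v; rewrite invg1. Qed.

Lemma normalizes_transvection n w a : w \in coord_space n ->
  normalizes n (transvection w a).
Proof.
move=> wn; split=> v vn.
  by rewrite transvectionE coord_spaceD ?coord_spaceZ.
have -> : (transvection w a)^-1%g v = v - (a * <<v, w>>) *: w by [].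
by rewrite coord_spaceD ?coord_spaceN ?coord_spaceZ.
Qed.

(** In a coordinate space the directions cannot be kept off a subspace, but a
    chain of length two suffices: if [x] and [y] are orthogonal, some [z] in the
    orthogonal of [s] is orthogonal to neither of them, as a vector space is not
    a union of two proper subspaces, and the chain is [x, x + z, y]. *)
Lemma coord_transitive n s x y : {subset s <= coord_space n} ->
  x \in coord_space n -> y \in coord_space n ->
  x \notin span s -> y \notin span s -> perp (y - x) s ->
  exists g, [/\ normalizes n g, fixes g s & g x = y].
Proof.
move=> sn xn yn xs ys yxs.
have [xy|xy] := eqVneq <<x, y>> 0; last first.
  exists (transvection (y - x) (<<x, y>>)^-1); split; last exact: move_step.
    by apply: normalizes_transvection; rewrite coord_spaceD ?coord_spaceN.
  exact: transvection_perp.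
have [z [zn zs zx zy]] : exists z,
    [/\ z \in coord_space n, perp z s, <<z, x>> != 0 & <<z, y>> != 0].
  have [z1 [z1n z1s z1x]] := coord_dual sn xn xs.
  have [z2 [z2n z2s z2y]] := coord_dual sn yn ys.
  have [e1|n1] := eqVneq <<z1, y>> 0; last first.
    by exists z1; split; rewrite ?z1x ?oner_eq0.
  have [e2|n2] := eqVneq <<z2, x>> 0; last first.
    by exists z2; split; rewrite ?z2y ?oner_eq0.
  exists (z1 + z2); split; first exact: coord_spaceD.
  - exact: perpD.
  - by rewrite symp_formDl z1x e2 addr0 oner_eq0.
  - by rewrite symp_formDl z2y e1 add0r oner_eq0.
have n1 : <<x, x + z>> != 0.
  by rewrite symp_formDr symp_formvv add0r symp_formC oppr_eq0.
have n2 : <<x + z, y>> != 0 by rewrite symp_formDl xy add0r.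
exists (transvection (y - (x + z)) (<<x + z, y>>)^-1%R *
        transvection (x + z - x) (<<x, x + z>>)^-1%R)%g; split.
- by apply: normalizesM; apply: normalizes_transvection;
    rewrite ?(coord_spaceD, coord_spaceN).
- apply: fixesM; apply: transvection_perp.
    by rewrite opprD addrA; exact: perpB.
  by rewrite [x + _]addrC addrK.
- by rewrite sp_mulE !move_step.
Qed.

(** Witt's theorem for subspaces of a coordinate space, with an extension that
    preserves the coordinate space and hence normalizes [G(n)]. *)
Lemma coord_witt n g s : {subset s <= coord_space n} ->
  {subset map g s <= coord_space n} ->
  exists2 h, normalizes n h & forall v, v \in s -> h v = g v.
Proof.
elim: s => [_ _|w s IH sn gsn]; first by exists 1%g => //; exact: normalizes1.
have [||h hn hg] := IH.
- by move=> x xs; rewrite sn // inE xs orbT.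
- by move=> x xs; rewrite gsn // inE xs orbT.
have e : map h s = map g s by apply/eq_in_map.
have hgs : fixes (h^-1 * g)%g s by move=> v vs; rewrite sp_mulE -hg // sp_VK.
have [ws|ws] := boolP (w \in span s).
  exists h => // v; rewrite inE => /orP[/eqP->|]; last exact: hg.
  by rewrite -{1}(fixes_span hgs ws) sp_mulE sp_KV.
have [||||||k [kn ks kw]] := @coord_transitive n (map h s) (h w) (g w).
- by move=> x; rewrite e => xs; rewrite gsn // inE xs orbT.
- by case: hn => hn _; apply: hn; rewrite sn ?mem_head.
- by rewrite gsn ?mem_head.
- by rewrite span_map.
- by rewrite e span_map.
- move=> _ /mapP[x xs ->]; rewrite symp_formDl symp_formNl sp_form {1}hg //.
  by rewrite sp_form subrr.
exists (k * h)%g => [|v]; first exact: normalizesM.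
rewrite inE sp_mulE => /orP[/eqP->//|vs].
by rewrite ks ?map_f ?hg.
Qed.

Lemma span_cap s s' : exists d, forall x, (x \in span d) = (x \in span s) && (x \in span s').
Proof.
exists [seq x <- span s | x \in span s'] => x; apply/idP/andP => [xd|[xs xs']].
  by split; apply: span_sub xd => y; rewrite mem_filter => /andP[].
by rewrite mem_span // mem_filter xs' xs.
Qed.

Variable H : open_subgroup F.

(** Write [v = u + u'] with [u] orthogonal to [s] and [u'] orthogonal to [s'].
    A vector orthogonal to both spans, but not to [v], serves to change the
    product of [u] and [u'] to [1]; then a transvection along [u] carries [u'] to
    [v] and conjugates the transvection along [u'] into the one along [v]. *)
Lemma transvection_in s s' d v c :
  (forall g, fixes g s -> H g) -> (forall g, fixes g s' -> H g) ->
  (forall x, (x \in span d) = (x \in span s) && (x \in span s')) ->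
  perp v d -> v \notin span (s ++ s') -> H (transvection v c).
Proof.
move=> Hs Hs' dP vd vss.
have [|u us vus] := @perp_capP _ s s' v.
  by move=> x xs xs'; apply: (perp_span vd); rewrite dP xs xs'.
have [z zss zv] := dual_vector vss.
have zs : perp z s by apply: perp_sub zss => x xs; rewrite mem_cat xs.
have zs' : perp z s' by apply: perp_sub zss => x xs; rewrite mem_cat xs orbT.
pose e := 1 - <<u, v>>; pose u1 := u + e *: z.
have u1s : perp u1 s by apply/perpD/perpZ.
have vu1s : perp (v - u1) s' by rewrite opprD addrA; apply/perpB/perpZ.
have u1v : <<u1, v>> = 1 by rewrite symp_formDl symp_formZl zv mulr1 addrC subrK.
have -> : v = transvection u1 (-1) (v - u1).
  rewrite transvectionE symp_formDl symp_formNl symp_formvv subr0 symp_formC u1v.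
  by rewrite mulrNN mulr1 scale1r subrK.
rewrite -transvection_conj; apply: osg_M; last apply: osg_V.
  by apply: osg_M; [apply: Hs | apply: Hs']; exact: transvection_perp.
by apply: Hs; exact: transvection_perp.
Qed.

(** [H] contains many transvections that fix the intersection, and those move
    any element of the fixator of the intersection into the fixator of [s]. *)
Lemma fixator_cap s s' d :
  (forall g, fixes g s -> H g) -> (forall g, fixes g s' -> H g) ->
  (forall x, (x \in span d) = (x \in span s) && (x \in span s')) ->
  forall g, fixes g d -> H g.
Proof.
move=> Hs Hs' dP g gd.
suff [u [Hu ud us]] : exists u : G, [/\ H u, fixes u d & fixes (u * g)%g s].
  by rewrite -(mulKg u g); apply: osg_M; [exact: osg_V|exact: Hs].
elim: {1}s => [|w r [u [Hu ud ur]]].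
  by exists 1%g; split=> //; exact: osg_1.
have ugdr : fixes (u * g)%g (d ++ r).
  move=> v; rewrite mem_cat => /orP[vd|]; last exact: ur.
  by rewrite sp_mulE gd ?ud.
have [wdr|wdr] := boolP (w \in span (d ++ r)).
  by exists u; split=> //; apply/fixes_cons; split=> //; exact: (fixes_span ugdr).
have e : map (u * g)%g (d ++ r) = d ++ r.
  by rewrite -[RHS]map_id; apply/eq_in_map.
have [|||||k [Hk kdr kw]] := @transvections_transitive
    H (d ++ r) (s ++ s') ((u * g)%g w) w.
- by move=> *; exact: osg_M.
- move=> v c vdr vss; apply: transvection_in vss => //.
  by apply: perp_sub vdr => x xd; rewrite mem_cat xd.
- by rewrite -e span_map.
- by [].
- move=> x xdr; rewrite symp_formDl symp_formNl -{2}(ugdr x xdr) sp_form.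
  exact: subrr.
exists (k * u)%g; split; first exact: osg_M.
  by apply: fixesM => // v vd; apply: kdr; rewrite mem_cat vd.
rewrite -mulgA; apply/fixes_cons; split; first by rewrite sp_mulE.
by apply: fixesM => // v vr; apply: kdr; rewrite mem_cat vr orbT.
Qed.

End Witt.

(** * Open subgroups and their orbits *)

Lemma class_reps (T : Type) (I : finType) (A : T -> Prop) (c : T -> I) :
  exists n (r : 'I_n -> T),
    (forall i, A (r i)) /\ (forall x, A x -> exists! i, c (r i) = c x).
Proof.
pose J := [set i | `[< exists2 x, A x & c x = i >]]%SET.
have ex (j : 'I_#|J|) : exists x, A x /\ c x = enum_val j.
  by have := enum_valP j; rewrite inE => /asboolP[x]; exists x.
have [r rP] := choice ex.
exists #|J|, r; split=> [i|x Ax]; first by case: (rP i).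
have xJ : c x \in J by rewrite inE; apply/asboolP; exists x.
exists (enum_rank_in xJ (c x)); split=> [|j].
  by rewrite (rP _).2 enum_rankK_in.
by move=> e; apply: enum_val_inj; rewrite enum_rankK_in // -e (rP j).2.
Qed.

Section OpenSubgroups.
Variable F : finFieldType.
Notation V := (symp_space F).
Notation G := (symp_group F).
Implicit Types (U K L : open_subgroup F) (s d : seq V) (g h : G).
Local Open Scope group_scope.

Lemma osg_ext U K : (forall g, U g <-> K g) -> U = K.
Proof.
case: U K => [A A1 AM AV Ao] [B B1 BM BV Bo] /= AB.
have e : A = B by apply/funext => g; apply/propext.
subst B; congr OpenSubgroup; exact: Prop_irrelevance.
Qed.

Lemma fixator_open s : sp_open (fun g : G => fixes g s).
Proof.
by move=> g gs; exists s => h hs; apply: fixesM => // v vs; exact: hs.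
Qed.

Definition fixator s : open_subgroup F :=
  @OpenSubgroup F (fun g => fixes g s) (fixes1 (s := s)) (fun g h => @fixesM F g h s)
    (fun g => @fixesV F g s) (@fixator_open s).

Lemma open_fixator U : exists s, forall g, fixes g s -> U g.
Proof.
have [s sP] := @osg_open F U 1 (osg_1 U).
by exists s => g gs; rewrite -(mul1g g); exact: sP.
Qed.

Definition is_core U s := (forall g, fixes g s -> U g) /\
  (forall s', (forall g, fixes g s' -> U g) -> {subset span s <= span s'}).

(** A subspace of least size among those whose fixator lies in [U] is contained
    in every other such subspace, because [fixator_cap] allows intersecting. *)
Lemma core_exists U : exists s, is_core U s.
Proof.
pose P n := `[< exists2 s, (forall g, fixes g s -> U g) & size (undup (span s)) = n >].
have exP : exists n, P n.
  by have [s sU] := open_fixator U; exists (size (undup (span s))); apply/asboolP; exists s.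
case: (ex_minnP exP) => n /asboolP[s sU sn] nmin.
exists s; split=> // s' s'U x xs.
have [d dP] := span_cap s s'.
have dU := fixator_cap sU s'U dP.
have le : (size (undup (span s)) <= size (undup (span d)))%N.
  by rewrite sn; apply: nmin; apply/asboolP; exists d.
have sub : {subset undup (span d) <= undup (span s)}.
  by move=> y; rewrite !mem_undup dP => /andP[].
have [_ e] := uniq_min_size (undup_uniq _) sub le.
by move: (e x); rewrite !mem_undup xs dP => /andP[].
Qed.

Lemma core_stable U s g v : is_core U s -> U g -> v \in span s -> g v \in span s.
Proof.
move=> [sU smin] Ug vs.
have e : {subset span s <= span (map (sp_fun g^-1) s)}.
  apply: smin => h /fixes_map; rewrite invgK => hs.
  have -> : h = g^-1 * (g * h * g^-1) * g by rewrite !mulgA mulVg mul1g -mulgA mulVg mulg1.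
  by apply: osg_M => //; apply: osg_M; [exact: osg_V|exact: sU].
by rewrite -(span_map (g^-1 : G)) sp_VK; apply: e.
Qed.

(** [U] permutes the finitely many vectors of the span of its core, so the
    fixator of the core is normal of finite index in [U]. *)
Lemma core_index U s : is_core U s ->
  exists n (u : 'I_n -> G), (forall i, U (u i)) /\
    (forall g, U g -> exists! i, fixes ((u i)^-1 * g) s).
Proof.
move=> sU.
pose c g := [ffun j : 'I_(size s) => inord (index (g (s`_j)%R) (span s)) : 'I_(size (span s)).+1].
have [n [u [uU uP]]] := class_reps U c.
exists n, u; split=> // g Ug.
have cP i : c (u i) = c g <-> fixes ((u i)^-1 * g) s.
  split=> [e v vs|f]; last first.
    apply/ffunP => j; rewrite !ffunE; congr (inord (index _ _)).
    by rewrite -{1}(f _ (mem_nth 0%R (ltn_ord j))) sp_mulE sp_KV.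
  rewrite sp_mulE; apply: (can_inj (sp_VK (u i))); rewrite sp_KV.
  have vj : (index v s < size s)%N by rewrite index_mem.
  move/ffunP/(_ (Ordinal vj)): e; rewrite !ffunE /= nth_index // => /(congr1 val) /=.
  rewrite !inordK ?ltnS ?index_size // => e.
  have vs' := mem_span vs.
  rewrite -(nth_index 0%R (core_stable sU Ug vs')) -e nth_index //.
  exact: (core_stable sU (uU i) vs').
have [i [ei iu]] := uP _ Ug.
by exists i; split=> [|j /cP]; [exact/cP | exact: iu].
Qed.

(** Off the span of [s], the products with the vectors of [s] determine the
    orbit, by [transvections_transitive]. *)
Lemma vector_orbits s : exists (I : finType) (r : I -> V),
  forall v, exists i g, fixes g s /\ v = g (r i).
Proof.
pose r (i : {ffun 'I_(size s) -> F} + 'I_(size (span s))) : V :=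
  match i with
  | inl f => xget 0%R (fun v => v \notin span s /\ forall j : 'I_(size s), <<v, (s`_j)%R>>%R = f j)
  | inr j => ((span s)`_j)%R
  end.
exists _, r => v; have [vs|vs] := boolP (v \in span s).
  have vi : (index v (span s) < size (span s))%N by rewrite index_mem.
  by exists (inr (Ordinal vi)), 1; rewrite /= nth_index.
exists (inl [ffun j : 'I_(size s) => <<v, (s`_j)%R>>%R]) => /=.
case: xgetP => [w _ [ws wv]|/(_ v)[]]; last by split=> // j; rewrite ffunE.
have [|||||g [_ gs gv]] := @transvections_transitive F (fun=> True) s [::] w v => //.
  move=> x xs; rewrite symp_formDl symp_formNl.
  have xj : (index x s < size s)%N by rewrite index_mem.
  by have := wv (Ordinal xj); rewrite ffunE /= nth_index // => ->; rewrite subrr.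
by exists g.
Qed.

Lemma tuple_orbits m s : exists (I : finType) (r : I -> seq V),
  forall l, size l = m -> exists i g, fixes g s /\ l = map g (r i).
Proof.
elim: m s => [|m IH] s.
  by exists unit, (fun=> [::]) => l /size0nil->; exists tt, 1.
have [I [r rP]] := vector_orbits s.
have [J JP] := choice (fun i : I => IH (r i :: s)).
pose t i := projT1 (cid (JP i)); have tP i := projT2 (cid (JP i)).
exists {i : I & J i}, (fun p => r (tag p) :: t _ (tagged p)) => -[//|v l] [lm].
have [i [g [gs vg]]] := rP v.
have [|j [h [/fixes_cons[hr hs] lh]]] := tP i (map (sp_fun g^-1) l); first by rewrite size_map.
exists (Tagged J j), (g * h); split; first exact: fixesM.
rewrite /= hr -vg; congr cons.
have -> : l = map g (map (sp_fun g^-1) l).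
  by rewrite -map_comp -[LHS]map_id; apply: eq_map => x /=; rewrite sp_KV.
by rewrite lh -map_comp.
Qed.

Definition finite_orbits U (X : gset U) :=
  exists (I : finType) (r : I -> X), forall x, exists i, gs_orbit (r i) x.

Lemma gs_orbit_sym U (X : gset U) (x y : X) : gs_orbit x y -> gs_orbit y x.
Proof.
by move=> [g Ug ->]; exists g^-1; [exact: osg_V|rewrite gs_actVK].
Qed.

Lemma gs_orbit_trans U (X : gset U) (x y z : X) :
  gs_orbit x y -> gs_orbit y z -> gs_orbit x z.
Proof.
move=> [g Ug ->] [h Uh ->]; exists (h * g); first exact: osg_M.
by rewrite gs_actM.
Qed.

Lemma finite_orbits_decomposition U (X : gset U) (S : set X) :
  finite_orbits X -> gs_stable S -> exists n (r : 'I_n -> X), orbit_decomposition S r.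
Proof.
move=> [I [r rP]] St; pose c x := [pick i | `[< gs_orbit (r i) x >]].
have cP x y : c x = c y <-> gs_orbit x y.
  split=> [|xy]; last first.
    apply: eq_pick => i; apply/asboolP/asboolP => h; first exact: gs_orbit_trans xy.
    by apply: gs_orbit_trans h (gs_orbit_sym xy).
  rewrite /c; case: pickP => [i /asboolP ix|n]; last first.
    by have [i ix] := rP x; have := n i; rewrite asboolT.
  case: pickP => // j /asboolP jy [ij]; subst j.
  exact: gs_orbit_trans (gs_orbit_sym ix) jy.
have [n [r' [r'S r'P]]] := class_reps S c.
exists n, r'; split=> // x Sx; have [i [/cP ix iu]] := r'P x Sx.
by exists i; split=> // j /cP/iu.
Qed.

(** A point of an orbit is determined by the image of finitely many vectors, as
    stabilizers are open; so orbits of tuples of vectors are enough. *)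
Lemma orbit_finite_orbits U (X : Gset F) (x0 : X) :
  exists (I : finType) (r : I -> res_gset U X),
    forall g, exists i, gs_orbit (r i) (gs_act g x0).
Proof.
have [s sU] := open_fixator U; have [s0 s0P] := open_fixator (stabilizer x0).
have [I [t tP]] := tuple_orbits (size s0) s.
pose P i (x : X) := exists g h,
  [/\ x = gs_act g x0, fixes h s & map g s0 = map h (t i)].
pose r i : res_gset U X := if pselect (exists x, P i x) is left e then projT1 (cid e) else x0.
exists I, r => g; have [|i [h [hs gh]]] := tP (map g s0); first by rewrite size_map.
have iP : exists x, P i x by exists (gs_act g x0), g, h.
exists i; rewrite /r; case: pselect => // e; case: cid => x /= [g' [h' [-> h's gh']]].
exists (h * h'^-1); first by apply: sU; apply: fixesM => //; exact: fixesV.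
rewrite /= -gs_actM //.
have [_ e'] : stabilizer x0 (g^-1 * (h * h'^-1 * g')).
    apply: s0P => v vs; rewrite !sp_mulE.
  have : map g s0 = map (sp_fun (h * h'^-1 * g')) s0.
    have -> : map (sp_fun (h * h'^-1 * g')) s0 = map h (map (sp_fun h'^-1) (map g' s0)).
      by rewrite -!map_comp.
    by rewrite gh' gh -!map_comp; apply: eq_map => w; exact: (congr1 h (esym (sp_VK h' w))).
  by move=> /eq_in_map/(_ v vs) /esym; rewrite !sp_mulE => ->; exact: sp_VK.
by rewrite -{1}e' -gs_actM // mulVKg.
Qed.

Lemma finitary_finite_orbits U (X : Gset F) : finite_orbits X ->
  finite_orbits (res_gset U X).
Proof.
move=> [I [r rP]].
have [J JP] := choice (fun i : I => orbit_finite_orbits U (r i)).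
pose t i := projT1 (cid (JP i)); have tP i := projT2 (cid (JP i)).
exists {i : I & J i}, (fun p => t _ (tagged p)) => x.
have [i [g _ ->]] := rP x; have [j jx] := tP i g.
by exists (Tagged J j).
Qed.

Lemma finitaryP (X : Gset F) : finitary X -> finite_orbits X.
Proof.
by move=> [n [r [_ rP]]]; exists 'I_n, r => x; have [i [ix _]] := rP x I; exists i.
Qed.

Lemma prod_finite_orbits (X Y : Gset F) :
  finite_orbits X -> finite_orbits Y -> finite_orbits (prod_gset X Y).
Proof.
move=> [I [r rP]] Yf.
have [J JP] := choice (fun i : I => finitary_finite_orbits (stabilizer (r i)) Yf).
pose t i := projT1 (cid (JP i)); have tP i := projT2 (cid (JP i)).
exists {i : I & J i}, (fun p => (r (tag p), t _ (tagged p))) => -[x y].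
have [i [g _ ->]] := rP x.
have [j [h [_ hi] hy]] := tP i (gs_act g^-1 y).
exists (Tagged J j), (g * h) => //=.
rewrite !gs_actM // hi; congr pair.
by rewrite -[y in LHS](gs_actKV (g := g)) // hy.
Qed.

End OpenSubgroups.

(** * Measures as indices, and volumes *)

Section Maps.
Variable F : finFieldType.
Notation G := (symp_group F).
Implicit Types (U K L : open_subgroup F) (g h : G).
Local Open Scope group_scope.

Lemma tr_act (Y : trGset F) (y y' : Y) : exists g, y' = gs_act g y.
Proof.
have [y0 y0T] := tr_transitive Y.
have [g _ ->] : gs_orbit y0 y by rewrite y0T.
have [h _ ->] : gs_orbit y0 y' by rewrite y0T.
by exists (h * g^-1); rewrite -gs_actM // -mulgA mulVg mulg1.
Qed.

Lemma gmap_ext (Y X : Gset F) (f f' : gmap Y X) : (forall y, f y = f' y) -> f = f'.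
Proof.
case: f f' => [f fe] [f' fe'] /= e; have e' : f = f' by apply/funext.
by subst f'; congr GMap; exact: Prop_irrelevance.
Qed.

Lemma gmap_eq_at (Y : trGset F) (X : Gset F) (f f' : gmap Y X) y :
  f y = f' y -> f = f'.
Proof.
move=> e; apply: gmap_ext => z; have [g ->] := tr_act y z.
by rewrite !gm_equivariant // e.
Qed.

Lemma gmap_exists (Y : trGset F) (X : Gset F) (y : Y) (x : X) :
  (forall g, gs_act g y = y -> gs_act g x = x) -> exists f : gmap Y X, f y = x.
Proof.
move=> yx; pose c z := projT1 (cid (tr_act y z)).
have cP z : z = gs_act (c z) y by exact: projT2 (cid (tr_act y z)).
have key g h : gs_act g y = gs_act h y -> gs_act g x = gs_act h x.
  move=> e; rewrite -[g](mulVKg h) gs_actM // yx // gs_actM // e.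
  by rewrite -gs_actM // mulVg gs_act1.
have fe g z : full_subgroup F g -> gs_act (c (gs_act g z)) x = gs_act g (gs_act (c z) x).
  by move=> _; rewrite -gs_actM //; apply: key; rewrite gs_actM // -!cP.
exists (GMap fe) => /=.
by rewrite -[RHS]gs_act1; apply: key; rewrite -cP gs_act1.
Qed.

Lemma gmap_bijective (Y X : trGset F) (f : gmap Y X) y :
  (forall g, gs_act g (f y) = f y -> gs_act g y = y) -> bijective f.
Proof.
move=> /gmap_exists[f' e]; exists f' => z.
  by have [g ->] := tr_act y z; rewrite !gm_equivariant // e.
by have [g ->] := tr_act (f y) z; rewrite !gm_equivariant // e.
Qed.

Definition coset_pt U : coset_trset U := SigSub (mem_set (imageT (lcoset_set U) 1)).

Lemma coset_ptP U g : gs_act g (coset_pt U) = coset_pt U <-> U g.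
Proof.
split=> [/(congr1 val) /=|Ug].
  by rewrite lcoset_set_act => /esym /lcoset_set_eq; rewrite invg1 mulg1 mul1g.
apply: val_inj; rewrite /= lcoset_set_act; apply/esym/lcoset_set_eq.
by rewrite invg1 mulg1 mul1g.
Qed.

Lemma stab_coset_pt U : stabilizer (coset_pt U) = U.
Proof.
by apply: osg_ext => g; split=> [[_ /coset_ptP]|Ug] //; split=> //; exact/coset_ptP.
Qed.

Lemma coset_map_exists K U : (forall g, K g -> U g) ->
  exists f : gmap (coset_trset K) (coset_trset U), f (coset_pt K) = coset_pt U.
Proof. by move=> KU; apply: gmap_exists => g /coset_ptP/KU/coset_ptP. Qed.

Lemma stabilizer_sub U (X : gset U) (S : set X) (St : gs_stable S) (y : sub_gset St) :
  stabilizer y = stabilizer (val y).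
Proof.
apply: osg_ext => g; split=> -[Ug gy]; split=> //.
  by rewrite -[in RHS]gy sub_gsetE.
by apply: val_inj; rewrite sub_gsetE.
Qed.

Definition orbit_pt U (X : gset U) (x : X) : orbit_trset x :=
  SigSub (mem_set (orbit_refl x)).

End Maps.

Section Index.
Variables (F : finFieldType) (k : fieldType) (mu : measure F k).
Notation G := (symp_group F).
Implicit Types (U K L : open_subgroup F) (g h : G).

(** The measure of [G/K -> G/U], given a junk value unless [K] is contained in
    [U]. By transitivity every value of [mu] has this form. *)
Definition idx U K : k :=
  if pselect (exists f : gmap (coset_trset K) (coset_trset U), f (coset_pt K) = coset_pt U)
  is left e then mu _ _ (projT1 (cid e)) else 0.

Lemma measure_idx (Y X : trGset F) (f : gmap Y X) (y : Y) :
  mu _ _ f = idx (stabilizer (f y)) (stabilizer y).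
Proof.
set U := stabilizer (f y); set K := stabilizer y.
have KU g : K g -> U g by move=> [_ gy]; split=> //; rewrite -gm_equivariant ?gy.
rewrite /idx; case: pselect => [e|[]]; last exact: coset_map_exists.
case: cid => c /= cE.
have [a aE] : exists a : gmap (coset_trset K) Y, a (coset_pt K) = y.
  by apply: gmap_exists => g /coset_ptP[].
have [b bE] : exists b : gmap (coset_trset U) X, b (coset_pt U) = f y.
  by apply: gmap_exists => g /coset_ptP[].
have abij : bijective a.
  by apply: (@gmap_bijective _ _ _ _ (coset_pt K)) => g; rewrite aE => ?; apply/coset_ptP.
have bbij : bijective b.
  by apply: (@gmap_bijective _ _ _ _ (coset_pt U)) => g; rewrite bE => ?; apply/coset_ptP.
have e' : gcomp f a = gcomp b c.
  by apply: (@gmap_eq_at _ _ _ _ _ (coset_pt K)); rewrite /= aE cE bE.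
by rewrite -[LHS]mulr1 -(ms_iso mu abij) -ms_comp e' ms_comp (ms_iso mu bbij) mul1r.
Qed.

Lemma idxxx U : idx U U = 1.
Proof.
have [f fE] := coset_map_exists (fun g (Ug : U g) => Ug).
have := measure_idx f (coset_pt U); rewrite fE !stab_coset_pt => <-.
apply: ms_iso; apply: (@gmap_bijective _ _ _ _ (coset_pt U)) => g.
by rewrite fE.
Qed.

Lemma idx_trans U L K : (forall g, K g -> L g) -> (forall g, L g -> U g) ->
  idx U K = idx U L * idx L K.
Proof.
move=> KL LU; have [f fE] := coset_map_exists KL; have [h hE] := coset_map_exists LU.
have hf : gcomp h f (coset_pt K) = coset_pt U by rewrite /= fE.
have := measure_idx (gcomp h f) (coset_pt K); rewrite hf !stab_coset_pt => <-.
rewrite ms_comp (measure_idx h (coset_pt L)) (measure_idx f (coset_pt K)).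
by rewrite fE hE !stab_coset_pt.
Qed.

(** The [G]-orbits on the fibre product of [f] and [h] correspond to the orbits
    of the stabilizer of [x'] on the fibre of [f] above [h x']. *)
Lemma measure_base (Y X X' : trGset F) (f : gmap Y X) (h : gmap X' X) x' n
    (r : 'I_n -> Y) :
  (forall i, f (r i) = h x') ->
  (forall y, f y = h x' -> exists! i, exists2 g, gs_act g x' = x' & y = gs_act g (r i)) ->
  mu _ _ f = \sum_(i < n) idx (stabilizer x') (stabilizer ((r i, x') : prod_gset Y X')).
Proof.
move=> rf rP.
have rD : orbit_decomposition (fiber_product f h) (fun i => (r i, x') : prod_gset Y X').
  split=> [i|[y z] /= yz]; first exact: rf.
  have [a za] := tr_act x' z.
  have [|i [[g gx' yE] iu]] := rP (gs_act a^-1%g y).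
    by rewrite gm_equivariant // yz za gm_equivariant // -gs_actM // mulVg gs_act1.
  exists i; split=> [|j [b _ [yb zb]]].
    exists (a * g)%g => //=; congr pair; first by rewrite gs_actM // -yE -gs_actM // mulgV gs_act1.
    by rewrite gs_actM // gx'.
  apply: iu; exists (a^-1 * b)%g; last by rewrite yb -gs_actM.
  by rewrite gs_actM // -zb za -gs_actM // mulVg gs_act1.
rewrite (ms_base mu rD); apply: eq_bigr => i _.
rewrite (measure_idx _ (orbit_pt ((r i, x') : prod_gset Y X'))).
by rewrite stabilizer_sub.
Qed.

(** The class of [(1, y)] in the induced [G]-set has the same stabilizer as [y]. *)
Lemma tr_volE U (Y : trset U) (y : Y) : tr_vol mu Y = idx U (stabilizer y).
Proof.
pose A : induced_trset Y := SigSub (mem_set (imageT (@induced_class _ _ Y) (1%g, y))).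
have AU : induced_map Y A = coset_pt U.
  apply: val_inj => /=.
  apply/seteqP; split=> [_ [_ [u Uu ->] <-]|_ [u Uu ->]]; first by exists u.
  by exists (1 * u, gs_act u^-1 y)%g => //; exists u.
rewrite /tr_vol (measure_idx _ A) AU stab_coset_pt; congr idx.
apply: osg_ext => g; split=> [[_ /(congr1 val)]|[Ug gy]] /=.
  rewrite induced_class_act => /esym /induced_class_eq /=.
  by rewrite invg1 mulg1 mul1g.
split=> //; apply: val_inj; rewrite /= induced_class_act.
by apply/esym/induced_class_eq; rewrite /= invg1 mulg1 mul1g.
Qed.

Lemma orbit_volE U (X : gset U) (x y : X) : gs_orbit x y ->
  tr_vol mu (orbit_trset x) = idx U (stabilizer y).
Proof.
by move=> xy; rewrite (tr_volE (SigSub (mem_set xy) : orbit_trset x)) stabilizer_sub.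
Qed.

Lemma idx_orbit U (X : gset U) (x y : X) : gs_orbit x y ->
  idx U (stabilizer x) = idx U (stabilizer y).
Proof. by move=> xy; rewrite -(orbit_volE xy) -(orbit_volE (orbit_refl x)). Qed.

Lemma idx_act (X Y : Gset F) (x : X) (y : Y) h :
  idx (stabilizer x) (stabilizer ((x, y) : prod_gset X Y)) =
  idx (stabilizer (gs_act h x)) (stabilizer ((gs_act h x, gs_act h y) : prod_gset X Y)).
Proof.
have [f fE] : exists f : gmap (orbit_trset ((x, y) : prod_gset X Y)) (orbit_trset x),
    f (orbit_pt _) = orbit_pt _.
  apply: gmap_exists => g /(congr1 val); rewrite sub_gsetE // => -[gx _].
  by apply: val_inj; rewrite sub_gsetE.
have := measure_idx f (orbit_pt _); rewrite fE !stabilizer_sub => <-.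
rewrite (measure_idx f (gs_act h (orbit_pt _))) gm_equivariant // fE.
by rewrite !stabilizer_sub !sub_gsetE.
Qed.

Definition orbit_reps U (X : gset U) (S : set X) (I : finType) (r : I -> X) :=
  (forall i, S (r i)) /\ (forall x, S x -> exists! i, gs_orbit (r i) x).

Lemma orbit_reps_sum U (X : gset U) (S : set X) (I J : finType) (r : I -> X) (r' : J -> X) :
  orbit_reps S r -> orbit_reps S r' ->
  \sum_i idx U (stabilizer (r i)) = \sum_j idx U (stabilizer (r' j)).
Proof.
move=> [rS rP] [r'S r'P].
have [c cP] := choice (fun j => rP _ (r'S j)).
have [d dP] := choice (fun i => r'P _ (rS i)).
rewrite (reindex c) /=; last first.
  apply: onW_bij; exists d => [j|i].
    by have [_] := dP (c j); apply; apply: gs_orbit_sym; case: (cP j).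
  by have [_] := cP (d i); apply; apply: gs_orbit_sym; case: (dP i).
by apply: eq_bigr => j _; apply: idx_orbit; case: (cP j).
Qed.

Lemma orbit_reps_ord U (X : gset U) (S : set X) (I : finType) (r : I -> X) :
  orbit_reps S r -> orbit_decomposition S (r \o @enum_val I predT).
Proof.
move=> [rS rP]; split=> [i|x Sx]; first exact: rS.
have [i [ix iu]] := rP x Sx; exists (enum_rank i); split=> [|j /iu jx].
  by rewrite /= enum_rankK.
by rewrite jx enum_valK.
Qed.

Lemma volE U (X : gset U) (S : set X) (I : finType) (r : I -> X) :
  orbit_reps S r -> vol mu S = \sum_i idx U (stabilizer (r i)).
Proof.
move=> rS; rewrite /vol; case: xgetP => [v _ [n [r' [r'S ->]]]|]; last first.
  move=> /(_ _ (ex_intro _ _ (ex_intro _ _ (conj (orbit_reps_ord rS) erefl)))).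
  by [].
rewrite (eq_bigr _ (fun i _ => orbit_volE (orbit_refl (r' i)))).
exact: orbit_reps_sum r'S rS.
Qed.

Lemma vol_orbit U (X : gset U) (x : X) : vol mu (gs_orbit x) = idx U (stabilizer x).
Proof.
rewrite (@volE _ _ _ 'I_1 (fun=> x)) ?big_ord1 //; split=> [_|y xy].
  exact: orbit_refl.
by exists ord0; split=> // j _; rewrite [j]ord1.
Qed.

Lemma vol_bigU U (X : gset U) (J : finType) (S : set X) (T : J -> set X) :
  finite_orbits X -> (forall j, gs_stable (T j)) ->
  (forall x, S x <-> exists j, T j x) ->
  (forall i j x, T i x -> T j x -> i = j) ->
  vol mu S = \sum_j vol mu (T j).
Proof.
move=> Xf Tst ST Tdis.
pose P j n (r : 'I_n -> X) := orbit_decomposition (T j) r.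
have ex j : exists n (r : 'I_n -> X), orbit_decomposition (T j) r.
  exact: finite_orbits_decomposition.
have [n nP] := choice ex.
pose r j := projT1 (cid (nP j)); have rP j := projT2 (cid (nP j)).
have rS : orbit_reps S (fun p : {j : J & 'I_(n j)} => r _ (tagged p)).
  split=> [[j i] /=|x /ST[j Tx]]; first by apply/ST; exists j; exact: (rP j).1.
  have [i [ix iu]] := (rP j).2 x Tx.
  exists (Tagged (fun j => 'I_(n j)) i); split=> // -[j' i'] /= i'x.
  have e : j = j'.
    apply: (Tdis _ _ x) => //.
    by case: i'x => g Ug ->; apply: Tst => //; exact: (rP j').1.
  by subst j'; rewrite (iu i').
rewrite (volE rS); under eq_bigr => p _ do rewrite -[p in tagged p]/p.
rewrite (eq_bigr (fun j => \sum_(i < n j) idx U (stabilizer (r j i)))); last first.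
  by move=> j _; exact: volE (rP j).
by rewrite sig_big_dep /=.
Qed.

(** The orbit of [(x, U)] in [X * G/U] realizes [G/K -> G/U], for [K] the
    stabilizer of [x] in [U], with [U]-orbit of [x] as a fibre. *)
Lemma idx_orbit_snd U (X : Gset F) (x : res_gset U X) :
  idx U (stabilizer x) =
  mu _ _ (orbit_snd ((x, coset_pt U) : prod_gset X (coset_trset U)) : gmap _ (coset_trset U)).
Proof.
set p := (x, coset_pt U) : prod_gset X (coset_trset U).
rewrite (measure_idx _ (orbit_pt p)) /= stab_coset_pt stabilizer_sub; congr idx.
apply: osg_ext => g; split=> [[Ug gx]|[_ /pair_equal_spec[gx /coset_ptP Ug]]] //.
by split=> //=; congr pair => //; exact/coset_ptP.
Qed.

(** Base change along [G/L -> G/U]. *)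
Lemma orbit_idx_sum U L (X : Gset F) (x : res_gset U X) n (r : 'I_n -> res_gset L X) :
  (forall g, L g -> U g) ->
  orbit_decomposition (gs_orbit x : set (res_gset L X)) r ->
  idx U (stabilizer x) = \sum_(i < n) idx L (stabilizer (r i)).
Proof.
move=> LU [rx rP].
pose p : prod_gset X (coset_trset U) := (x, coset_pt U).
have [h hE] := coset_map_exists LU.
have [u uP] : exists u : 'I_n -> G, forall i, U (u i) /\ r i = gs_act (u i) x.
  have /choice[u uP] : forall i, exists u : G, U u /\ r i = gs_act u x.
    by move=> i; have [u Uu e] := rx i; exists u.
  by exists u.
pose q i : orbit_trset p := gs_act (u i) (orbit_pt p).
have qE i : val (q i) = (r i, coset_pt U).
  have [Uu ri] := uP i; rewrite sub_gsetE //=; congr pair; first by rewrite ri.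
  exact/coset_ptP.
rewrite idx_orbit_snd -/p.
rewrite (@measure_base _ _ _ _ h (coset_pt L) n q).
- apply: eq_bigr => i _; rewrite stab_coset_pt; congr idx.
  apply: osg_ext => g; split=> [[_ /pair_equal_spec[/(congr1 val)]]|[Lg gr]].
    by rewrite sub_gsetE // qE => -[gr _] /coset_ptP Lg.
  split=> //; congr pair; last exact/coset_ptP.
  apply: val_inj; rewrite sub_gsetE // qE; congr pair => //.
  exact/coset_ptP/LU.
- by move=> i; rewrite hE /= qE.
- move=> y; rewrite hE => yE; have [g _ gE] := set_valP y.
  have y2 : (val y).2 = coset_pt U := yE.
  have Ug : U g by apply/coset_ptP; rewrite -[RHS]y2 gE.
  have yv : val y = (gs_act g x, coset_pt U).
    by rewrite [LHS]surjective_pairing y2 gE.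
  have [|i [[l Ll lE] iu]] := rP (gs_act g x); first by exists g.
  exists i; split=> [|j [a /coset_ptP La ya]].
    exists l; first exact/coset_ptP.
    apply: val_inj; rewrite sub_gsetE // yv qE lE; congr pair.
    by apply/esym/coset_ptP/LU.
  apply: iu; exists a => //.
  by move: (congr1 val ya); rewrite sub_gsetE // yv qE => -[].
Qed.

Lemma res_stable U L (X : Gset F) (S : set X) : (forall g, L g -> U g) ->
  gs_stable (S : set (res_gset U X)) -> gs_stable (S : set (res_gset L X)).
Proof. by move=> LU St g x /LU; exact: St. Qed.

Lemma vol_res U L (X : Gset F) (S : set X) : (forall g, L g -> U g) ->
  finite_orbits X -> gs_stable (S : set (res_gset U X)) ->
  vol mu (S : set (res_gset U X)) = vol mu (S : set (res_gset L X)).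
Proof.
move=> LU Xf St.
have [n [r rP]] := finite_orbits_decomposition (finitary_finite_orbits U Xf) St.
have Lf := finitary_finite_orbits L Xf.
have st i : @gs_stable _ L (res_gset L X) (gs_orbit (r i)).
  by apply: res_stable LU _; exact: orbit_stable.
rewrite (volE rP) (@vol_bigU L (res_gset L X) 'I_n S (fun i => gs_orbit (r i))) //.
- apply: eq_bigr => i _.
  have [m [r' r'P]] := finite_orbits_decomposition Lf (st i).
  by rewrite (volE r'P); apply: orbit_idx_sum.
- move=> x; split=> [Sx|[i [g Ug ->]]]; last by apply: St => //; exact: rP.1.
  by have [i [ix _]] := rP.2 x Sx; exists i.
- move=> i j x [g Ug xi] xj; have Sx : S x by rewrite xi; apply: St => //; exact: rP.1.
  have [l [_ lu]] := rP.2 x Sx.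
  by rewrite -(lu i) ?(lu j) //; exists g.
Qed.

Lemma vol_bij U (X X' : gset U) (S : set X) (S' : set X') (phi : X -> X') :
  finite_orbits X -> gs_stable S -> (forall x, S x -> S' (phi x)) ->
  (forall x y, S x -> S y -> phi x = phi y -> x = y) ->
  (forall x', S' x' -> exists2 x, S x & phi x = x') ->
  (forall g x, U g -> S x -> phi (gs_act g x) = gs_act g (phi x)) ->
  vol mu S = vol mu S'.
Proof.
move=> Xf St SS' inj surj eqv.
have [n [r rP]] := finite_orbits_decomposition Xf St.
have r'P : orbit_reps S' (phi \o r).
  split=> [i|x' /surj[x Sx <-]]; first by apply: SS'; exact: rP.1.
  have [i [[g Ug xE] iu]] := rP.2 x Sx.
  exists i; split=> [|j [h Uh hE]]; first by exists g; rewrite // xE eqv //; exact: rP.1.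
  apply: iu; exists h => //; apply: inj => //; first by apply: St => //; exact: rP.1.
  by rewrite hE /= eqv //; exact: rP.1.
rewrite (volE rP) (volE r'P); apply: eq_bigr => i _; congr idx.
apply: osg_ext => g; have Sr := rP.1 i.
split=> -[Ug gx]; split=> //; first by rewrite /= -eqv // gx.
by apply: inj => //; [exact: St|rewrite eqv].
Qed.

End Index.

(** * Measures are determined by the volume of the symplectic space *)

Section Universality.
Variable F : finFieldType.
Notation V := (symp_space F).
Notation G := (symp_group F).
Implicit Types (U K L : open_subgroup F) (s : seq V) (g h : G).

Definition vec_vol (k : fieldType) (mu : measure F k) : k := vol mu [set: vector_gset F]%classic.

(** [c] is the same rational polynomial in the volume of the symplectic space for
    all measures with values in characteristic [0]; the denominator [d] keeps the
    coefficients integral, so that they map to every field. *)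
Definition universal (c : forall k : fieldType, measure F k -> k) :=
  exists (P : {poly int}) (d : nat), (0 < d)%N /\
    forall (k : fieldType), [pchar k] =i pred0 -> forall mu : measure F k,
      d%:R * c k mu = (map_poly intr P).[vec_vol mu].

Lemma universal_ext c c' : (forall (k : fieldType) (mu : measure F k), [pchar k] =i pred0 ->
  c k mu = c' k mu) -> universal c -> universal c'.
Proof.
by move=> e [P [d [d0 cP]]]; exists P, d; split=> // k k0 mu; rewrite -e // cP.
Qed.

Lemma universal_int (z : int) : universal (fun k _ => z%:~R).
Proof. by exists z%:P, 1%N; split=> // k _ mu; rewrite mul1r map_polyC hornerC. Qed.

Lemma universal_vec_vol : universal vec_vol.
Proof. by exists 'X, 1%N; split=> // k _ mu; rewrite mul1r map_polyX hornerX. Qed.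

Lemma universalD c c' : universal c -> universal c' ->
  universal (fun k mu => c k mu + c' k mu).
Proof.
move=> [P [d [d0 cP]]] [P' [d' [d'0 cP']]].
exists (P *+ d' + P' *+ d), (d * d')%N; split=> [|k k0 mu].
  by rewrite muln_gt0 d0.
rewrite rmorphD !rmorphMn /= hornerD !hornerMn -cP // -cP' //.
rewrite natrM mulrDr; congr (_ + _); rewrite -[RHS]mulr_natr.
  by rewrite mulrAC.
by rewrite -mulrA mulrC.
Qed.

Lemma universalM c c' : universal c -> universal c' ->
  universal (fun k mu => c k mu * c' k mu).
Proof.
move=> [P [d [d0 cP]]] [P' [d' [d'0 cP']]].
exists (P * P'), (d * d')%N; split=> [|k k0 mu]; first by rewrite muln_gt0 d0.
by rewrite [map_poly _ _]rmorphM /= hornerM -cP // -cP' // natrM mulrACA.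
Qed.

Lemma universalN c : universal c -> universal (fun k mu => - c k mu).
Proof.
move=> [P [d [d0 cP]]]; exists (- P), d; split=> // k k0 mu.
by rewrite rmorphN /= hornerN -cP // mulrN.
Qed.

Lemma universal_div n c : (0 < n)%N -> universal (fun k mu => n%:R * c k mu) -> universal c.
Proof.
move=> n0 [P [d [d0 cP]]]; exists P, (d * n)%N; split=> [|k k0 mu].
  by rewrite muln_gt0 d0.
by rewrite natrM -mulrA cP.
Qed.

Lemma vector_finite_orbits : finite_orbits (vector_gset F).
Proof.
have [I [r rP]] := vector_orbits [::]%SEQ (F := F).
by exists I, r => v; have [i [g [_ ->]]] := rP v; exists i; exists g.
Qed.

Lemma vec_vol_res (k : fieldType) (mu : measure F k) U :
  vec_vol mu = vol mu [set: res_gset U (vector_gset F)]%classic.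
Proof.
have vf := vector_finite_orbits.
pose X := res_gset (full_subgroup F) (vector_gset F).
transitivity (vol mu (setT : set X)); last exact: (@vol_res F k mu _ U (vector_gset F) setT).
apply: (@vol_bij F k mu _ (vector_gset F) X setT setT id) => //.
by move=> x _; exists x.
Qed.

Definition pairing s (v : V) := [ffun j : 'I_(size s) => <<v, (s`_j)>>].

Lemma pairingP s v w : pairing s v = pairing s w <-> perp (v - w) s.
Proof.
split=> [/ffunP e x xs|vws]; last first.
  apply/ffunP => j; rewrite !ffunE; apply/eqP; rewrite -subr_eq0 -symp_formNl -symp_formDl.
  by apply/eqP/vws/mem_nth.
have xj : (index x s < size s)%N by rewrite index_mem.
have := e (Ordinal xj); rewrite !ffunE /= nth_index // symp_formDl symp_formNl => ->.
exact: subrr.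
Qed.

Lemma pairing_act s g v : fixes g s -> pairing s (g v) = pairing s v.
Proof.
move=> gs; apply/ffunP => j; rewrite !ffunE -[in LHS](gs (s`_j)) ?sp_form //.
exact: mem_nth.
Qed.

Definition pairing_fiber s v : set (res_gset (fixator s) (vector_gset F)) :=
  [set w | pairing s w = pairing s v]%classic.

Arguments pairing_fiber : clear implicits.

Lemma pairing_fiber_stable s v : gs_stable (pairing_fiber s v).
Proof. by move=> g x gs; rewrite /pairing_fiber /= pairing_act. Qed.

(** Translation by [w - v] identifies two fibres of [pairing s], and it is
    equivariant for the open subgroup that also fixes [w - v]. *)
Lemma pairing_fiber_vol (k : fieldType) (mu : measure F k) s v w :
  vol mu (pairing_fiber s v) = vol mu (pairing_fiber s w).
Proof.
pose L := fixator ((w - v) :: s).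
have LU g : L g -> fixator s g by move=> /fixes_cons[].
have st u : gs_stable (pairing_fiber s u) by exact: pairing_fiber_stable.
have vf := vector_finite_orbits.
rewrite !(vol_res mu LU) //.
pose X := res_gset L (vector_gset F).
apply: (@vol_bij F k mu L X X (pairing_fiber s v) (pairing_fiber s w) (fun x : V => x + (w - v))).
- exact: finitary_finite_orbits.
- exact: res_stable LU (st v).
- move=> x /= /pairingP xv; apply/pairingP.
  by rewrite [w - v]addrC addrA addrK.
- by move=> x y _ _ /addIr.
- move=> y /= /pairingP yw; exists (y - (w - v)); last by rewrite subrK.
  by apply/pairingP; rewrite opprB [v - w]addrC addrA addrK.
- by move=> g x /fixes_cons[gw _] _; rewrite /= sp_D gw.
Qed.

(** If [N] is the number of fibres of [pairing s] and [M] the number of vectors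
    of the span of [s] in the fibre of [v], the orbit of [v] under the fixator
    of [s] is that fibre with [M] points removed: its volume is [t / N - M]. *)
Lemma universal_vector s v :
  universal (fun k mu => idx mu (fixator s) (fixator (v :: s))).
Proof.
have [vs|vs] := boolP (v \in span s).
  apply: universal_ext (universal_int 1) => k mu _ /=.
  have -> : fixator (v :: s) = fixator s; last by rewrite idxxx.
  apply: osg_ext => g; split=> [/fixes_cons[]|gs] //.
  by apply/fixes_cons; split=> //; exact: (fixes_span gs).
have [n [r [_ rP]]] := class_reps (fun=> True) (pairing s).
pose J : finType := seq_sub [seq w <- span s | pairing s w == pairing s v].
have n0 : (0 < n)%N by have [i _] := rP v I; apply: leq_ltn_trans (ltn_ord i).
pose U := fixator s; pose X := res_gset U (vector_gset F).
apply: (@universal_div n) => //.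
refine (universal_ext _ (universalD universal_vec_vol (universal_int (- (n * #|J|)%N%:Z)))).
move=> k mu _ /=.
have -> : vec_vol mu = n%:R * vol mu (pairing_fiber s v).
  rewrite (vec_vol_res _ U) (@vol_bigU _ _ mu _ X 'I_n _ (fun i => pairing_fiber s (r i))).
  - rewrite (eq_bigr (fun=> vol mu (pairing_fiber s v))); last by move=> *; exact: pairing_fiber_vol.
    by rewrite sumr_const card_ord mulr_natl.
  - exact/finitary_finite_orbits/vector_finite_orbits.
  - by move=> j; exact: pairing_fiber_stable.
  - by move=> x; split=> // _; have [i [ei _]] := rP x I; exists i.
  - move=> i j x; rewrite /pairing_fiber /= => xi xj.
    have [l [_ lu]] := rP x I.
    by rewrite -(lu i) ?(lu j).
pose q (o : 'I_1 + J) : X := if o is inr w then ssval w else v.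
have qP : orbit_reps (pairing_fiber s v) q.
  have Jin (w : J) : (ssval w \in span s) /\ pairing s (ssval w) = pairing s v.
    by have := ssvalP w; rewrite mem_filter => /andP[/eqP].
  have fixJ (w : J) g : fixes g s -> g (ssval w) = ssval w.
    by move=> gs; apply: (fixes_span gs); case: (Jin w).
  split=> [[_|w] //=|x xv]; first by case: (Jin w).
  have [xs|xs] := boolP (x \in span s).
    have xJ : x \in [seq w <- span s | pairing s w == pairing s v].
      by rewrite mem_filter xs andbT; apply/eqP.
    exists (inr (SeqSub xJ)); split=> [|[i [g gs xw]|w [g gs xw]]].
    - exact: orbit_refl.
    - case/negP: vs; rewrite -(span_map g).
      have e : map g s = s by rewrite -[RHS]map_id; apply/eq_in_map.
      by rewrite e; rewrite xw in xs.
    - by congr inr; apply: val_inj; rewrite /= xw /= fixJ.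
  exists (inl ord0); split=> [|[i _|w [g gs xw]]]; last 2 first.
  - by rewrite [i]ord1.
  - by case/negP: xs; rewrite xw /= fixJ //; case: (Jin w).
  have [|||||g [gs' gs xg]] := @transvections_transitive F (fun g => fixes g s) s [::]%SEQ v x => //.
  - by move=> g h; exact: fixesM.
  - by move=> w c ws _; exact: transvection_perp.
  - exact/pairingP.
  - by exists g => //; rewrite /= xg.
rewrite (volE mu qP) big_sumType /= big_ord1 (eq_bigr (fun=> 1)) => [|w _]; last first.
  rewrite -[RHS](idxxx mu U); congr idx; apply: osg_ext => g; split=> [[]|gs] //.
  split=> //=; apply: (fixes_span gs).
  by have := ssvalP w; rewrite mem_filter => /andP[].
rewrite sumr_const mulrDr mulrNz -pmulrn natrM addrK; congr (_ * idx _ _ _).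
by apply: osg_ext => g; split=> [[gs gv]|/fixes_cons[gv gs]] //; exact/fixes_cons.
Qed.

Lemma universal_fixator s s' : {subset span s <= span s'} ->
  universal (fun k mu => idx mu (fixator s) (fixator s')).
Proof.
move=> ss'; have -> : fixator s' = fixator (s' ++ s).
  apply: osg_ext => g; split=> [gs v|gs v vs]; last by apply: gs; rewrite mem_cat vs.
  rewrite mem_cat => /orP[/gs//|/mem_span/ss' vs].
  exact: (fixes_span gs).
elim: s' {ss'} => [|v s' IH].
  by apply: universal_ext (universal_int 1) => k mu _; rewrite idxxx.
apply: universal_ext (universalM IH (universal_vector (s' ++ s) v)) => k mu _ /=.
rewrite -idx_trans // => g; first by move=> /fixes_cons[].
by move=> gs x xs; apply: gs; rewrite mem_cat xs orbT.
Qed.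

(** The fixator of the core acts trivially on its [n] cosets in [U], so that [n]
    points make up the fibre of a base change. *)
Lemma idx_core U s : is_core U s -> exists2 n, (0 < n)%N &
  forall (k : fieldType) (mu : measure F k), idx mu U (fixator s) = n%:R.
Proof.
move=> sU; have [n [u [uU uP]]] := core_index sU.
exists n => [|k mu]; first by have [i _] := uP _ (osg_1 U); apply: leq_ltn_trans (ltn_ord i).
pose L := fixator s; pose X := coset_gset L; pose x : res_gset U X := coset_pt L.
have LU g : L g -> U g by exact: sU.1.
have Lu i g : L g -> L ((u i)^-1 * g * u i)%g.
  move=> gs v vs; rewrite !sp_mulE (fixes_span gs) ?sp_VK //.
  exact/(core_stable sU (uU i))/mem_span.
have Lx i g : L g -> @gs_act F _ X g (gs_act (u i) (coset_pt L)) = gs_act (u i) (coset_pt L).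
  move=> /(Lu i)/coset_ptP e.
  by rewrite -[in RHS]e -!(@gs_actM F _ X) // !mulgA mulgV mul1g.
have key j g : fixes ((u j)^-1 * g)%g s <->
    @gs_act F _ X g (coset_pt L) = gs_act (u j) (coset_pt L).
  rewrite -[fixes _ _]/(L _) -(coset_ptP L); split=> e.
    by rewrite -[in RHS]e -(@gs_actM F _ X) // mulgA mulgV mul1g.
  by rewrite (@gs_actM F _ X) // e -(@gs_actM F _ X) // mulVg gs_act1.
have -> : fixator s = stabilizer x.
  apply: osg_ext => g; split=> [gs|[_ /coset_ptP]] //.
  by split; [exact: LU|exact/coset_ptP].
rewrite (@orbit_idx_sum F k mu U L X x n (fun i => gs_act (u i) x)) //.
  rewrite (eq_bigr (fun=> 1)) ?sumr_const ?card_ord // => i _.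
  rewrite -[RHS](idxxx mu L); congr idx.
  by apply: osg_ext => g; split=> [[]|gs] //; split=> //; exact: Lx.
split=> [i|y [g Ug ->]]; first by exists (u i).
have [i [ui iu]] := uP g Ug.
exists i; split=> [|j [l Ll e]].
  by exists 1%g; [exact: osg_1|rewrite gs_act1; exact/key].
by apply/iu/key; rewrite [LHS]e; exact: Lx.
Qed.

(** With cores [s] of [U] and [s'] of [K], the index of the fixator of [s'] in [U]
    is computed through [K] and through the fixator of [s], which contains it by
    leastness of the core; the factors other than [idx mu U K] are known, and the
    one by which to divide is a positive integer. *)
Lemma universal_idx U K : (forall g, K g -> U g) -> universal (fun k mu => idx mu U K).
Proof.
move=> KU; have [s sU] := core_exists U; have [s' s'K] := core_exists K.
have [n n0 nP] := idx_core sU; have [n' n'0 n'P] := idx_core s'K.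
have ss' : {subset span s <= span s'} by apply: sU.2 => g /s'K.1/KU.
apply: (@universal_div n') => //.
apply: universal_ext (universalM (universal_int n) (universal_fixator ss')) => k mu _ /=.
rewrite -[_%:~R]/(n%:R) -(nP k mu) -(n'P k mu) [RHS]mulrC -!idx_trans //.
- exact: s'K.1.
- move=> g gs' v /mem_span/ss' vs; exact: (fixes_span gs').
- exact: sU.1.
Qed.

Lemma universal_measure (Y X : trGset F) (f : gmap Y X) :
  universal (fun k mu => mu _ _ f).
Proof.
have [y _] := tr_transitive Y.
have yf g : stabilizer y g -> stabilizer (f y) g.
  by move=> [_ gy]; split=> //; rewrite -gm_equivariant ?gy.
by apply: universal_ext (universal_idx yf) => k mu _; rewrite -measure_idx.
Qed.

Lemma universal_theta (a : theta_expr F) : universal (fun k mu => theta_eval mu a).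
Proof.
elim: a => [Y X f|||a IH|a IHa b IHb|a IHa b IHb] /=.
- exact: universal_measure.
- exact: universal_int 0.
- exact: universal_int 1.
- exact: universalN.
- exact: universalD.
- exact: universalM.
Qed.

End Universality.

(** * Points fixed by the groups G(n) *)

Section Counting.
Local Open Scope nat_scope.

(** The counting type is arbitrary, so that disjoint unions need no
    renumbering. *)
Definition ncard T (A : set T) m := exists (I : finType) (e : I -> T),
  [/\ injective e, forall x, A x <-> exists i, e i = x & #|I| = m].

Lemma ncard_bij T T' (A : set T) (B : set T') (phi : T -> T') m :
  (forall x, A x -> B (phi x)) ->
  (forall x y, A x -> A y -> phi x = phi y -> x = y) ->
  (forall y, B y -> exists2 x, A x & phi x = y) ->
  ncard A m -> ncard B m.
Proof.
move=> AB inj surj [I [e [ei eA <-]]]; exists I, (phi \o e).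
have Ae i : A (e i) by apply/eA; exists i.
split=> // [i j /inj ij|y]; first by apply: ei; exact: ij.
split=> [/surj[x /eA[i <-] <-]|[i <-]]; first by exists i.
exact: AB.
Qed.

Lemma ncard_uniq T (A : set T) m m' : ncard A m -> ncard A m' -> m = m'.
Proof.
suff le n n' : ncard A n -> ncard A n' -> n <= n'.
  by move=> h h'; apply/eqP; rewrite eqn_leq !le.
move=> [I [e [ei eA <-]]] [J [f [fi fA <-]]].
have [c cP] := choice (fun i => (fA (e i)).1 ((eA _).2 (ex_intro _ i erefl))).
by apply: (@leq_card _ _ c) => i j ij; apply: ei; rewrite -!cP ij.
Qed.

Lemma ncard_card T (A : set T) m : ncard A m -> (A #= `I_m)%card.
Proof.
move=> [I [e [ei eA <-]]].
have A0 : (A #= [set: I])%card.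
  have -> : A = [set e i | i in [set: I]]%classic.
    by apply/seteqP; split=> [x /eA[i <-]|x [i _ <-]]; [exists i|apply/eA; exists i].
  by apply: inj_card_eq => i j _ _; exact: ei.
apply: card_eq_trans A0 _; rewrite card_eq_sym; apply: card_eq_trans card_II _.
have -> : [set: I]%classic = [set enum_val i | i in [set: 'I_#|I|]]%classic.
  by apply/seteqP; split=> // x _; exists (enum_rank x); rewrite ?enum_rankK.
rewrite card_eq_sym; apply: inj_card_eq => i j _ _; exact: enum_val_inj.
Qed.

Lemma ncard_bigU T (A : set T) (J : finType) (B : J -> set T) (m : J -> nat) :
  (forall x, A x <-> exists j, B j x) ->
  (forall i j x, B i x -> B j x -> i = j) ->
  (forall j, ncard (B j) (m j)) -> ncard A (\sum_j m j).
Proof.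
move=> AB dis Bm.
pose I j := projT1 (cid (Bm j)); have IP j := projT2 (cid (Bm j)).
pose e j := projT1 (cid (IP j)); have eP j := projT2 (cid (IP j)).
exists {j : J & I j}, (fun p => e _ (tagged p)); split.
- move=> [i a] [j b] /= ab.
  have ij : i = j.
    have [_ ei _] := eP i; have [_ ej _] := eP j.
    by apply: (dis _ _ (e i a)); [apply/ei; exists a|apply/ej; exists b; rewrite ab].
  by subst j; have [ei _ _] := eP i; rewrite (ei _ _ ab).
- move=> x; split=> [/AB[j Bx]|[[j a] <-]]; have [_ ej _] := eP j.
    by have /ej[a <-] := Bx; exists (Tagged I a).
  by apply/AB; exists j; apply/ej; exists a.
- rewrite card_tagged sumnE big_map big_enum /=.
  by apply: eq_bigr => j _; have [_ _] := eP j.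
Qed.

Lemma ncard_eq T (A B : set T) m : (forall x, A x <-> B x) -> ncard A m -> ncard B m.
Proof.
move=> AB [I [e [ei eA eI]]]; exists I, e; split=> // x.
by rewrite -AB.
Qed.

End Counting.

Section FixedPoints.
Variable F : finFieldType.
Notation V := (symp_space F).
Notation G := (symp_group F).
Implicit Types (U K L : open_subgroup F) (s : seq V) (g h : G).

Definition coord_basis n : seq V :=
  [seq basis_e F i | i <- iota 0 n] ++ [seq basis_f F i | i <- iota 0 n].

Lemma coord_decomp n v : v \in coord_space n ->
  v = \sum_(i < n) (v.1`_i *: basis_e F i + v.2`_i *: basis_f F i).
Proof.
rewrite inE => /andP[v1 v2].
have fst_sum (f : 'I_n -> V) : (\sum_(i < n) f i).1 = \sum_(i < n) (f i).1.
  by apply: (big_morph fst (id1 := 0) (op1 := +%R)).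
have snd_sum (f : 'I_n -> V) : (\sum_(i < n) f i).2 = \sum_(i < n) (f i).2.
  by apply: (big_morph snd (id1 := 0) (op1 := +%R)).
rewrite [RHS]surjective_pairing fst_sum snd_sum [LHS]surjective_pairing; congr pair.
  rewrite (eq_bigr (fun i : 'I_n => v.1`_i *: 'X^i)) => [|i _]; last first.
    by rewrite /= scaler0 addr0.
  rewrite -poly_def; apply/polyP => i; rewrite coef_poly.
  by case: ltnP => // ni; rewrite nth_default // (leq_trans v1).
rewrite (eq_bigr (fun i : 'I_n => v.2`_i *: 'X^i)) => [|i _]; last first.
  by rewrite /= scaler0 add0r.
rewrite -poly_def; apply/polyP => i; rewrite coef_poly.
by case: ltnP => // ni; rewrite nth_default // (leq_trans v2).
Qed.

Lemma span_coord_basis n v : (v \in span (coord_basis n)) = (v \in coord_space n).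
Proof.
apply/idP/idP.
  apply: span_coord => x; rewrite mem_cat => /orP[] /mapP[i];
    rewrite mem_iota add0n => /andP[_ ni] ->; [exact: basis_e_coord|exact: basis_f_coord].
move=> /coord_decomp->; apply: (big_ind (fun x => x \in span (coord_basis n))).
- exact: span0.
- exact: spanD.
- by move=> i _; apply: spanD; apply/spanZ/mem_span; rewrite mem_cat map_f ?orbT // mem_iota /=.
Qed.

Lemma symp_fixP n g : symp_fix n g <-> fixes g (coord_basis n).
Proof.
split=> [gn v|gn i ni].
  by rewrite mem_cat => /orP[] /mapP[i]; rewrite mem_iota add0n => /andP[_ /gn[]] + + ->.
by split; apply: gn; rewrite mem_cat map_f ?orbT // mem_iota /=.
Qed.

Lemma symp_fix_coord n g : symp_fix n g -> fixes g (coord_basis n) /\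
  forall v, v \in coord_space n -> g v = v.
Proof.
by move=> /symp_fixP gn; split=> // v; rewrite -span_coord_basis; exact: fixes_span.
Qed.

Lemma normalizes_fixed n (X : Gset F) h (x : X) : normalizes n h ->
  fixed_points n x -> fixed_points n (gs_act h x).
Proof.
move=> [h1 h2] xn k kn; rewrite -gs_actM //.
have /xn e : symp_fix n (h^-1 * k * h)%g.
  apply/symp_fixP => v /mem_span; rewrite span_coord_basis => vn.
  by rewrite !sp_mulE (symp_fix_coord kn).2 ?sp_VK // h1.
by rewrite -[in RHS]e -!gs_actM // !mulgA mulgV mul1g.
Qed.

(** If [G(n)] fixes [g x], the coordinate space moved back by [g] contains the
    core of the stabilizer of [x], which is least. *)
Lemma fixed_core n (X : Gset F) (x : X) s g : is_core (stabilizer x) s ->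
  fixed_points n (gs_act g x) <-> {subset map g s <= coord_space n}.
Proof.
move=> [sx smin]; split=> [gx w /mapP[v vs ->]|sn k kn].
  rewrite -span_coord_basis -(span_map g^-1%g) sp_VK.
  apply: smin (mem_span vs) => h hs; split=> //.
  have kn : symp_fix n (g * h * g^-1)%g.
    by apply/symp_fixP; move: hs => /fixes_map; rewrite invgK.
  have := gx _ kn; rewrite -!gs_actM // -!mulgA mulVg mulg1 => e.
  by rewrite -[h](mulKg g) gs_actM // e -gs_actM // mulVg gs_act1.
have [_ e] : stabilizer x (g^-1 * k * g)%g.
  apply: sx => v vs; rewrite !sp_mulE (symp_fix_coord kn).2 ?sp_VK //.
  by rewrite sn ?map_f.
by rewrite -[in RHS]e -!gs_actM // !mulgA mulgV mul1g.
Qed.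

(** The fixed points of [G(n)] in an orbit are a single orbit of the normalizer,
    since an isometry of the core into the coordinate space extends to it. *)
Lemma fixed_transitive n (X : Gset F) (x : X) s g : is_core (stabilizer x) s ->
  {subset s <= coord_space n} -> fixed_points n (gs_act g x) ->
  exists2 h, normalizes n h & gs_act g x = gs_act h x.
Proof.
move=> sx sn /(fixed_core _ _ sx) gsn.
have [h hn hg] := coord_witt sn gsn.
exists h => //.
have [_ e] : stabilizer x (g^-1 * h)%g.
  by apply: sx.1 => v vs; rewrite sp_mulE hg // sp_VK.
by rewrite -[in LHS]e -gs_actM // mulVKg.
Qed.

(** A fixed point [g x0] is determined by the image under [g] of the core, which
    lies in a finite coordinate space. *)
Lemma fixed_finite n (X : trGset F) (A : set X) : (forall x, A x -> fixed_points n x) ->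
  exists m, ncard A m.
Proof.
move=> An; have [x0 _] := tr_transitive X.
have [s sx] := core_exists (stabilizer x0).
have [a aE] := choice (tr_act x0).
pose B := span (coord_basis n).
pose c x := [ffun j : 'I_(size s) => inord (index (a x (s`_j)) B) : 'I_(size B).+1].
have [m [r [rA rP]]] := class_reps A c.
have cinj x y : A x -> A y -> c x = c y -> x = y.
  move=> /An xn /An yn /ffunP e.
  have vB z v : fixed_points n z -> v \in s -> a z v \in B.
    rewrite [in fixed_points _ _](aE z) => /(fixed_core _ _ sx) h vs.
    by rewrite span_coord_basis h ?map_f.
  rewrite (aE x) (aE y).
  have [_ e'] : stabilizer x0 ((a x)^-1 * a y)%g.
    apply: sx.1 => v vs; rewrite sp_mulE.
    suff -> : a y v = a x v by rewrite sp_VK.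
    have vj : (index v s < size s)%N by rewrite index_mem.
    move: (e (Ordinal vj)); rewrite !ffunE /= nth_index // => /(congr1 val) /=.
    rewrite !inordK ?ltnS ?index_size // => exy.
    by rewrite -(nth_index 0 (vB y v yn vs)) -exy nth_index // vB.
  by rewrite -[in LHS]e' -gs_actM // mulVKg.
exists m, 'I_m, r; split; rewrite ?card_ord //.
  move=> i j ij; have [l [_ lu]] := rP _ (rA i).
  by rewrite -(lu i erefl) -(lu j (congr1 c (esym ij))).
move=> x; split=> [Ax|[i <-] //]; have [i [ci _]] := rP x Ax.
by exists i; exact: cinj.
Qed.

Definition fiber_ncard (Y X : Gset F) (f : gmap Y X) n m :=
  (exists x : X, fixed_points n x) /\
  forall x : X, fixed_points n x -> ncard (fun y : Y => fixed_points n y /\ f y = x) m.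

Definition fiber_count (Y X : Gset F) (f : gmap Y X) n : nat :=
  if pselect (exists m, fiber_ncard f n m) is left e then projT1 (cid e) else 0.

Lemma gmap_fixed n (Y X : Gset F) (f : gmap Y X) y :
  fixed_points n y -> fixed_points n (f y).
Proof. by move=> yn g gn; rewrite -gm_equivariant // yn. Qed.

(** The normalizer of [G(n)] permutes the fixed points of [X] transitively, hence
    also the fibres above them. *)
Lemma fiber_countP (Y X : trGset F) (f : gmap Y X) :
  exists N, forall n, (N <= n)%N -> fiber_ncard f n (fiber_count f n).
Proof.
have [y0 _] := tr_transitive Y.
have [s sy] := core_exists (stabilizer y0).
have [s' sx] := core_exists (stabilizer (f y0)).
have [N sN] := coord_space_bound (s ++ s').
exists N => n Nn; rewrite /fiber_count; case: pselect => [e|[]]; first by case: cid.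
have {}sN : {subset s ++ s' <= coord_space n}.
  by move=> v /sN; exact: coord_spaceW.
have sn : {subset s <= coord_space n} by move=> v vs; rewrite sN // mem_cat vs.
have s'n : {subset s' <= coord_space n} by move=> v vs; rewrite sN // mem_cat vs orbT.
have y0n : fixed_points n y0.
  rewrite -[y0]gs_act1; apply/(fixed_core _ _ sy) => _ /mapP[v vs ->]; exact: sn.
have [m fm] : exists m, ncard (fun y : Y => fixed_points n y /\ f y = f y0) m.
  by apply: (@fixed_finite n) => y [].
exists m; split=> [|x xn]; first by exists (f y0); exact: gmap_fixed.
have [g xg] := tr_act (f y0) x.
rewrite xg in xn *; have [h hn ->] := fixed_transitive sx s'n xn.
apply: (ncard_bij (phi := gs_act h) _ _ _ fm).
- move=> y [yn yf]; split; first exact: normalizes_fixed.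
  by rewrite gm_equivariant // yf.
- by move=> y y' _ _ /(congr1 (gs_act h^-1%g)); rewrite !gs_actVK.
- move=> y [yn yf]; exists (gs_act h^-1%g y); last by rewrite gs_actKV.
  split; first by apply: normalizes_fixed => //; exact: normalizesV.
  by rewrite gm_equivariant // yf gs_actVK.
Qed.

Lemma fiber_ncard_uniq (Y X : Gset F) (f : gmap Y X) n m m' :
  fiber_ncard f n m -> fiber_ncard f n m' -> m = m'.
Proof. by move=> [[x xn] fm] [_ fm']; exact: ncard_uniq (fm x xn) (fm' x xn). Qed.

Lemma fiber_ncard_card (Y X : Gset F) (f : gmap Y X) n m :
  fiber_ncard f n m -> fiber_card f n m.
Proof. by move=> [xn fm]; split=> // x /fm/ncard_card. Qed.

Lemma fiber_count_iso (Y X : trGset F) (f : gmap Y X) : bijective f ->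
  exists N, forall n, (N <= n)%N -> fiber_count f n = 1%N.
Proof.
move=> [f' f'K fK']; have [N NP] := fiber_countP f; exists N => n /NP fn.
apply: (fiber_ncard_uniq fn); split; first by case: fn.
move=> x xn; exists unit, (fun=> f' x); split; rewrite ?card_unit //.
  by move=> [] [].
move=> y; split=> [[_ <-]|[_ <-]]; first by exists tt; rewrite f'K.
split=> // g gn; apply: (can_inj f'K).
by rewrite gm_equivariant // fK' xn.
Qed.

Lemma fiber_count_comp (Z Y X : trGset F) (f : gmap Y X) (g : gmap Z Y) :
  exists N, forall n, (N <= n)%N ->
    fiber_count (gcomp f g) n = (fiber_count f n * fiber_count g n)%N.
Proof.
have [Nf fP] := fiber_countP f; have [Ng gP] := fiber_countP g.
have [N NP] := fiber_countP (gcomp f g).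
exists (maxn N (maxn Nf Ng)) => n; rewrite !geq_max => /and3P[/NP nfg /fP nf /gP ng].
apply: (fiber_ncard_uniq nfg); split; first by case: nf.
move=> x xn; have [I [e [ei eP <-]]] := nf.2 x xn.
have en i : fixed_points n (e i) /\ f (e i) = x by apply/eP; exists i.
rewrite -sum_nat_const.
apply: (@ncard_bigU _ _ I (fun i z => fixed_points n z /\ g z = e i) (fun=> fiber_count g n)).
- move=> z /=; split=> [[zn zx]|[i [zn zi]]].
    have /eP[i ie] : fixed_points n (g z) /\ f (g z) = x.
      by split=> //; exact: gmap_fixed.
    by exists i.
  by split=> //; rewrite zi; case: (en i).
- by move=> i j z [_ zi] [_ zj]; apply: ei; rewrite -zi.
- by move=> i; apply: ng.2; case: (en i).
Qed.

Lemma fiber_count_base (Y X X' : trGset F) (f : gmap Y X) (h : gmap X' X)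
    m (r : 'I_m -> prod_gset Y X') :
  orbit_decomposition (fiber_product f h) r ->
  exists N, forall n, (N <= n)%N ->
    fiber_count f n = \sum_(i < m) fiber_count (orbit_snd (r i)) n.
Proof.
move=> [rS rP]; have [Nf fP] := fiber_countP f.
have [N NP] := choice (fun i => fiber_countP (orbit_snd (r i))).
have [x0 _] := tr_transitive X'.
have [s sx] := core_exists (stabilizer x0).
have [M sM] := coord_space_bound s.
exists (maxn M (maxn Nf (\max_i N i))) => n; rewrite !geq_max => /and3P[Mn /fP nf Nn].
have {}NP i : fiber_ncard (orbit_snd (r i)) n (fiber_count (orbit_snd (r i)) n).
  by apply: NP; apply: leq_trans Nn; exact: leq_bigmax.
have x0n : fixed_points n x0.
  rewrite -[x0]gs_act1; apply/(fixed_core _ _ sx) => _ /mapP[v vs ->].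
  exact: coord_spaceW Mn _ (sM _ vs).
pose A (p : prod_gset Y X') := [/\ fixed_points n p, f p.1 = h p.2 & p.2 = x0].
have fixp (p : prod_gset Y X') : fixed_points n p <-> fixed_points n p.1 /\ fixed_points n p.2.
  split=> [pn|[p1 p2] g gn]; last by rewrite [RHS]surjective_pairing /= p1 // p2.
  by split=> g gn; move: (pn g gn); case: p {pn} => y x /= [].
have Af : ncard A (fiber_count f n).
  apply: (ncard_bij (phi := fun y => (y, x0) : prod_gset Y X') _ _ _ (nf.2 _ (gmap_fixed h x0n))).
  - by move=> y [yn yf]; split=> //; apply/fixp.
  - by move=> y y' _ _ [].
  - by move=> [y x] [/fixp[/= yn _] yf xx]; exists y; rewrite /= ?xx //; split=> //; rewrite -xx.
apply: (ncard_uniq Af).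
apply: (@ncard_bigU _ _ _ (fun i p => A p /\ gs_orbit (r i) p)).
- move=> p; split=> [Ap|[i []] //]; have [_ pf _] := Ap.
  by have [i [ip _]] := rP p pf; exists i.
- move=> i j p [Ap ip] [_ jp]; have [_ pf _] := Ap; have [l [_ lu]] := rP p pf.
  by rewrite -(lu i) // -(lu j).
- move=> i; apply: (ncard_bij (phi := val) _ _ _ ((NP i).2 x0 x0n)).
  + move=> q [qn qx]; have [g _ gE] := set_valP q; split; last by exists g.
    split=> //; first by move=> k kn; have /(congr1 val) := qn k kn; rewrite sub_gsetE.
    by rewrite gE /= !gm_equivariant //; congr gs_act; exact: rS.
  + by move=> q q' _ _ /val_inj.
  + move=> p [[pn pf px] ip]; exists (SigSub (mem_set ip)) => //; split=> // k kn.
    by apply: val_inj; rewrite sub_gsetE // pn.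
Qed.

(** The points fixed by [G(n)] in an orbit of an open subgroup are the fibre of
    a map of transitive [G]-sets. *)
Definition orbit_map U (X : Gset F) (x : X) : gmap _ (coset_trset U) :=
  orbit_snd ((x, coset_pt U) : prod_gset X (coset_trset U)).

Lemma orbit_map_count U (X : Gset F) (x : res_gset U X) :
  exists N, forall n, (N <= n)%N ->
    ncard (fun y : X => gs_orbit x y /\ fixed_points n y) (fiber_count (orbit_map U x) n).
Proof.
have [N NP] := fiber_countP (orbit_map U x : gmap (orbit_trset _) (coset_trset U)).
have [s sU] := open_fixator U; have [M sM] := coord_space_bound s.
exists (maxn N M) => n; rewrite geq_max => /andP[/NP[_ nP] Mn].
have nU g : symp_fix n g -> U g.
  move=> /symp_fix_coord[_ gn]; apply: sU => v /sM vM; apply: gn.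
  exact: coord_spaceW vM.
have ptn : fixed_points n (coset_pt U) by move=> g /nU/coset_ptP.
apply: (ncard_bij (phi := fun q => (val q).1) _ _ _ (nP _ ptn)).
- move=> q [qn qx]; have [g _ gE] := set_valP q; split.
    by exists g; [apply/coset_ptP; rewrite -[RHS]qx /= gE|rewrite gE].
  by move=> k kn; have /(congr1 val) := qn k kn; rewrite sub_gsetE // => /(congr1 fst).
- move=> q q' [_ qx] [_ qx'] e; apply: val_inj.
  rewrite [LHS]surjective_pairing [RHS]surjective_pairing e; congr pair.
  exact: etrans qx (esym qx').
- move=> y [[g Ug ye] yn].
  have oy : gs_orbit ((x, coset_pt U) : prod_gset X (coset_trset U)) (y, coset_pt U).
    by exists g => //=; rewrite ye; congr pair; apply/esym/coset_ptP.
  exists (SigSub (mem_set oy)) => //; split=> // k kn.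
  by apply: val_inj; rewrite sub_gsetE //=; congr pair; [exact: yn|exact: ptn].
Qed.

Lemma vector_fixed n (v : V) : fixed_points n (v : vector_gset F) <-> v \in coord_space n.
Proof.
split=> [vn|vn g /symp_fix_coord[_]]; last exact.
rewrite -span_coord_basis; apply: contraT => /dual_vector[z zn zv].
have /vn/= : symp_fix n (transvection z 1) by apply/symp_fixP; exact: transvection_perp.
rewrite mul1r symp_formC zv scaleN1r => /(congr1 (fun w => - v + w)).
rewrite addKr addNr => /eqP; rewrite oppr_eq0 => /eqP z0.
by move: zv; rewrite z0 symp_form0l => /esym/eqP; rewrite oner_eq0.
Qed.

Lemma coord_space_card n : ncard (fun v : V => v \in coord_space n) (#|F| ^ (2 * n)).
Proof.
pose p (f : {ffun 'I_n -> F}) : {poly F} := \poly_(i < n) (if insub i is Some j then f j else 0).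
have pE f (i : 'I_n) : (p f)`_i = f i by rewrite coef_poly ltn_ord valK.
exists ({ffun 'I_n -> F} * {ffun 'I_n -> F})%type, (fun f => (p f.1, p f.2)); split.
- by move=> [f1 f2] [g1 g2] [/polyP e1 /polyP e2];
    congr pair; apply/ffunP => i; rewrite -!pE ?e1 ?e2.
- move=> v; split=> [|[f <-]]; last by rewrite inE !size_poly.
  rewrite inE => /andP[v1 v2].
  have key (q : {poly F}) : (size q <= n)%N -> p [ffun i : 'I_n => q`_i] = q.
    move=> qn; apply/polyP => i; rewrite coef_poly; case: ltnP => [ni|ni].
      by rewrite insubT ffunE.
    by rewrite nth_default // (leq_trans qn).
  by exists ([ffun i : 'I_n => v.1`_i], [ffun i : 'I_n => v.2`_i]); rewrite /= !key // -surjective_pairing.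
- by rewrite card_prod !card_ffun card_ord -expnD addnn mul2n.
Qed.

End FixedPoints.

(** * Ultraproduct measures *)

Section UltraMeasure.
Variables (F : finFieldType) (kappa : nat -> fieldType) (D : set_system nat).
Variables (UD : UltraFilter D) (D1 : forall n, ~ D [set n]).
Notation K := (ultraproduct kappa UD).
Notation cls := (ultra_class UD).
Implicit Types a b : forall n, kappa n.

Lemma ultra_ge N : D [set n | (N <= n)%N].
Proof.
elim: N => [|N IH]; first exact: filterE.
have [/D1//|DN] := in_ultra_setVsetC [set N] UD.
apply: filterS2 IH DN => n /= Nn nN; rewrite ltn_neqAle Nn andbT.
by apply/eqP => e; apply: nN.
Qed.

Lemma ultra_eq a b : (exists N, forall n, (N <= n)%N -> a n = b n) -> cls a = cls b.
Proof. by move=> [N ab]; apply/ultra_classP; apply: filterS (ultra_ge N) => n /ab. Qed.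

Lemma ultraD a b : cls a + cls b = cls (fun n => a n + b n).
Proof. exact: ultra_addE. Qed.

Lemma ultraM a b : cls a * cls b = cls (fun n => a n * b n).
Proof. exact: ultra_mulE. Qed.

Lemma ultraN a : - cls a = cls (fun n => - a n).
Proof. exact: ultra_oppE. Qed.

Lemma ultra_nat m : (m%:R : K) = cls (fun n => m%:R).
Proof.
elim: m => [//|m IH]; rewrite mulrS IH [LHS]ultraD; congr cls.
by apply: functional_extensionality_dep => n; rewrite mulrS.
Qed.

Lemma ultra_int (z : int) : (z%:~R : K) = cls (fun n => z%:~R).
Proof.
case: z => m; first by rewrite -[LHS]/(m%:R) ultra_nat.
by rewrite NegzE mulrNz -[X in - X]/(m.+1%:R) ultra_nat ultraN; congr cls;
  apply: functional_extensionality_dep => n; rewrite mulrNz.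
Qed.

Lemma ultra_sum m (f : 'I_m -> forall n, kappa n) :
  \sum_(i < m) cls (f i) = cls (fun n => \sum_(i < m) f i n).
Proof.
elim: m f => [|m IH] f.
  rewrite big_ord0 -[LHS]/(0%:R) ultra_nat; congr cls.
  by apply: functional_extensionality_dep => n; rewrite big_ord0.
rewrite big_ord_recr /= IH [LHS]ultraD; congr cls.
by apply: functional_extensionality_dep => n; rewrite big_ord_recr.
Qed.

Lemma ultra_horner (P : {poly int}) a :
  (map_poly intr P).[cls a] = cls (fun n => (map_poly intr P).[a n]).
Proof.
elim/poly_ind: P => [|P c IH].
  rewrite map_poly0 horner0 -[LHS]/(0%:R) ultra_nat; congr cls.
  by apply: functional_extensionality_dep => n; rewrite map_poly0 horner0.
have e (R : fieldType) (x : R) :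
    (map_poly intr (P * 'X + c%:P)).[x] = (map_poly intr P).[x] * x + c%:~R.
  by rewrite rmorphD /= rmorphM /= map_polyX map_polyC hornerMXaddC.
rewrite e IH ultra_int ultraM ultraD; congr cls.
by apply: functional_extensionality_dep => n; rewrite e.
Qed.

Lemma ultra_char0 : (forall p, prime p -> D [set n | (p%:R : kappa n) != 0]) ->
  [pchar K] =i pred0.
Proof.
move=> h p; rewrite !inE; apply/negbTE/negP => /andP[pp /eqP].
rewrite ultra_nat -[RHS]/(0%:R) ultra_nat => /ultra_classP e.
apply: (@filter_not_empty _ D _); apply: filterS2 (h p pp) e => n /=.
by move=> /eqP + e; apply.
Qed.

Definition ultra_measure_fun (Y X : trGset F) (f : gmap Y X) : K :=
  cls (fun n => (fiber_count f n)%:R).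

Fact ultra_measure_iso (Y X : trGset F) (f : gmap Y X) : bijective f ->
  ultra_measure_fun f = 1.
Proof.
move=> /fiber_count_iso[N fN]; rewrite -[RHS]/(1%:R) ultra_nat; apply: ultra_eq.
by exists N => n /fN ->.
Qed.

Fact ultra_measure_comp (Z Y X : trGset F) (f : gmap Y X) (g : gmap Z Y) :
  ultra_measure_fun (gcomp f g) = ultra_measure_fun f * ultra_measure_fun g.
Proof.
have [N fN] := fiber_count_comp f g; rewrite [RHS]ultraM; apply: ultra_eq.
by exists N => n /fN ->; rewrite natrM.
Qed.

Fact ultra_measure_base (Y X X' : trGset F) (f : gmap Y X) (h : gmap X' X)
    m (r : 'I_m -> prod_gset Y X') :
  orbit_decomposition (fiber_product f h) r ->
  ultra_measure_fun f = \sum_(i < m) ultra_measure_fun (orbit_snd (r i)).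
Proof.
move=> /fiber_count_base[N fN]; rewrite [RHS]ultra_sum; apply: ultra_eq.
by exists N => n /fN ->; rewrite natr_sum.
Qed.

Definition ultra_measure : measure F K :=
  Measure ultra_measure_iso ultra_measure_comp ultra_measure_base.

Lemma ultra_measureP : is_ultraproduct_measure ultra_measure.
Proof.
move=> Y X f; exists (fiber_count f) => //.
by have [N fN] := fiber_countP f; exists N => // n /fN/fiber_ncard_card.
Qed.

End UltraMeasure.

Section Count.
Variable F : finFieldType.
Notation V := (symp_space F).

Lemma decomposition_count (U : open_subgroup F) (X : Gset F) (S : set (res_gset U X)) m
    (r : 'I_m -> res_gset U X) : gs_stable S -> orbit_decomposition S r ->
  exists N, forall n, (N <= n)%N ->
    ncard (fun y : X => S y /\ fixed_points n y)
      (\sum_(i < m) fiber_count (orbit_map U (r i)) n).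
Proof.
move=> St [rS rP]; have [N NP] := choice (fun i => orbit_map_count (r i)).
exists (\max_i N i) => n Nn.
have {}NP i := NP i n (leq_trans (leq_bigmax i) Nn).
apply: (@ncard_bigU _ _ _ (fun i y => gs_orbit (r i) y /\ fixed_points n y)) => //.
- move=> y; split=> [[Sy yn]|[i [[g Ug ->] yn]]].
    by have [i [iy _]] := rP y Sy; exists i.
  by split=> //; apply: St.
- move=> i j y [[g Ug ye] _] [jy _].
  have Sy : S y by rewrite ye; exact: St.
  by have [l [_ lu]] := rP y Sy; rewrite -(lu i) ?(lu j) //; exists g.
Qed.

Lemma ultra_vec_vol kappa (D : set_system nat) (UD : UltraFilter D)
    (D1 : forall n, ~ D [set n]) :
  vec_vol (@ultra_measure F kappa D UD D1) =
  ultra_class UD (fun n => (#|F| ^ (2 * n))%:R : kappa n).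
Proof.
pose U := full_subgroup F.
have St : gs_stable (setT : set (res_gset U (vector_gset F))) by [].
have [m [r rP]] :=
  finite_orbits_decomposition (finitary_finite_orbits U (vector_finite_orbits F)) St.
rewrite (vec_vol_res _ U) (volE _ rP).
under eq_bigr do rewrite idx_orbit_snd.
rewrite [LHS]ultra_sum; apply: ultra_eq => //.
have [N NP] := decomposition_count St rP; exists N => n /NP Nn.
rewrite -natr_sum; congr _%:R; apply: (ncard_uniq Nn).
apply: ncard_eq (coord_space_card F n) => v; split=> [vn|[_ /vector_fixed]] //.
by split=> //; exact/vector_fixed.
Qed.

(** If the number of fixed points differed from the universal polynomial for
    infinitely many [n], an ultrafilter containing these [n] would yield a
    measure valued in an ultrapower of the rationals that contradicts
    universality. *)
Lemma universal_count (U : open_subgroup F) (X : Gset F) (x : res_gset U X) :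
  exists (P : {poly int}) (d N : nat), [/\ (0 < d)%N,
    forall k : fieldType, [pchar k] =i pred0 -> forall mu : measure F k,
      d%:R * idx mu U (stabilizer x) = (map_poly intr P).[vec_vol mu] &
    forall n, (N <= n)%N ->
      (d * fiber_count (orbit_map U x) n)%:R = P.[(#|F| ^ (2 * n))%:R] :> int].
Proof.
have Ux g : stabilizer x g -> U g by case.
have [P [d [d0 cP]]] := universal_idx Ux.
exists P, d; apply: contrapT => noN.
pose A n := (d * fiber_count (orbit_map U x) n)%:R <> P.[(#|F| ^ (2 * n))%:R] :> int.
have infA N : exists n, (N <= n)%N /\ A n.
  apply: contrapT => noA; apply: noN; exists N; split=> // n Nn.
  by apply: contrapT => An; apply: noA; exists n.
pose B N := [set n | (N <= n)%N /\ A n].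
have FB : ProperFilter (filter_from [set: nat] B).
  apply: filter_from_proper; last by move=> N _; have [n nA] := infA N; exists n.
  apply: filter_from_filter; first by exists 0%N.
  move=> i j _ _; exists (maxn i j) => // n [].
  by rewrite geq_max => /andP[ni nj] An; split; split.
have [D [UD DB]] := ultraFilterLemma FB.
have DN N : D (B N) by apply: DB; exists N.
have D1 n : ~ D [set n].
  move=> Dn; apply: (@filter_not_empty _ D _).
  by apply: filterS2 Dn (DN n.+1) => m /= -> []; rewrite ltnn.
pose kappa := fun _ : nat => rat : fieldType.
have K0 : [pchar (ultraproduct kappa UD)] =i pred0.
  apply: ultra_char0 => p pp; apply: filterE => n /=.
  by rewrite Num.Theory.pnatr_eq0 -lt0n prime_gt0.
have := cP _ K0 (@ultra_measure F kappa D UD D1).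
rewrite ultra_vec_vol ultra_horner // idx_orbit_snd ultra_nat [LHS]ultraM.
move=> /ultra_classP De; apply: (@filter_not_empty _ D _).
apply: filterS2 De (DN 0%N) => n /= e [_ An]; apply: An.
have {}e : d%:R * (fiber_count (orbit_map U x) n)%:R =
    (map_poly intr P).[(#|F| ^ (2 * n))%:R] :> rat := e.
rewrite -natrM in e.
set y := (#|F| ^ (2 * n))%N in e *.
set c := (_ * _)%N in e *.
apply: (@intr_inj rat).
rewrite -[RHS]horner_map.
rewrite [LHS]rmorph_nat.
rewrite e; congr (_.[_]).
by rewrite rmorph_nat.
Qed.

End Count.

(** * Extending specializations of fields *)

Section Relations.
Variables (R : comNzRingType) (k : fieldType) (al : {rmorphism R -> k}) (x : k).
Implicit Types P Q g : {poly R}.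
Local Notation "P ^a" := (map_poly al P) (at level 2, left associativity, format "P ^a").
Definition eval_at P := P^a.[x].

Lemma eval_atD P Q : eval_at (P + Q) = eval_at P + eval_at Q.
Proof. by rewrite /eval_at rmorphD hornerD. Qed.
Lemma eval_atM P Q : eval_at (P * Q) = eval_at P * eval_at Q.
Proof. by rewrite /eval_at rmorphM hornerM. Qed.
Lemma eval_atZ a P : eval_at (a *: P) = al a * eval_at P.
Proof. by rewrite /eval_at map_polyZ hornerZ. Qed.

Lemma size_mapped_poly P : (size P^a <= size P)%N.
Proof. by apply/leq_sizeP => j nj; rewrite coef_map /= nth_default ?rmorph0. Qed.

Lemma map_poly_truncate P : exists Q, [/\ Q^a = P^a, size Q = size P^a &
  P^a != 0 -> al (lead_coef Q) != 0].
Proof.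
pose Q := take_poly (size P^a) P; exists Q.
have QP : Q^a = P^a.
  apply/polyP => i; rewrite !coef_map /= coef_take_poly; case: ltnP => // ni.
  by rewrite rmorph0 -coef_map nth_default.
have sQ : size Q = size P^a.
  by apply/eqP; rewrite eqn_leq size_take_poly -{1}QP size_mapped_poly.
split=> // P0; rewrite lead_coefE sQ -coef_map QP -lead_coefE.
by rewrite lead_coef_eq0.
Qed.

Lemma pseudo_division (p P : {poly R}) : p != 0 -> exists m Q T,
  lead_coef p ^+ m *: P = Q * p + T /\ (size T < size p)%N.
Proof.
move=> p0; exists (Pdiv.Ring.rscalp P p), (Pdiv.Ring.rdivp P p), (Pdiv.Ring.rmodp P p).
by split; [exact: Pdiv.ComRing.rdivp_eq|rewrite Pdiv.Ring.ltn_rmodp].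
Qed.

(** A minimal polynomial of [x] over [R]. Degrees are those of the images in
    [k], since [al] may kill leading coefficients. *)
Definition minimal_relation p := [/\ al (lead_coef p) != 0, eval_at p = 0 &
  forall P, eval_at P = 0 -> (size P^a < size p)%N -> P^a = 0].

Lemma minimal_relation_exists P : P^a != 0 -> eval_at P = 0 ->
  exists p, minimal_relation p.
Proof.
move=> P0 Px.
pose A n := `[< exists P, [/\ P^a != 0, eval_at P = 0 & size P^a = n] >].
have exA : exists n, A n by exists (size P^a); apply/asboolP; exists P.
case: (ex_minnP exA) => n /asboolP[Q [Q0 Qx Qn]] nmin.
have [p [pQ sp lp]] := map_poly_truncate Q; exists p; split; first exact: lp.
  by rewrite /eval_at pQ.
move=> S Sx Ssz; apply/eqP; apply: contraLR Ssz => S0; rewrite -leqNgt sp Qn.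
by apply: nmin; apply/asboolP; exists S.
Qed.

Section Minimal.
Variables (p : {poly R}) (pmin : minimal_relation p).

Let p0 : p != 0.
Proof. by apply: contraTneq isT => e; case: pmin; rewrite e lead_coef0 rmorph0 eqxx. Qed.

Lemma minimal_relation_size : size p^a = size p.
Proof. by case: pmin => lp _ _; exact: size_map_poly_id0. Qed.

Lemma minimal_relation_gt1 : (1 < size p)%N.
Proof.
case: pmin => lp px _; rewrite ltnNge; apply: contraNN lp => /size1_polyC pE.
move: px; rewrite /eval_at pE map_polyC hornerC /= => pc.
by rewrite lead_coefC pc.
Qed.

Lemma minimal_relation_divides P : eval_at P = 0 ->
  exists m Q T, lead_coef p ^+ m *: P = Q * p + T /\ T^a = 0.
Proof.
move=> Px; have [m [Q [T [PE sT]]]] := pseudo_division P p0.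
exists m, Q, T; split=> //; have [_ px pm] := pmin; apply: pm.
  have := congr1 eval_at PE; rewrite eval_atZ eval_atD eval_atM px Px !mulr0 add0r.
  by move=> <-.
exact: leq_ltn_trans (size_mapped_poly T) sT.
Qed.

(** Bezout: an element of least degree in the ideal of [b] and [p] that does not
    vanish at [x] is a constant, for otherwise it would divide [p]. *)
Lemma minimal_relation_coprime b : eval_at b != 0 -> exists r U W Z,
  [/\ al r != 0, Z^a = 0 & r%:P = U * b + W * p + Z].
Proof.
move=> bx; have [lp px pm] := pmin.
pose I g := exists U W Z, Z^a = 0 /\ g = U * b + W * p + Z.
pose A n := `[< exists g, [/\ I g, eval_at g != 0 & size g^a = n] >].
have exA : exists n, A n.
  exists (size b^a); apply/asboolP; exists b; split=> //.
  by exists 1, 0, 0; rewrite rmorph0 mul1r mul0r !addr0.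
case: (ex_minnP exA) => n /asboolP[g' [g'I g'x g'n]] nmin.
have [g [gE sg lg]] := map_poly_truncate g'.
have gx : eval_at g != 0 by rewrite /eval_at gE.
have ga0 : g^a != 0 by apply: contraNneq gx => e; rewrite /eval_at e horner0.
have {}lg : al (lead_coef g) != 0 by apply: lg; rewrite -gE.
have gI : I g.
  have [U [W [Z [Z0 e]]]] := g'I; exists U, W, (Z + (g - g')).
  rewrite rmorphD rmorphB /= gE Z0 subrr addr0; split=> //.
  by rewrite addrA -e addrC subrK.
have least h : I h -> eval_at h != 0 -> (size g <= size h)%N.
  move=> hI hx; rewrite sg g'n; apply: leq_trans (size_mapped_poly h).
  by apply: nmin; apply/asboolP; exists h.
have red h q m Q T : I h -> I q -> lead_coef q ^+ m *: h = Q * q + T -> I T.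
  move=> [U [W [Z [Z0 hE]]]] [U' [W' [Z' [Z'0 qE]]]] e.
  exists (lead_coef q ^+ m *: U - Q * U'), (lead_coef q ^+ m *: W - Q * W').
  exists (lead_coef q ^+ m *: Z - Q * Z'); split.
    by rewrite rmorphB rmorphM /= map_polyZ Z0 Z'0 scaler0 mulr0 subr0.
  have -> : T = lead_coef q ^+ m *: h - Q * q by rewrite e addrC addKr.
  move: (lead_coef q ^+ m) => c; rewrite hE qE -!mul_polyC; ring.
have pI : I p by exists 0, 1, 0; rewrite rmorph0 mul1r mul0r !(add0r, addr0).
have g0 : g != 0 by apply: contraNneq ga0 => ->; rewrite rmorph0.
have gp : (size g < size p)%N.
  have [m [Q [T [e sT]]]] := pseudo_division g p0.
  apply: leq_ltn_trans sT; apply: (least T); first exact: red gI pI e.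
  have := congr1 eval_at e; rewrite eval_atZ eval_atD eval_atM px mulr0 add0r => <-.
  by rewrite mulf_neq0 // rmorphXn expf_neq0.
have [m [Q [T [e sT]]]] := pseudo_division p g0.
have Tx : eval_at T = 0.
  by apply: contraTeq sT => Tx; rewrite -leqNgt; apply: least => //; exact: red pI gI e.
have Ta : T^a = 0.
  by apply: pm => //; apply: leq_ltn_trans (size_mapped_poly T) (ltn_trans sT gp).
have Qx : eval_at Q = 0.
  have := congr1 eval_at e; rewrite eval_atZ eval_atD eval_atM px Tx mulr0 addr0.
  by move=> /esym/eqP; rewrite mulf_eq0 (negbTE gx) orbF => /eqP.
have eQ : al (lead_coef g) ^+ m *: p^a = Q^a * g^a.
  by have := congr1 (map_poly al) e; rewrite rmorphD rmorphM /= map_polyZ Ta addr0 rmorphXn.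
have pa0 : p^a != 0 by rewrite -size_poly_gt0 minimal_relation_size size_poly_gt0.
have Qa0 : Q^a != 0.
  apply: contraNneq pa0 => Q0; move: eQ; rewrite Q0 mul0r => /eqP.
  by rewrite scaler_eq0 expf_eq0 (negbTE lg) andbF.
have sg1 : (size g <= 1)%N.
  rewrite leqNgt; apply: contra_neqN (Qa0) => sg2; apply: pm => //.
  have e2 : size p^a = (size Q^a + size g^a).-1.
    by rewrite -(size_mul Qa0 ga0) -eQ size_scale // expf_neq0.
  rewrite -minimal_relation_size e2; move: sg2; rewrite sg -gE.
  by case: (size g^a) => [|[|j]] //= _; rewrite !addnS /= ltnS leq_addr.
have [U [W [Z [Z0 gE']]]] := gI.
exists g`_0, U, W, Z; split=> //; last by rewrite -gE' -size1_polyC.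
by move: lg; rewrite (size1_polyC sg1) lead_coefC coefC.
Qed.

(** Every relation satisfied by [x] is a pseudo-multiple of [p], so it holds at
    each root [xi] of the specialized [p] once the leading coefficient of [p]
    survives; and [b] does not vanish at [xi], because it is coprime to [p]. *)
Lemma minimal_relation_specialize b : eval_at b != 0 -> exists2 s, al s != 0 &
  forall (Om : fieldType) (ga : {rmorphism R -> Om}) (xi : Om),
    (forall a, al a = 0 -> ga a = 0) -> ga s != 0 -> (map_poly ga p).[xi] = 0 ->
    (forall P, eval_at P = 0 -> (map_poly ga P).[xi] = 0) /\ (map_poly ga b).[xi] != 0.
Proof.
move=> /minimal_relation_coprime[r [U [W [Z [r0 Z0 rE]]]]]; have [lp _ _] := pmin.
exists (lead_coef p * r); first by rewrite rmorphM mulf_neq0.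
move=> Om ga xi ker; rewrite rmorphM mulf_eq0 negb_or => /andP[glp gr] pxi.
have kill T : T^a = 0 -> map_poly ga T = 0.
  move=> Ta; apply/polyP => i; rewrite coef_map coef0; apply: ker.
  by rewrite -coef_map Ta coef0.
split=> [P /minimal_relation_divides[m [Q [T [e Ta]]]]|].
  have := congr1 (fun q => (map_poly ga q).[xi]) e.
  rewrite /= rmorphD rmorphM /= map_polyZ (kill T Ta) addr0 hornerM pxi mulr0 hornerZ.
  by move=> /eqP; rewrite mulf_eq0 rmorphXn expf_eq0 (negbTE glp) andbF => /eqP.
apply: contraNneq gr => bxi; have := congr1 (fun q => (map_poly ga q).[xi]) rE.
rewrite /= !rmorphD !rmorphM /= (kill Z Z0) addr0 hornerD !hornerM pxi bxi !mulr0 addr0.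
by rewrite map_polyC hornerC => /eqP.
Qed.

End Minimal.

(** If [x] is algebraic its image is a root of the specialized minimal
    polynomial; if not, any element off the roots of [b] will do. *)
Lemma specialize_step b : eval_at b != 0 -> exists2 s, al s != 0 &
  forall (Om : closedFieldType) (ga : {rmorphism R -> Om}),
    (forall a, al a = 0 -> ga a = 0) -> ga s != 0 ->
    exists xi, (forall P, eval_at P = 0 -> (map_poly ga P).[xi] = 0) /\
      (map_poly ga b).[xi] != 0.
Proof.
move=> bx.
have [[P [P0 Px]]|trans] := pselect (exists P, P^a != 0 /\ eval_at P = 0).
  have [p pmin] := minimal_relation_exists P0 Px; have [lp _ _] := pmin.
  have [s s0 sP] := minimal_relation_specialize pmin bx.
  exists (s * lead_coef p) => [|Om ga ker]; first by rewrite rmorphM mulf_neq0.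
  rewrite rmorphM mulf_eq0 negb_or => /andP[gs glp].
  have : size (map_poly ga p) != 1.
    by rewrite size_map_poly_id0 // neq_ltn minimal_relation_gt1 ?orbT.
  by move=> /closed_rootP[xi /eqP pxi]; exists xi; exact: sP.
have ba0 : b^a != 0 by apply: contraNneq bx => e; rewrite /eval_at e horner0.
exists b`_(size b^a).-1 => [|Om ga ker gs].
  by rewrite -coef_map -lead_coefE lead_coef_eq0.
have : map_poly ga b != 0.
  by apply: contraNneq gs => e; rewrite -coef_map e coef0.
move=> /closed_nonrootP[xi bxi]; exists xi; split=> // P Px.
have Pa : P^a = 0 by have [//|P0] := eqVneq P^a 0; case: trans; exists P.
suff -> : map_poly ga P = 0 by rewrite horner0.
by apply/polyP => i; rewrite coef_map coef0; apply: ker; rewrite -coef_map Pa coef0.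
Qed.

End Relations.

(** Chevalley's extension theorem: a specialization of [R] into an algebraically
    closed field extends to the ring generated by finitely many elements of [k],
    provided it does not kill a certain nonzero element. One element is added at
    a time; the element that must survive for the later ones is the [b] of
    [specialize_step]. *)
Lemma specialize_extend (k : fieldType) (l : seq k) (R : comNzRingType)
    (al : {rmorphism R -> k}) : exists2 s, al s != 0 &
  forall (Om : closedFieldType) (ga : {rmorphism R -> Om}),
    (forall a, al a = 0 -> ga a = 0) -> ga s != 0 ->
    exists (B : comNzRingType) (be : {rmorphism B -> k}) (de : {rmorphism B -> Om})
      (io : R -> B),
      [/\ forall a, be (io a) = al a, forall a, de (io a) = ga a,
          forall b, be b = 0 -> de b = 0 & forall x, x \in l -> exists b, be b = x].
Proof.
elim: l R al => [|x l IH] R al.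
  exists 1 => [|Om ga ker _]; first by rewrite rmorph1 oner_neq0.
  by exists R, al, ga, id.
pose ev : {rmorphism {poly R} -> k} := horner_morph (fun a => mulrC x (al a)).
have [b bx bP] := IH {poly R} ev.
have [s s0 sP] := specialize_step (bx : eval_at al x b != 0).
exists s => // Om ga ker gs; have [xi [xiP bxi]] := sP Om ga ker gs.
pose ge : {rmorphism {poly R} -> Om} := horner_morph (fun a => mulrC xi (ga a)).
have [B [be [de [io [beE deE kerB lB]]]]] := bP Om ge xiP bxi.
exists B, be, de, (io \o polyC); split=> //.
- by move=> a; rewrite /= beE /= /horner_morph map_polyC hornerC.
- by move=> a; rewrite /= deE /= /horner_morph map_polyC hornerC.
- move=> y; rewrite inE => /orP[/eqP->|/lB//].
  by exists (io 'X); rewrite beE /= /horner_morph map_polyX hornerX.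
Qed.

(** * Prime divisors of polynomial values *)

Lemma poly_nonroot (S : {poly int}) (u : nat -> int) : S != 0 -> injective u ->
  exists j, S.[u j] != 0.
Proof.
move=> S0 ui; apply: contrapT => no.
have : (size (mkseq u (size S)) < size S)%N.
  apply: max_poly_roots S0 _ _; last by apply/mkseq_uniqP => i j _ _ /ui.
  apply/allP => _ /mapP[j _ ->]; apply: contraT => /negP uj; case: no; exists j.
  exact/negP.
by rewrite size_mkseq ltnn.
Qed.

Lemma int_poly_sub (P : {poly int}) (x y : int) : (x - y %| P.[x] - P.[y])%Z.
Proof.
have /factor_theorem[Q e] : root (P - P.[y]%:P) y.
  by rewrite rootE hornerD hornerN hornerC subrr.
have := congr1 (fun p => p.[x]) e.
rewrite /= hornerM hornerD hornerN hornerC hornerXsubC => ->.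
exact: dvdz_mull.
Qed.

Section PrimeDivisors.
Import Num.Theory.
Variables (q : nat) (q1 : (1 < q)%N).
Local Notation v n := ((q ^ (2 * n))%:R : int).

Lemma even_power_inj : injective (fun n => v n).
Proof.
move=> i j /eqP; rewrite eqr_nat eqn_exp2l // => /eqP/eqP.
by rewrite eqn_mul2l => /eqP.
Qed.

(** The values of a polynomial at the even powers of [q] have infinitely many
    prime divisors: otherwise, along an arithmetic progression on which these
    values are constant modulo a large modulus, they would all divide a fixed
    nonzero integer. *)
Lemma prime_divisor_exists (p : {poly int}) (z : int) N :
  (1 < size p)%N -> p`_0 != 0 -> z != 0 ->
  exists n pr, [/\ (N <= n)%N, prime pr, ~~ (pr%:Z %| z)%Z & (pr%:Z %| p.[v n])%Z].
Proof.
move=> p1 c0 z0; apply: contrapT => no.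
have noP n pr : (N <= n)%N -> prime pr -> (pr%:Z %| p.[v n])%Z -> (pr%:Z %| z)%Z.
  by move=> Nn prp pn; apply: contraT => prz; case: no; exists n, pr.
(* from n1 on, the even powers of q exceed the constant coefficient *)
set c := p`_0 in c0; pose n1 := (N + `|c|)%N.
have pn0 : p != 0 by rewrite -size_poly_gt0; exact: ltnW.
have [j0 A0] : exists j, p.[v (n1 + j)] != 0.
  by apply: (poly_nonroot (u := fun j => v (n1 + j))) => // i j /even_power_inj/addnI.
pose n0 := (n1 + j0)%N; set A := p.[_] in A0.
pose m := `|(A * z)%R|%N; pose pi := [pred r : nat | ~~ (r %| q)%N].
have m0 : (0 < m)%N by rewrite absz_gt0 mulf_neq0.
(* by Euler's theorem q ^ (2 * (n0 + T * j)) does not depend on j modulo B *)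
pose B := (m`_pi)%N; pose T := totient B.
have T0 : (0 < T)%N by rewrite totient_gt0 part_gt0.
have qB : coprime q B.
  rewrite coprime_sym; apply: (@pnat_coprime pi); first exact: part_pnat.
  rewrite /pnat ltnW //; apply/allP => r; rewrite mem_primes => /and3P[_ _ rq].
  by rewrite !inE negbK.
pose C := `|(A * c)%R|%N.
have C0 : (0 < C)%N by rewrite absz_gt0 mulf_neq0.
(* S vanishes wherever the absolute value of p is at most C *)
pose S : {poly int} := \prod_(i < C.*2.+1) (p - (i%:Z - C%:Z)%:P).
have S0 : S != 0.
  apply/prodf_neq0 => i _; rewrite subr_eq0; apply: contraTneq p1 => ->.
  by rewrite -leqNgt size_polyC_leq1.
have [j Sj] : exists j, S.[v (n0 + T * j)] != 0.
  apply: (poly_nonroot (u := fun j => v (n0 + T * j))) => // i j /even_power_inj/addnI/eqP.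
  by rewrite eqn_mul2l eqn0Ngt T0 => /eqP.
set n := (n0 + T * j)%N in Sj; pose a := `|p.[v n]|%N.
have Ca : (C < a)%N.
  rewrite ltnNge; apply: contraNN Sj => aC.
  rewrite horner_prod; apply/eqP/eqP; rewrite -[_ == 0]negbK; apply/prodf_neq0.
  have h : (`|(p.[v n] + C%:Z)%R| < C.*2.+1)%N by rewrite /a in aC; lia.
  move=> /(_ (Ordinal h) isT)/negP; apply; rewrite hornerD hornerN hornerC /=.
  by apply/eqP; move: aC {h}; rewrite /a; move: p.[_] => y; lia.
suff : (a %| C)%N by move=> /dvdn_leq-/(_ C0); rewrite leqNgt Ca.
have a0 : (0 < a)%N by exact: leq_ltn_trans Ca.
apply/dvdn_partP => // pr; rewrite mem_primes => /and3P[prp _ pra].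
rewrite p_part; set e := logn pr a.
have n1n : (n1 <= n)%N by rewrite /n /n0 -addnA leq_addr.
have Nn : (N <= n)%N by apply: leq_trans n1n; rewrite leq_addr.
have prz : (pr%:Z %| z)%Z by apply: noP Nn prp _; rewrite dvdzE.
have pea : ((pr ^ e)%N%:Z %| p.[v n])%Z by rewrite dvdzE /= pfactor_dvdn.
have [prq|prq] := boolP (pr %| q)%N.
  have hc : (v n %| p.[v n] - c)%Z.
    by have := int_poly_sub p (v n) 0; rewrite subr0 horner_coef0.
  have pv i : (i <= 2 * n)%N -> ((pr ^ i)%N%:Z %| v n)%Z.
    by move=> i2n; rewrite dvdzE /= natz (dvdn_trans (dvdn_exp2l pr i2n)) // dvdn_exp2r.
  have pc i : (i <= 2 * n)%N -> (i <= e)%N -> (pr ^ i %| `|c|)%N.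
    move=> i2n ie; have h1 := dvdz_trans (pv i i2n) hc.
    have h2 : ((pr ^ i)%N%:Z %| p.[v n])%Z.
      by apply: dvdz_trans pea; rewrite dvdzE /= dvdn_exp2l.
    have : ((pr ^ i)%N%:Z %| c)%Z by rewrite -(rpredBl _ h2) //.
    by rewrite dvdzE.
  have e2n : (e <= 2 * n)%N.
    rewrite leqNgt; apply/negP => /ltnW h; have := pc _ (leqnn _) h.
    move=> /dvdn_leq; rewrite absz_gt0 c0 leqNgt => /(_ isT)/negP; apply.
    apply: leq_ltn_trans (ltn_expl (2 * n) (prime_gt1 prp)).
    by apply: leq_trans (leq_pmull n _) => //; apply: leq_trans n1n; rewrite leq_addl.
  by rewrite /C abszM dvdn_mull // pc.
have hA : (B%:Z %| p.[v n] - A)%Z.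
  apply: dvdz_trans (int_poly_sub p (v n) (v n0)).
  rewrite /n mulnDr expnD natrM -[X in _ - X]mulr1 -mulrBr dvdz_mull //.
  rewrite mulnCA expnM; set y := (_ ^ (2 * j))%N.
  have yB : (y = 1 %[mod B])%N.
    by rewrite /y -modnXm (Euler_exp_totient qB) modnXm exp1n.
  have y0 : (0 < y)%N by rewrite expn_gt0 expn_gt0 ltnW.
  have -> : y%:R - 1 = (y - 1)%N%:Z :> int by rewrite natz -subzn.
  by rewrite dvdzE /= -eqn_mod_dvd //; apply/eqP.
pose f := logn pr m.
have fB : (pr ^ f %| B)%N.
  rewrite -p_part; have -> : (m`_pr = m`_[predI pi & (pr : nat_pred)])%N.
    by apply: eq_partn => r; rewrite !inE /=; case: eqP => [->|]; rewrite ?prq ?andbF.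
  by rewrite partnI dvdn_part.
have pfA i : (i <= f)%N -> (i <= e)%N -> (pr ^ i %| `|A|)%N.
  move=> i_f ie; have h1 : ((pr ^ i)%N%:Z %| p.[v n] - A)%Z.
    by apply: dvdz_trans hA; rewrite dvdzE /= (dvdn_trans (dvdn_exp2l pr i_f)).
  have h2 : ((pr ^ i)%N%:Z %| p.[v n])%Z.
    by apply: dvdz_trans pea; rewrite dvdzE /= dvdn_exp2l.
  have : ((pr ^ i)%N%:Z %| A)%Z by rewrite -(rpredBl _ h2) //.
  by rewrite dvdzE.
have [ef|fe] := leqP e f; first by rewrite /C abszM dvdn_mulr // pfA.
have := pfA f (leqnn _) (ltnW fe).
rewrite pfactor_dvdn ?absz_gt0 // /f /m abszM lognM ?absz_gt0 //.
have lz : (0 < logn pr `|z|)%N.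
  by rewrite logn_gt0 mem_primes prp absz_gt0 z0 /= -[pr]/(`|pr%:Z|%N) -dvdzE.
by rewrite leqNgt -{1}[logn pr `|A|]addn0 ltn_add2l lz.
Qed.

End PrimeDivisors.

(** * Specializing t to even powers of q *)

Lemma intr_eq0_pchar0 (k : fieldType) (z : int) : [pchar k] =i pred0 ->
  (z%:~R == 0 :> k) = (z == 0).
Proof.
move=> /pcharf0P k0; case: z => n; first by rewrite -[_%:~R]/(n%:R) k0.
by rewrite NegzE mulrNz !oppr_eq0 -[_%:~R]/(n.+1%:R) k0.
Qed.

Lemma intr_eq0_pchar (k : fieldType) p (z : int) : p \in [pchar k] ->
  (z%:~R == 0 :> k) = (p%:Z %| z)%Z.
Proof.
move=> kp; case: z => n; first by rewrite -[_%:~R]/(n%:R) -(dvdn_pcharf kp) dvdzE.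
by rewrite NegzE mulrNz oppr_eq0 -[_%:~R]/(n.+1%:R) -(dvdn_pcharf kp) dvdzE abszN.
Qed.

(** Specializing [t] at an even power of [q]: if [t] is transcendental, any power
    that is not a root of [s] will do, in characteristic [0]; if [t] is algebraic,
    reduce modulo a prime that divides a value of its minimal polynomial. *)
Lemma specialize_power (k : fieldType) (t : k) (s : {poly int}) q N :
  [pchar k] =i pred0 -> t != 0 -> (1 < q)%N -> (map_poly intr s).[t] != 0 ->
  exists n, (N <= n)%N /\ exists Om : closedFieldType,
    (forall P : {poly int}, (map_poly intr P).[t] = 0 ->
       (map_poly intr P).[(q ^ (2 * n))%:R : Om] = 0) /\
    (map_poly intr s).[(q ^ (2 * n))%:R : Om] != 0.
Proof.
move=> k0 t0 q1 st; pose al : {rmorphism int -> k} := intr.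
have al0 z : al z = 0 -> z = 0 by move=> /eqP; rewrite intr_eq0_pchar0 // => /eqP.
have al_inj P : map_poly al P = 0 -> P = 0.
  by move=> /polyP Pa; apply/polyP => i; rewrite coef0; apply: al0; rewrite -coef_map Pa coef0.
have [[P [P0 Px]]|trans] := pselect (exists P, map_poly al P != 0 /\ eval_at al t P = 0).
  have [p pmin] := minimal_relation_exists P0 Px; have [lp px pm] := pmin.
  have [z z0 zP] := minimal_relation_specialize pmin st.
  have p0 : p`_0 != 0.
    apply/eqP => p00; have /factor_theorem[Q pE] : root p 0 by rewrite rootE horner_coef0 p00.
    have pne : p != 0 by rewrite -size_poly_gt0 ltnW // (minimal_relation_gt1 pmin).
    have Qne : Q != 0 by apply: contraNneq pne => Q0; rewrite pE Q0 mul0r.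
    rewrite subr0 in pE.
    have Qx : eval_at al t Q = 0.
      move: px; rewrite pE eval_atM => /eqP; rewrite mulf_eq0 /eval_at map_polyX hornerX.
      by rewrite (negbTE t0) orbF => /eqP.
    case/eqP: (Qne); apply: al_inj; apply: pm => //.
    have -> : size p = (size Q).+1 by rewrite pE size_mulX.
    exact: size_mapped_poly.
  have zne : z != 0 by apply: contraNneq z0 => ->; rewrite rmorph0.
  have [n [pr [Nn prp prz prn]]] :=
    prime_divisor_exists q1 N (minimal_relation_gt1 pmin) p0 zne.
  have [Om [io _]] := countable_algebraic_closure 'F_pr.
  have Omp : pr \in [pchar Om] by apply: (rmorph_pchar io); exact: pchar_Fp.
  exists n; split=> //; exists Om.
  pose ga : {rmorphism int -> Om} := intr.
  apply: (zP Om ga).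
  - by move=> a /al0->; rewrite rmorph0.
  - by rewrite /= (intr_eq0_pchar _ Omp).
  - by rewrite -(rmorph_nat ga) horner_map /=; apply/eqP; rewrite (intr_eq0_pchar _ Omp).
have s0 : s != 0 by apply: contraNneq st => ->; rewrite map_poly0 horner0.
have [j sj] : exists j, s.[(q ^ (2 * (N + j)))%:R] != 0.
  apply: (poly_nonroot (u := fun j => (q ^ (2 * (N + j)))%:R)) => // i j.
  by move=> /(even_power_inj q1)/addnI.
exists (N + j)%N; split; first exact: leq_addr.
exists algC; pose ga : {rmorphism int -> algC} := intr; split=> [P Px|].
  have -> : P = 0; last by rewrite map_poly0 horner0.
  by apply: al_inj; have [//|P0] := eqVneq (map_poly al P) 0; case: trans; exists P.
by rewrite -(rmorph_nat ga) horner_map /= intr_eq0.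
Qed.

(** A ring homomorphism to [Om] from the subring [S] of [k]; off [S] the values
    of [phi] are junk. *)
Record partial_hom (k Om : fieldType) (S : k -> Prop) (phi : k -> Om) : Prop := PartialHom {
  ph_1 : S 1 /\ phi 1 = 1;
  ph_N : forall x, S x -> S (- x) /\ phi (- x) = - phi x;
  ph_D : forall x y, S x -> S y -> S (x + y) /\ phi (x + y) = phi x + phi y;
  ph_M : forall x y, S x -> S y -> S (x * y) /\ phi (x * y) = phi x * phi y
}.

Lemma specialization_exists (k : fieldType) (t : k) (l : seq k) q N :
  [pchar k] =i pred0 -> t != 0 -> (1 < q)%N ->
  exists n, (N <= n)%N /\ exists (Om : fieldType) (S : k -> Prop) (phi : k -> Om),
    [/\ partial_hom S phi, S t, phi t = (q ^ (2 * n))%:R & forall x, x \in l -> S x].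
Proof.
move=> k0 t0 q1; pose ik : {rmorphism int -> k} := intr.
pose al : {rmorphism {poly int} -> k} := horner_morph (fun a => mulrC t (ik a)).
have [s s0 sP] := specialize_extend l al.
have [n [Nn [Om [ker gs]]]] := specialize_power N k0 t0 q1 s0.
exists n; split=> //; set xi := _%:R in ker gs.
pose io : {rmorphism int -> Om} := intr.
pose ga : {rmorphism {poly int} -> Om} := horner_morph (fun a => mulrC xi (io a)).
have [B [be [de [inc [beE deE kerB lB]]]]] := sP Om ga ker gs.
pose phi x := if pselect (exists b, be b = x) is left e then de (projT1 (cid e)) else 0.
have phiE b : phi (be b) = de b.
  rewrite /phi; case: pselect => [e|[]]; last by exists b.
  case: cid => b' /= bb'; apply/eqP; rewrite -subr_eq0 -rmorphB; apply/eqP/kerB.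
  by rewrite rmorphB bb' subrr.
exists Om, (fun x => exists b, be b = x), phi; split.
- split.
  + by split; [exists 1; rewrite rmorph1|rewrite -(rmorph1 be) phiE rmorph1].
  + move=> _ [b <-]; rewrite -(rmorphN be) !phiE.
    by split; [exists (- b)|exact: rmorphN].
  + move=> _ _ [b <-] [b' <-]; rewrite -(rmorphD be) !phiE.
    by split; [exists (b + b')|exact: rmorphD].
  + move=> _ _ [b <-] [b' <-]; rewrite -(rmorphM be) !phiE.
    by split; [exists (b * b')|exact: rmorphM].
- by exists (inc 'X); rewrite beE /= /horner_morph map_polyX hornerX.
- have <- : be (inc 'X) = t by rewrite beE /= /horner_morph map_polyX hornerX.
  by rewrite phiE deE /= /horner_morph map_polyX hornerX.
- exact: lB.
Qed.

Section PartialHom.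
Variables (k Om : fieldType) (S : k -> Prop) (phi : k -> Om) (ph : partial_hom S phi).

Lemma ph_0 : S 0 /\ phi 0 = 0.
Proof.
have [S1 _] := ph_1 ph; have [SN1 N1] := ph_N ph S1.
by have := ph_D ph S1 SN1; rewrite N1 !subrr.
Qed.

Lemma ph_int (z : int) : S z%:~R /\ phi z%:~R = z%:~R.
Proof.
have nat n : S n%:R /\ phi n%:R = n%:R.
  elim: n => [|n [Sn phin]]; first exact: ph_0.
  have [S1 p1] := ph_1 ph; have := ph_D ph S1 Sn.
  by rewrite p1 phin -!mulrS.
case: z => n; first exact: nat.
by have [Sn phin] := nat n.+1; have := ph_N ph Sn; rewrite phin NegzE !mulrNz.
Qed.

Lemma ph_sum (I : finType) (f : I -> k) : (forall i, S (f i)) ->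
  S (\sum_i f i) /\ phi (\sum_i f i) = \sum_i phi (f i).
Proof.
move=> Sf; elim/big_ind2: _ => [|x x' y y' [Sx <-] [Sy <-]|i _]; first exact: ph_0.
  exact: ph_D.
by split.
Qed.

Lemma ph_horner (P : {poly int}) x : S x ->
  S (map_poly intr P).[x] /\ phi (map_poly intr P).[x] = (map_poly intr P).[phi x].
Proof.
move=> Sx; elim/poly_ind: P => [|P c [SP IH]].
  by rewrite !map_poly0 !horner0; exact: ph_0.
have e (R : fieldType) (y : R) :
    (map_poly intr (P * 'X + c%:P)).[y] = (map_poly intr P).[y] * y + c%:~R.
  by rewrite rmorphD /= rmorphM /= map_polyX map_polyC hornerMXaddC.
have [SM pM] := ph_M ph SP Sx; have [Sc pc] := ph_int c.
by have := ph_D ph SM Sc; rewrite pM pc IH -!e.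
Qed.

End PartialHom.

(** * Nilpotent matrices and integrals *)

Lemma mulmx_iter_intertwine (K : fieldType) n r (A : 'M[K]_n) (B : 'M[K]_r) (C : 'M[K]_(n, r)) m :
  C *m B = A *m C -> C *m iter m (mulmx B) B = iter m (mulmx A) A *m C.
Proof.
move=> CB; elim: m => [//|m IH] /=.
by rewrite mulmxA CB -mulmxA IH mulmxA.
Qed.

(** A nilpotent matrix [C *m R] that is not invertible has the trace of the
    smaller nilpotent matrix [R *m C]. *)
Lemma nilpotent_trace (K : fieldType) n (A : 'M[K]_n) m :
  iter m (mulmx A) A = 0 -> \tr A = 0.
Proof.
have [b] := ubnP n; elim: b n A m => [//|b IH] n A m /ltnSE nb Am.
have [Afree|Adep] := boolP (row_free A).
  suff -> : A = 0 by rewrite mxtrace0.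
  have Au : A \in unitmx by rewrite -row_free_unit.
  by elim: m Am => //= m IHm /(congr1 (mulmx (invmx A))); rewrite mulKmx // mulmx0.
have rn : (\rank A < n)%N by rewrite ltn_neqAle rank_leq_row andbT.
pose C := col_base A; pose R := row_base A.
have CR : C *m R = A by exact: mulmx_base.
rewrite -CR mxtrace_mulC; apply: (IH _ _ m.+1); first exact: leq_trans rn nb.
have CB : C *m (R *m C) = A *m C by rewrite mulmxA CR.
by rewrite /= -mulmxA (mulmx_iter_intertwine m CB) Am mul0mx mulmx0.
Qed.

Section Integral.
Variables (F : finFieldType) (k : fieldType) (mu : measure F k).
Notation G := (symp_group F).

Lemma vol_set0 (U : open_subgroup F) (X : gset U) : vol mu (set0 : set X) = 0.
Proof.
have r0 : 'I_0 -> X by case.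
by rewrite (@volE _ _ mu _ _ _ _ r0) ?big_ord0 //; split=> // -[].
Qed.

Lemma integralE (U : open_subgroup F) (X : Gset F) (phi : X -> k) n
    (r : 'I_n -> res_gset U X) :
  orbit_decomposition setT r -> (forall g x, U g -> phi (gs_act g x) = phi x) ->
  integral mu U phi = \sum_(i < n) phi (r i) * idx mu U (stabilizer (r i)).
Proof.
move=> [_ rP] phiU; have Xf : finite_orbits (res_gset U X).
  by exists 'I_n, r => x; have [i [ix _]] := rP x I; exists i.
have orbP i x : gs_orbit (r i) x -> phi x = phi (r i) by move=> [g Ug ->]; exact: phiU.
pose w i := idx mu U (stabilizer (r i)).
have volc c : vol mu (phi @^-1` [set c] : set (res_gset U X))%classic =
    \sum_(i < n) if phi (r i) == c then w i else 0.
  pose T i : set (res_gset U X) := if phi (r i) == c then gs_orbit (r i) else set0.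
  rewrite (@vol_bigU _ _ mu _ _ 'I_n _ T) //.
  - apply: eq_bigr => i _; rewrite /T; case: eqP => _; last exact: vol_set0.
    by rewrite vol_orbit.
  - by move=> i; rewrite /T; case: eqP => _ //; exact: orbit_stable.
  - move=> x; split=> [xc|[i]].
      have [i [ix _]] := rP x I; exists i; rewrite /T ifT // -(orbP i x ix).
      exact/eqP.
    by rewrite /T; case: eqP => // <- /orbP.
  - move=> i j x; rewrite /T; case: eqP => // _ ix; case: eqP => // _ jx.
    by have [l [_ lu]] := rP x I; rewrite -(lu i) ?(lu j).
pose s := undup [seq c <- [seq phi (r i) | i <- enum 'I_n] | c != 0].
rewrite /integral -(@fsbig_widen _ _ _ _ [set` s]%classic); last first.
- move=> c [c0 cs].
  change (c * vol mu (phi @^-1` [set c] : set (res_gset U X))%classic = 0); rewrite volc big1 ?mulr0 // => i _; case: eqP => // e.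
  by case: cs; rewrite /s /= mem_undup mem_filter c0 -e map_f ?mem_enum.
- by move=> c /=; rewrite mem_undup mem_filter => /andP[].
rewrite -fsbig_seq ?undup_uniq //.
under eq_bigr do rewrite volc mulr_sumr.
rewrite exchange_big; apply: eq_bigr => i _ /=.
have [e|ne] := eqVneq (phi (r i)) 0.
  rewrite e mul0r big_seq big1 // => c; rewrite mem_undup mem_filter => /andP[c0 _].
  by rewrite eq_sym (negbTE c0) mulr0.
rewrite (bigD1_seq (phi (r i))) ?undup_uniq //=; last first.
  by rewrite mem_undup mem_filter ne map_f ?mem_enum.
by rewrite eqxx big1 ?addr0 // => c; rewrite eq_sym => /negbTE->; rewrite mulr0.
Qed.

End Integral.

(** * Transfer of matrix identities to finite matrices *)

Section Transfer.
Variables (F : finFieldType) (k : fieldType) (k0 : [pchar k] =i pred0) (mu : measure F k).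
Notation G := (symp_group F).

(** A specialization of [k] under which [mu] counts the points fixed by [G(n)],
    and which is defined at the elements of [l]. *)
Record counting_specialization (l : seq k) (n : nat) (Om : fieldType) (S : k -> Prop)
    (phi : k -> Om) : Prop := CountingSpecialization {
  cs_ph :> partial_hom S phi;
  cs_t : S (vec_vol mu) /\ phi (vec_vol mu) = (#|F| ^ (2 * n))%:R;
  cs_l : forall x, x \in l -> S x
}.

Lemma counting_specialization_sub l l' n (Om : fieldType) S (phi : k -> Om) :
  {subset l <= l'} -> counting_specialization l' n S phi -> counting_specialization l n S phi.
Proof. by move=> ll' [ph t lS]; split=> // x /ll'/lS. Qed.

Definition enum_fixed (X : Gset F) n (I : finType) (e : I -> X) :=
  injective e /\ forall x, fixed_points n x <-> exists i, e i = x.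

Lemma enum_fixed_exists (X : Gset F) : finite_orbits X ->
  exists N, forall n, (N <= n)%N -> exists (m : nat) (e : 'I_m -> X), enum_fixed n e.
Proof.
move=> Xf; have St : gs_stable (setT : set (res_gset (full_subgroup F) X)) by [].
have [m [r rP]] := finite_orbits_decomposition (finitary_finite_orbits (full_subgroup F) Xf) St.
have [N NP] := decomposition_count St rP.
exists N => n /NP[I [e [ei eX _]]].
exists #|I|, (e \o enum_val); split=> [i j /= /ei/enum_val_inj|x] //.
split=> [xn|[i <-]]; last by have [] := (eX _).2 (ex_intro _ (enum_val i) erefl).
have [i <-] := (eX x).1 (conj Logic.I xn).
by exists (enum_rank i); rewrite /= enum_rankK.
Qed.

(** Both the index and the number of fixed points are given by the polynomial of
    [universal_count], once its denominator is invertible. *)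
Lemma idx_transfer (U : open_subgroup F) (X : Gset F) (x : res_gset U X) :
  exists l N, forall n (Om : fieldType) S (phi : k -> Om), (N <= n)%N ->
    counting_specialization l n S phi ->
    S (idx mu U (stabilizer x)) /\
    phi (idx mu U (stabilizer x)) = (fiber_count (orbit_map U x) n)%:R.
Proof.
have [P [d [N [d0 cP Pn]]]] := universal_count x.
set w := idx _ _ _; have dk : d%:R != 0 :> k by rewrite (pcharf0P k).1 // -lt0n.
exists [:: d%:R^-1], N => n Om S phi Nn [ph [St phit] lS].
have Sd : S d%:R^-1 by apply: lS; rewrite inE.
have wE : w = d%:R^-1 * (map_poly intr P).[vec_vol mu] by rewrite -cP // mulKf.
have [SP phiP] := ph_horner ph P St.
have [Sw phiw] := ph_M ph Sd SP; rewrite wE; split=> //.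
rewrite phiw phiP phit.
have dd : phi d%:R^-1 * d%:R = 1.
  have [Sdd phid] : S d%:R /\ phi d%:R = d%:R := ph_int ph d.
  by rewrite -{1}phid -(ph_M ph Sd Sdd).2 mulVf // (ph_1 ph).2.
pose io : {rmorphism int -> Om} := intr.
have -> : (map_poly intr P).[(#|F| ^ (2 * n))%:R : Om] =
    (d * fiber_count (orbit_map U x) n)%:R.
  have := Pn n Nn; set y := (#|F| ^ _)%N; set c := (d * _)%N => Py.
  have -> : (y%:R : Om) = io y%:R by rewrite rmorph_nat.
  by rewrite horner_map -Py; exact: rmorph_nat.
by rewrite natrM mulrA dd mul1r.
Qed.

Lemma integral_transfer (U : open_subgroup F) (X : Gset F) : finite_orbits X ->
  exists l N, forall n (Om : fieldType) S (phi : k -> Om), (N <= n)%N ->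
    counting_specialization l n S phi ->
    forall f : X -> k, (forall g x, U g -> f (gs_act g x) = f x) -> (forall x, S (f x)) ->
    S (integral mu U f) /\
    forall (I : finType) (e : I -> X), enum_fixed n e ->
      phi (integral mu U f) = \sum_i phi (f (e i)).
Proof.
move=> Xf; have St : gs_stable (setT : set (res_gset U X)) by [].
have [m [r rP]] := finite_orbits_decomposition (finitary_finite_orbits U Xf) St.
have [l lP] := choice (fun i => idx_transfer (r i)).
have [N NP] := choice lP.
have [M MP] := choice (fun i => orbit_map_count (r i)).
exists (flatten [seq l i | i <- enum 'I_m]), (maxn (\max_i N i) (\max_i M i)).
move=> n Om S phi; rewrite geq_max => /andP[Nn Mn] cs f fU fS.
have {}NP i : S (idx mu U (stabilizer (r i))) /\
    phi (idx mu U (stabilizer (r i))) = (fiber_count (orbit_map U (r i)) n)%:R.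
  apply: (NP i); first exact: leq_trans (leq_bigmax i) Nn.
  apply: counting_specialization_sub cs => x xl; apply/flattenP.
  by exists (l i) => //; rewrite map_f ?mem_enum.
have {}MP i := MP i n (leq_trans (leq_bigmax i) Mn).
rewrite (integralE mu rP fU).
have SM i : S (f (r i) * idx mu U (stabilizer (r i))) /\
    phi (f (r i) * idx mu U (stabilizer (r i))) =
    phi (f (r i)) * (fiber_count (orbit_map U (r i)) n)%:R.
  by rewrite -(NP i).2; apply: (ph_M cs) => //; case: (NP i).
have [SS ->] := ph_sum cs (fun i => (SM i).1); split=> // I e [ei eX].
have [c cP] := choice (fun i : I => rP.2 (e i) Logic.I).
rewrite (partition_big c predT) //=; apply: eq_bigr => j _; rewrite (SM j).2.
have cj i : c i = j <-> gs_orbit (r j) (e i).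
  by have [ci cu] := cP i; split=> [<-|/cu].
rewrite (eq_bigr (fun=> phi (f (r j)))) => [|i /eqP/cj[g Ug ->]]; last by rewrite fU.
rewrite sumr_const mulr_natr; congr (_ *+ _); apply: (ncard_uniq (MP j)).
exists {i | c i == j}, (fun i => e (val i)); split.
- by move=> x y /ei/val_inj.
- move=> x; split=> [[xj /eX[i ix]]|[[i ij] <-]] /=.
    have ij : c i == j by apply/eqP/cj; rewrite ix.
    by exists (exist _ i ij).
  by split; [apply/cj/eqP|apply/eX; exists i].
- by rewrite card_sig; apply: eq_card.
Qed.

Lemma mulmx_gset_integrand (X : Gset F) (B A : X -> X -> k) z x :
  invariant_mx B -> invariant_mx A ->
  forall g y, stabilizer ((z, x) : prod_gset X X) g ->
    B z (gs_act g y) * A (gs_act g y) x = B z y * A y x.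
Proof.
move=> Bi Ai g y [_ /pair_equal_spec[gz gx]].
by have := Bi g z y; have := Ai g y x; rewrite gz gx => -> ->.
Qed.

(** Moving by [g] a decomposition for the stabilizer of [(z, x)] gives one for
    the stabilizer of [(g z, g x)]. *)
Lemma mulmx_gset_invariant (X : Gset F) (B A : X -> X -> k) : finite_orbits X ->
  invariant_mx B -> invariant_mx A -> invariant_mx (mulmx_gset mu B A).
Proof.
move=> Xf Bi Ai g z x; rewrite /mulmx_gset.
set U := stabilizer ((z, x) : prod_gset X X).
set U' := stabilizer ((gs_act g z, gs_act g x) : prod_gset X X).
have St : gs_stable (setT : set (res_gset U X)) by [].
have [m [r rP]] := finite_orbits_decomposition (finitary_finite_orbits U Xf) St.
pose r' i : res_gset U' X := gs_act g (r i).
have UU' h : U' h <-> U (g^-1 * h * g)%g.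
  have conj (y : X) : gs_act h (gs_act g y) = gs_act g y <-> gs_act (g^-1 * h * g)%g y = y.
    rewrite !gs_actM //; split=> [->|e]; first by rewrite -gs_actM // mulVg gs_act1.
    by rewrite -[in RHS]e gs_actKV.
  split=> -[_ /pair_equal_spec[/conj hz /conj hx]]; split=> //; exact/pair_equal_spec.
have r'P : orbit_decomposition setT r'.
  split=> // y _; have [i [[h Uh hE] iu]] := rP.2 (gs_act g^-1%g y) Logic.I.
  exists i; split=> [|j [h' U'h' h'E]].
    exists (g * h * g^-1)%g; first by apply/UU'; rewrite !mulgA mulVg mul1g -mulgA mulVg mulg1.
    rewrite /r' /= -gs_actM // -!mulgA mulVg mulg1 gs_actM //.
    by rewrite -[gs_act h _]hE gs_actKV.
  apply: iu; exists (g^-1 * h' * g)%g; first exact/UU'.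
  by rewrite h'E /r' /= -!gs_actM // !mulgA.
rewrite (integralE mu rP (mulmx_gset_integrand Bi Ai)).
rewrite (integralE mu r'P (mulmx_gset_integrand Bi Ai)).
apply: eq_bigr => i _; rewrite Bi Ai; congr (_ * _).
have stE (p : prod_gset X X) (y : X) : @stabilizer F (stabilizer p) (res_gset (stabilizer p) X) y =
    stabilizer ((p, y) : prod_gset (prod_gset X X) X).
  apply: osg_ext => h; split=> [[[_ hp] hy]|[_ /pair_equal_spec[hp hy]]]; split=> //.
  exact/pair_equal_spec.
rewrite !stE; apply: esym; exact: (idx_act mu ((z, x) : prod_gset X X) (r i : X) g).
Qed.

(** Matrix products over [X] specialize to products of finite matrices: this is
    [integral_transfer] at representatives of the orbits of pairs, carried to all
    pairs of fixed points by the normalizer of [G(n)]. *)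
Lemma mulmx_transfer (X : Gset F) : finite_orbits X ->
  exists l N, forall n (Om : fieldType) S (phi : k -> Om), (N <= n)%N ->
    counting_specialization l n S phi ->
    forall B A : X -> X -> k, invariant_mx B -> invariant_mx A ->
    (forall z x, S (B z x)) -> (forall z x, S (A z x)) ->
    (forall z x, S (mulmx_gset mu B A z x)) /\
    forall (I : finType) (e : I -> X), enum_fixed n e -> forall i j,
      phi (mulmx_gset mu B A (e i) (e j)) =
      \sum_h phi (B (e i) (e h)) * phi (A (e h) (e j)).
Proof.
move=> Xf; have [J [p pP]] := prod_finite_orbits Xf Xf.
have [l lP] := choice (fun j => integral_transfer (stabilizer (p j)) Xf).
have [N NP] := choice lP.
have [s sP] := choice (fun j => core_exists (stabilizer (p j))).
have [M sM] := choice (fun j => coord_space_bound (s j)).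
exists (flatten [seq l j | j <- enum J]), (maxn (\max_j N j) (\max_j M j)).
move=> n Om S phi; rewrite geq_max => /andP[Nn Mn] cs B A Bi Ai SB SA.
have sn j : {subset s j <= coord_space n}.
  move=> v /sM; apply: coord_spaceW; exact: leq_trans (leq_bigmax j) Mn.
have {}NP j : S (mulmx_gset mu B A (p j).1 (p j).2) /\
    forall (I : finType) (e : I -> X), enum_fixed n e ->
      phi (mulmx_gset mu B A (p j).1 (p j).2) =
      \sum_i phi (B (p j).1 (e i) * A (e i) (p j).2).
  have := NP j n Om S phi; rewrite {1 2 3}[p j]surjective_pairing; apply.
  - exact: leq_trans (leq_bigmax j) Nn.
  - apply: counting_specialization_sub cs => x xl; apply/flattenP.
    by exists (l j) => //; rewrite map_f ?mem_enum.
  - by move=> g x; exact: mulmx_gset_integrand.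
  - by move=> x; case: (ph_M cs (SB (p j).1 x) (SA x (p j).2)).
have Mi := mulmx_gset_invariant Xf Bi Ai.
split=> [z x|I e [ei eX] i j].
  by have [j [g _ [-> ->]]] := pP (z, x); rewrite Mi; case: (NP j).
have efix a : fixed_points n (e a) by apply/eX; exists a.
have [a [g _ ge]] := pP (e i, e j).
have gfix : fixed_points n (gs_act g (p a)).
  by rewrite -ge => h hn; rewrite /= !efix.
have [h hn hE] := fixed_transitive (sP a) (@sn a) gfix.
have [ez ex] : e i = gs_act h (p a).1 /\ e j = gs_act h (p a).2.
  by move: ge; rewrite hE => -[].
have e'P : enum_fixed n (fun b => gs_act h^-1%g (e b)).
  split=> [b c /(congr1 (gs_act h))|x]; first by rewrite !gs_actKV // => /ei.
  split=> [xn|[b <-]]; last by apply: normalizes_fixed => //; exact: normalizesV.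
  have /eX[b bE] := normalizes_fixed hn xn.
  by exists b; rewrite bE gs_actVK.
rewrite ez ex Mi ((NP a).2 _ _ e'P); apply: eq_bigr => b _.
have [_ ->] := ph_M cs (SB (p a).1 (gs_act h^-1%g (e b))) (SA (gs_act h^-1%g (e b)) (p a).2).
by rewrite -[in LHS](Bi h) -[in LHS](Ai h) gs_actKV.
Qed.

Lemma trace_transfer (X : Gset F) : finite_orbits X ->
  exists l N, forall n (Om : fieldType) S (phi : k -> Om), (N <= n)%N ->
    counting_specialization l n S phi ->
    forall A : X -> X -> k, invariant_mx A -> (forall z x, S (A z x)) ->
    forall (I : finType) (e : I -> X), enum_fixed n e ->
      phi (trace_gset mu A) = \sum_i phi (A (e i) (e i)).
Proof.
move=> Xf; have [l [N NP]] := integral_transfer (full_subgroup F) Xf.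
exists l, N => n Om S phi Nn cs A Ai SA I e eP.
have [_ h] := NP n Om S phi Nn cs (fun x => A x x) (fun g x _ => Ai g x x) (fun x => SA x x).
exact: h.
Qed.

Hypothesis t0 : vec_vol mu != 0.

Lemma counting_specialization_exists l N : exists n, (N <= n)%N /\
  exists (Om : fieldType) (S : k -> Prop) (phi : k -> Om), counting_specialization l n S phi.
Proof.
have q1 : (1 < #|F|)%N by exact: card_finNzRing_gt1.
have [n [Nn [Om [S [phi [ph St phit lS]]]]]] := specialization_exists l N k0 t0 q1.
by exists n; split=> //; exists Om, S, phi; split.
Qed.

(** A nilpotent matrix of nonzero trace would specialize, together with the
    inverse of its trace, to a nilpotent matrix of nonzero trace indexed by the
    finitely many points fixed by [G(n)]. *)
Lemma nil_condition_char0 : nil_condition mu.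
Proof.
move=> X /finitaryP Xf A Ai [m Am]; apply/eqP; apply: contraT => b0.
have [J [p pP]] := prod_finite_orbits Xf Xf.
have [l1 [N1 mulP]] := mulmx_transfer Xf.
have [l2 [N2 trP]] := trace_transfer Xf.
have [N3 enP] := enum_fixed_exists Xf.
pose l3 := [seq A (p j).1 (p j).2 | j <- enum J].
have [n [Nn [Om [S [phi cs]]]]] := counting_specialization_exists
  ([:: trace_gset mu A; (trace_gset mu A)^-1] ++ l1 ++ l2 ++ l3) (maxn N1 (maxn N2 N3)).
move: Nn; rewrite !geq_max => /and3P[Nn1 Nn2 Nn3].
have cs1 : counting_specialization l1 n S phi.
  by apply: counting_specialization_sub cs => x xl; rewrite !mem_cat xl orbT.
have cs2 : counting_specialization l2 n S phi.
  by apply: counting_specialization_sub cs => x xl; rewrite !mem_cat xl !orbT.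
have SA z x : S (A z x).
  have [j [g _ [-> ->]]] := pP (z, x); rewrite Ai; apply: (cs_l cs).
  by rewrite !mem_cat map_f ?mem_enum ?orbT.
have [r [e eP]] := enP n Nn3.
pose mat B : 'M[Om]_r := \matrix_(i, j) phi (B (e i) (e j)).
have iterP a : [/\ invariant_mx (iter a (mulmx_gset mu A) A),
    forall z x, S (iter a (mulmx_gset mu A) A z x) &
    mat (iter a (mulmx_gset mu A) A) = iter a (mulmx (mat A)) (mat A)].
  elim: a => [//|a [Bi SB BE]].
  have [SM ME] := mulP n Om S phi Nn1 cs1 _ _ Ai Bi SA SB.
  split=> //; first exact: mulmx_gset_invariant.
  rewrite [RHS]iterS -BE; apply/matrixP => i j; rewrite !mxE iterS (ME _ _ eP).
  by apply: eq_bigr => h _; rewrite !mxE.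
have [_ _ matm] := iterP m.
have tr0 : \tr (mat A) = 0.
  apply: (@nilpotent_trace _ _ _ m); rewrite -matm; apply/matrixP => i j.
  by rewrite !mxE Am (ph_0 cs).2.
have Sb : S (trace_gset mu A) by apply: (cs_l cs); rewrite inE eqxx.
have SbV : S (trace_gset mu A)^-1 by apply: (cs_l cs); rewrite !inE eqxx orbT.
have := (ph_M cs Sb SbV).2; rewrite mulfV // (ph_1 cs).2.
rewrite (trP n Om S phi Nn2 cs2 A Ai SA _ _ eP).
rewrite (eq_bigr (fun i => mat A i i)) => [|i _]; last by rewrite mxE.
by rewrite -[X in X * _]/(\tr (mat A)) tr0 mul0r => /eqP; rewrite oner_eq0.
Qed.

End Transfer.

(** * The equivalent ultraproduct measure *)

Section Equivalence.
Variables (F : finFieldType) (k : fieldType) (k0 : [pchar k] =i pred0) (mu : measure F k).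
Notation t := (vec_vol mu).
Hypothesis t0 : t != 0.

Definition nth_poly i : {poly int} := odflt 0 (unpickle i).

(** A single field can avoid only finitely many of the relations not satisfied by
    [t]; the bound [j] grows along the ultraproduct. *)
Definition approximates n (K : fieldType) j :=
  (forall P : {poly int}, (map_poly intr P).[t] = 0 ->
     (map_poly intr P).[(#|F| ^ (2 * n))%:R : K] = 0) /\
  (forall i, (i < j)%N -> (map_poly intr (nth_poly i)).[t] != 0 ->
     (map_poly intr (nth_poly i)).[(#|F| ^ (2 * n))%:R : K] != 0).

Lemma approximates_le n K i j : (i <= j)%N -> approximates n K j -> approximates n K i.
Proof. by move=> ij [h1 h2]; split=> // l li; apply: h2; exact: leq_trans ij. Qed.

Lemma approximates_exists j : exists n, (j <= n)%N /\ exists K : fieldType, approximates n K j.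
Proof.
pose l := [seq ((map_poly intr (nth_poly i)).[t])^-1 | i <- iota 0 j].
have [n [jn [Om [S [phi cs]]]]] := counting_specialization_exists k0 t0 l j.
have [St phit] := cs_t cs.
exists n; split=> //; exists Om; split=> [P Pt|i ij Pt]; rewrite -phit.
  by rewrite -(ph_horner cs P St).2 Pt (ph_0 cs).2.
have [SP <-] := ph_horner cs (nth_poly i) St.
have SV : S ((map_poly intr (nth_poly i)).[t])^-1.
  by apply: (cs_l cs); apply/mapP; exists i; rewrite ?mem_iota.
apply: contra_eq_neq (ph_1 cs).2 => e; rewrite -(mulfV Pt) (ph_M cs SP SV).2 e mul0r.
by rewrite eq_sym oner_neq0.
Qed.

(** One field for every [n]: the best one among the first [n] levels of
    approximation. *)
Lemma approximating_fields : exists kappa : nat -> fieldType, forall j N,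
  exists n, (N <= n)%N /\ approximates n (kappa n) j.
Proof.
have ex n : exists K : fieldType, forall j, (j <= n)%N ->
    (exists K', approximates n K' j) -> approximates n K j.
  suff: forall m, exists K : fieldType, forall j, (j <= m)%N ->
    (exists K', approximates n K' j) -> approximates n K j by apply.
  elim=> [|m [K KP]].
    have [[K K0]|no] := pselect (exists K', approximates n K' 0%N).
      by exists K => j; rewrite leqn0 => /eqP->.
    by exists k => j; rewrite leqn0 => /eqP->.
  have [[K' K'P]|no] := pselect (exists K', approximates n K' m.+1).
    by exists K' => j jm _; exact: approximates_le K'P.
  by exists K => j; rewrite leq_eqVlt => /orP[/eqP->//|]; exact: KP.
have [kappa kP] := choice ex; exists kappa => j N.
have [n [jn nP]] := approximates_exists (maxn j N).
have [jn' Nn] : (j <= n)%N /\ (N <= n)%N by apply/andP; rewrite -geq_max.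
exists n; split=> //; apply: approximates_le (leq_maxl j N) _.
exact: kP.
Qed.

(** For an ultrafilter containing the sets of [n] at which the chosen fields
    approximate to any given order, a polynomial vanishes at the ultraproduct of
    the [q ^ (2 * n)] if and only if it vanishes at [t]. *)
Lemma equivalent_ultraproduct_measure :
  exists (kappa : nat -> fieldType) (D : set_system nat) (UD : UltraFilter D),
    [/\ (forall n, ~ D [set n]),
        [pchar (ultraproduct kappa UD)] =i pred0 &
        exists2 nu : measure F (ultraproduct kappa UD),
          is_ultraproduct_measure nu & equivalent_measures mu nu].
Proof.
have [kappa kP] := approximating_fields.
pose B j := [set n | (j <= n)%N /\ approximates n (kappa n) j].
have FB : ProperFilter (filter_from [set: nat] B).
  apply: filter_from_proper; last by move=> j _; have [n nP] := kP j j; exists n.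
  apply: filter_from_filter; first by exists 0%N.
  move=> i j _ _; exists (maxn i j) => // n [].
  rewrite geq_max => /andP[ni nj] nP.
  split; split=> //; apply: approximates_le nP; [exact: leq_maxl|exact: leq_maxr].
have [D [UD DB]] := ultraFilterLemma FB.
have DN j : D (B j) by apply: DB; exists j.
have D1 n : ~ D [set n].
  move=> Dn; apply: (@filter_not_empty _ D _).
  by apply: filterS2 Dn (DN n.+1) => m /= -> []; rewrite ltnn.
have nz (P : {poly int}) : (map_poly intr P).[t] != 0 ->
    D [set n | (map_poly intr P).[(#|F| ^ (2 * n))%:R : kappa n] != 0].
  move=> Pt; apply: filterS (DN (pickle P).+1) => n [_ [_ h]].
  by have := h (pickle P) (leqnn _); rewrite /nth_poly pickleK; exact.
have K0 : [pchar (ultraproduct kappa UD)] =i pred0.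
  apply: ultra_char0 => p pp.
  have e (K : fieldType) (x : K) : (map_poly intr (p%:R%:P : {poly int})).[x] = p%:R.
    by rewrite map_polyC hornerC /= rmorph_nat.
  apply: filterS (nz p%:R%:P _) => [n|]; rewrite /= e //.
  by rewrite (pcharf0P k).1 // -lt0n prime_gt0.
exists kappa, D, UD; split=> //; exists (@ultra_measure F kappa D UD D1).
  exact: ultra_measureP.
move=> x; set nu := ultra_measure _ _ _ _.
have [P [d [d0 cP]]] := universal_theta (theta_repr x).
have zero (K : fieldType) (m : measure F K) : [pchar K] =i pred0 ->
    theta_hom m x = 0 <-> (map_poly intr P).[vec_vol m] = 0.
  move=> Kc; rewrite -(cP K Kc m) -[theta_eval m _]/(theta_hom m x).
  split=> [->|/eqP]; first by rewrite mulr0.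
  by rewrite mulf_eq0 (pcharf0P K).1 // -leqn0 leqNgt d0 => /eqP.
rewrite (zero k mu k0) (zero _ nu K0) ultra_vec_vol ultra_horner //.
rewrite -[X in _ <-> _ = X]/(0%:R) ultra_nat; split=> [Pt|/ultra_classP De].
  by apply/ultra_classP; apply: filterS (DN 0%N) => n [_ [h _]]; exact: h.
apply/eqP; apply: contraT => /nz Dn; exfalso; apply: (@filter_not_empty _ D _).
by apply: filterS2 De Dn => n /= ->; rewrite eqxx.
Qed.

End Equivalence.

Theorem proposition8p14 (F : finFieldType) (k : fieldType)
    (hk : [pchar k] =i pred0) (t : k) (ht : t != 0)
    (mu : measure F k) (hmu : vol mu [set: vector_gset F] = t) :
  (exists (kappa : nat -> fieldType) (D : set_system nat) (UD : UltraFilter D),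
    [/\ (forall n, ~ D [set n]),
        [pchar (ultraproduct kappa UD)] =i pred0 &
        exists2 nu : measure F (ultraproduct kappa UD),
          is_ultraproduct_measure nu & equivalent_measures mu nu]) /\
  nil_condition mu.
Proof.
have t0 : vec_vol mu != 0 by rewrite /vec_vol hmu.
split; first exact: (equivalent_ultraproduct_measure hk t0).
exact: (nil_condition_char0 hk t0).
Qed.
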